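(* Let $d\ge 1$, let $\Lambda$ be a weight function, $\Psi$ an approximating function, $\kappa\in(0,1)$, and let $\omega\in\mathbb{R}^d$ be rationally independent with $\sup_i|\omega_i|\le 1$ and $\omega\in BR(\kappa)$ (the $\Lambda$-Brjuno-Rüssmann condition, see context). Let $r_0>0$, $A_0\in sl(2,\mathbb{R})$ and $F_0\in U_{r_0}(\mathbb{T}^d,sl(2,\mathbb{R}))$. Then there exists $\varepsilon_0>0$ depending only on $A_0,\kappa,\Lambda,\Psi,r_0$ such that, if $|F_0|_{r_0}\le\varepsilon_0$, then there exist $\zeta\in(0,\tfrac18)$ and, for every $0<\varepsilon\le\varepsilon_0$, \begin{itemize} \item $r_\varepsilon>0$, \item $Z_\varepsilon\in U_{r_\varepsilon}(\mathbb{T}^d,SL(2,\mathbb{R}))$, \item $A_\varepsilon\in sl(2,\mathbb{R})$, \item $\bar A_\varepsilon,\bar F_\varepsilon\in U_{r_\varepsilon}(\mathbb{T}^d,sl(2,\mathbb{R}))$, \item $\psi_\varepsilon\in U_{r_\varepsilon}(2\mathbb{T}^d,SL(2,\mathbb{R}))$, \end{itemize} such that \begin{enumerate} \item $\bar A_\varepsilon$ is reducible to $A_\varepsilon$ by $\psi_\varepsilon$, with $|\psi_\varepsilon|_{r_\varepsilon}\le\varepsilon^{-\frac12\zeta}$; \item $|\bar F_\varepsilon|_{r_\varepsilon}\le\varepsilon$; \item $\lim_{\varepsilon\to0}r_\varepsilon>0$; \item for all $\theta\in\mathbb{T}^d$, $\partial_\omega Z_\varepsilon(\theta)=(A_0+F_0(\theta))Z_\varepsilon(\theta)-Z_\varepsilon(\theta)(\bar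 A_\varepsilon(\theta)+\bar F_\varepsilon(\theta))$; \item $|Z_\varepsilon^{\pm1}-Id|_{r_\varepsilon}\le\varepsilon_0^{9/10}$. \end{enumerate} Moreover, either $\psi_\varepsilon$ becomes constant as $\varepsilon\to0$ (i.e. $\psi_\varepsilon$ does not depend on $\varepsilon$ for all sufficiently small $\varepsilon$), or there exist arbitrarily small $\varepsilon$ such that $\|A_\varepsilon\|\le\kappa\varepsilon^\zeta$.
   Context: Notation: $\mathbb{T}^d=\mathbb{R}^d/\mathbb{Z}^d$, $2\mathbb{T}^d=\mathbb{R}^d/2\mathbb{Z}^d$; functions on $\mathbb{T}^d$ are also viewed as functions on $2\mathbb{T}^d$. For $k\in\frac12\mathbb{Z}^d$, $|k|$ is the sum of the absolute values of the components of $k$. $\|\cdot\|$ on matrices is the largest absolute value of a coefficient. $\partial_\omega Z(\theta)=\frac{d}{dt}\big|_{t=0}Z(\theta+t\omega)$. Rationally independent means that $\langle k,\omega\rangle\ne0$ for all $k\in\mathbb{Z}^d\setminus\{0\}$. Weight function: $\Lambda:[0,+\infty)\to[0,+\infty)$ increasing, differentiable and subadditive: $\Lambda(x+y)\le\Lambda(x)+\Lambda(y)$ for all $x,y\ge0$. Ultradifferentiable classes: for $r>0$, $U_r(\mathbb{T}^d,E)$ is the set of functions $F:\mathbb{T}^d\to E$, $F(\theta)=\sum_{k\in\mathbb{Z}^d}\hat F(k)e^{2i\pi\langle k,\theta\rangle}$, with $|F|_r:=\sum_{k}\|\hat F(k)\|e^{2\pi\Lambda(|k|)r}<\infty$. $U_r(2\mathbb{T}^d,E)$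 and $|\cdot|_r$ are defined in the same way, with Fourier series indexed by $k\in\frac12\mathbb{Z}^d$. Approximating function: $\Psi:[0,+\infty)\to[0,+\infty)$ increasing, differentiable, with $\Psi(x)\ge x$ for all $x$ and $\Psi(x+y)\ge\Psi(x)+\Psi(y)$ for all $x,y\ge1$. Condition $\omega\in BR(\kappa)$: $|\langle k,\omega\rangle|\ge\frac{\kappa}{\Psi(|k|)}$ for all $k\in\mathbb{Z}^d\setminus\{0\}$, and moreover $\lim_{t\to+\infty}\frac{\log\Psi(t)}{\Lambda(t)}=0$ and $\int^{+\infty}\frac{\Lambda'(t)\ln\Psi(t)}{\Lambda(t)^2}\,dt<+\infty$ (convergence at $+\infty$). Reducibility: $\bar A:\mathbb{T}^d\to sl(2,\mathbb{R})$ is reducible to the constant $B\in sl(2,\mathbb{R})$ by $\psi:2\mathbb{T}^d\to SL(2,\mathbb{R})$ if $\partial_\omega\psi(\theta)=\bar A(\theta)\psi(\theta)-\psi(\theta)B$ for all $\theta\in2\mathbb{T}^d$. *)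

(* Defs.v *)
From mathcomp Require Import all_boot all_order all_algebra finmap.
From mathcomp Require Import all_classical all_reals all_analysis.
From mathcomp Require Import complex.
From mathcomp.analysis.showcase Require summability.
From mathcomp Require Import lra.

Set Implicit Arguments.
Unset Strict Implicit.
Unset Printing Implicit Defensive.
Import Order.TTheory GRing.Theory Num.Theory.
Import numFieldNormedType.Exports.
Local Open Scope classical_set_scope.
Local Open Scope ring_scope.

(* [R[i]] itself carries no topology; the topology of a [numFieldType] is
   found once the head symbol is that of a [numClosedFieldType]. *)
Definition Cplx (R : realType) : numClosedFieldType := R[i].

Section Ultradifferentiable.
Context {R : realType}.
Implicit Types (f L Psi : R -> R) (r : R).

(* Differentiability on [0, +oo[, one-sided at 0. *)
Definition differentiable_nonneg f : Prop :=
  forall x, 0 <= x ->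
    cvg ((f y - f x) / (y - x) @[y --> within [set y | 0 <= y] x^']).

Definition increasing_nonneg f : Prop :=
  forall x y, 0 <= x -> x < y -> f x < f y.

Definition weight_function L : Prop :=
  [/\ forall x, 0 <= x -> 0 <= L x,
      increasing_nonneg L,
      differentiable_nonneg L
    & forall x y, 0 <= x -> 0 <= y -> L (x + y) <= L x + L y].

Definition approximating_function Psi : Prop :=
  [/\ increasing_nonneg Psi,
      differentiable_nonneg Psi,
      forall x, 0 <= x -> x <= Psi x
    & forall x y, 1 <= x -> 1 <= y -> Psi x + Psi y <= Psi (x + y)].

Section Dimension.
Context {d : nat}.
Implicit Types (u v theta omega : 'rV[R]_d) (k : 'rV[int]_d) (p : nat).

Definition dot u v : R := \sum_i u 0 i * v 0 i.

Definition norm1 u : R := \sum_i `|u 0 i|.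

Definition rvint k : 'rV[R]_d := map_mx intr k.

Definition rationally_independent omega : Prop :=
  forall k, k != 0 -> dot (rvint k) omega != 0.

Definition brjuno_russmann L Psi (kappa : R) omega : Prop :=
  [/\ forall k, k != 0 ->
        kappa / Psi (norm1 (rvint k)) <= `|dot (rvint k) omega|,
      ln (Psi t) / L t @[t --> +oo] --> 0
    & exists2 a : R, 0 < a &
        (@lebesgue_measure R).-integrable `[a, +oo[
          (fun t => (derive1 L t * ln (Psi t) / L t ^+ 2)%:E)].

(* A function on the torus R^d / p Z^d is a function on R^d whose Fourier
   frequencies are the k / p with k in Z^d: p = 1 for T^d, p = 2 for 2T^d.
   Such a function is p Z^d-periodic. *)
Definition freq p k : 'rV[R]_d := p%:R^-1 *: rvint k.

(* exp (2 i pi x) *)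
Definition expi2pi (x : R) : Cplx R :=
  (cos (2 * pi * x) +i* sin (2 * pi * x))%C.

Definition cmxnorm (M : 'M[Cplx R]_2) : R :=
  \big[Num.max/0]_(ij : 'I_2 * 'I_2) ComplexField.Normc.normc (M ij.1 ij.2).

(* F is real, its Fourier coefficients c are complex; [summability.totally]
   is the filter of unconditional convergence. *)
Definition fourier_expansion p (F : 'rV[R]_d -> 'M[R]_2)
    (c : 'rV[int]_d -> 'M[Cplx R]_2) : Prop :=
  (\esum_(k in [set: 'rV[int]_d]) (cmxnorm (c k))%:E < +oo)%E /\
  forall theta,
    summability.partial_sum (fun k => expi2pi (dot (freq p k) theta) *: c k)
      @ summability.totally -->
    (map_mx (real_complex R) (F theta) : 'M[Cplx R]_2).

Definition fourier_coef p (F : 'rV[R]_d -> 'M[R]_2) :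
    'rV[int]_d -> 'M[Cplx R]_2 :=
  xget (fun=> 0) [set c | fourier_expansion p F c].

(* The coefficients are unique: see [fourier_coefE] below.
   |F|_r, with value +oo for functions that are not the sum of an absolutely
   convergent Fourier series. *)
Definition unorm p L r (F : 'rV[R]_d -> 'M[R]_2) : \bar R :=
  if `[< exists c, fourier_expansion p F c >] then
    (\esum_(k in [set: 'rV[int]_d])
      (cmxnorm (fourier_coef p F k) *
       expR (2 * pi * L (norm1 (freq p k)) * r))%:E)%E
  else +oo%E.

(* U_r (p T^d, E) *)
Definition ultradiff p L r (E : set 'M[R]_2) (F : 'rV[R]_d -> 'M[R]_2) : Prop :=
  (forall theta, E (F theta)) /\ (unorm p L r F < +oo)%E.

Definition sl2 : set 'M[R]_2 := [set A | \tr A = 0].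
Definition SL2 : set 'M[R]_2 := [set A | \det A = 1].

Definition reducible omega (A : 'rV[R]_d -> 'M[R]_2) (B : 'M[R]_2)
    (psi : 'rV[R]_d -> 'M[R]_2) : Prop :=
  forall theta,
    is_derive theta omega psi (A theta *m psi theta - psi theta *m B).

End Dimension.
End Ultradifferentiable.

(* Uniqueness of the Fourier coefficients, by averaging over the grids
   (p / N) {0, ..., N - 1}^d with N large. *)
Section FourierUniqueness.
Context {R : realType}.
Implicit Types (x y : R).

Lemma esum_tail (T : choiceType) (a : T -> R) (e : R) :
  (forall k, 0 <= a k) -> (\esum_(k in [set: T]) (a k)%:E < +oo)%E -> 0 < e ->
  exists S : {fset T}, forall J : {fset T}, [disjoint J & S]%fset ->
    \sum_(k <- J) a k < e.
Proof.
move=> a0 afin e0.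
have fs (J : {fset T}) :
    (\sum_(k \in [set` J]) (a k)%:E = (\sum_(k <- J) a k)%:E)%E.
  by rewrite fsbig_finite//= set_fsetK sumEFin.
have sfin : (\esum_(k in [set: T]) (a k)%:E)%E \is a fin_num.
  by rewrite ge0_fin_numE// esum_ge0// => k _; rewrite lee_fin.
have [_ [X [finX _] <-]] := ub_ereal_sup_adherent e0 sfin.
rewrite -/(esum _ _) -[X](fset_setK finX) fs => ltX.
exists (fset_set X) => J dJ.
have : ((\sum_(k <- (fset_set X `|` J)%fset) a k)%R%:E
    <= \esum_(k in [set: T]) (a k)%:E)%E.
  by apply: esum_ge; exists [set` (fset_set X `|` J)%fset]; [split|rewrite fs].
have -> : \sum_(k <- (fset_set X `|` J)%fset) a k =
    \sum_(k <- fset_set X) a k + \sum_(k <- J) a k.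
  rewrite -big_cat; apply: perm_big; apply: uniq_perm.
  - exact: fset_uniq.
  - rewrite cat_uniq !fset_uniq andbT/=; apply/hasPn => k kJ.
    exact: fdisjointP dJ _ kJ.
  - by move=> k; rewrite mem_cat inE.
move: ltX; rewrite -(fineK sfin) -EFinB lte_fin lee_fin.
lra.
Qed.

Lemma expi2piD x y : expi2pi (x + y) = expi2pi x * expi2pi y.
Proof. by rewrite /expi2pi mulrDr cosD sinD; simpc; rewrite (addrC (sin _ * _)). Qed.

Lemma expi2pi0 : expi2pi (0 : R) = 1.
Proof. by rewrite /expi2pi mulr0 cos0 sin0. Qed.

Lemma expi2pi1 : expi2pi (1 : R) = 1.
Proof. by rewrite /expi2pi mulr1 mulr_natl cos2pi sin2pi. Qed.

Lemma expi2piM x n : expi2pi (x * n%:R) = expi2pi x ^+ n.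
Proof.
elim: n => [|n IH]; first by rewrite mulr0 expi2pi0.
by rewrite -natr1 mulrDr mulr1 expi2piD IH exprSr.
Qed.

Lemma expi2piN x : expi2pi x * expi2pi (- x) = 1.
Proof. by rewrite -expi2piD subrr expi2pi0. Qed.

Lemma expi2pi_int (q : int) : expi2pi (q%:~R : R) = 1.
Proof.
have e (n : nat) : expi2pi (n%:R : R) = 1.
  by rewrite -[n%:R]mul1r expi2piM expi2pi1 expr1n.
case: q => n; first by rewrite e.
by rewrite NegzE mulrNz -[LHS]mul1r -(e n.+1) expi2piN.
Qed.

Lemma norm_expi2pi x : `|expi2pi x| = 1.
Proof.
rewrite /expi2pi/=; congr (_ +i* _)%C => //=.
by rewrite cos2Dsin2 sqrtr1.
Qed.

Lemma expi2pi_neq1 x : x != 0 -> -1 < x < 1 -> expi2pi x != 1.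
Proof.
move=> x0 /andP[x1 x2]; apply/eqP => /(congr1 (@complex.Re R))/=.
rewrite /expi2pi/= => h.
have s0 : sin (pi * x) = 0.
  have : cos (2 * pi * x) = 1 - 2 * sin (pi * x) ^+ 2.
    have -> : 2 * pi * x = pi * x + pi * x by lra.
    rewrite cosD; have := cos2Dsin2 (pi * x).
    rewrite !expr2; lra.
  rewrite h => hs; apply/eqP; rewrite -sqrf_eq0; apply/eqP; lra.
have p0 := pi_gt0 R.
have [xp|xn|/eqP] := ltgtP x 0; last by rewrite (negPf x0).
- have : 0 < sin (pi * - x).
    by apply: sin_gt0_pi; rewrite pmulr_rgt0// gtr_pMr// oppr_gt0 xp/=; lra.
  by rewrite mulrN sinN s0 oppr0 ltxx.
- have : 0 < sin (pi * x).
    by apply: sin_gt0_pi; rewrite pmulr_rgt0// gtr_pMr// xn.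
  by rewrite s0 ltxx.
Qed.

Lemma sum_expi2pi_root (N : nat) (q : int) : q != 0 -> (`|q| < N)%N ->
  \sum_(j < N) expi2pi (q%:~R * (j%:R / N%:R) : R) = 0.
Proof.
move=> q0 qN; have N0 : (0 < N)%N by rewrite (leq_ltn_trans _ qN).
have NR : (N%:R : R) != 0 by rewrite pnatr_eq0 -lt0n.
set w := expi2pi (q%:~R / N%:R : R).
under eq_bigr => j _ do rewrite mulrCA mulrC expi2piM.
have w1 : w != 1.
  apply: expi2pi_neq1; first by rewrite mulf_neq0 ?invr_eq0// intr_eq0.
  rewrite -ltr_norml normrM normfV (ger0_norm (ler0n R N)).
  by rewrite ltr_pdivrMr ?ltr0n// mul1r -intr_norm -abszE ltr_nat.
have := subrX1 w N; rewrite -expi2piM mulfVK// expi2pi_int subrr => /esym/eqP.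
by rewrite mulf_eq0 subr_eq0 (negPf w1) => /eqP.
Qed.

End FourierUniqueness.

Section FourierCoefficients.
Context {R : realType}.
Implicit Types (x y : R).

#[local] Existing Instance summability.totally_filter.

Lemma norm_CplxE (z : Cplx R) :
  `|z| = real_complex R (ComplexField.Normc.normc z) :> Cplx R.
Proof. by []. Qed.

Lemma ler_Cplx x y :
  (real_complex R x <= real_complex R y :> Cplx R) = (x <= y).
Proof. exact: lecR. Qed.

Lemma ltr_Cplx x y :
  (real_complex R x < real_complex R y :> Cplx R) = (x < y).
Proof. exact: ltcR. Qed.

Lemma sum_grid (d N : nat) (q : 'rV[int]_d) : q != 0 ->
  (forall i, (`|q 0%R i| < N)%N) ->
  \sum_(f : {ffun 'I_d -> 'I_N})
    expi2pi (\sum_i (q 0 i)%:~R * ((f i)%:R / N%:R) : R) = 0.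
Proof.
move=> /rV0Pn [i qi] qN.
under eq_bigr => f _ do rewrite (big_morph _ (@expi2piD R) (@expi2pi0 R)).
rewrite -(bigA_distr_bigA (fun (i : 'I_d) (j : 'I_N) =>
  expi2pi ((q 0%R i)%:~R * (j%:R / N%:R) : R))).
by rewrite (bigD1 i)//= sum_expi2pi_root// mul0r.
Qed.

Lemma dotD d (u v w : 'rV[R]_d) : dot (u + v) w = dot u w + dot v w.
Proof.
by rewrite /dot -big_split; apply: eq_bigr => i _; rewrite mxE mulrDl.
Qed.

Lemma freqD d p (k l : 'rV[int]_d) :
  freq p (k + l) = freq p k + freq p l :> 'rV[R]_d.
Proof. by rewrite /freq /rvint map_mxD scalerDr. Qed.

Lemma fourier_coef_eq0 (d p : nat) (g : 'rV[int]_d -> Cplx R)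
    (a : 'rV[int]_d -> R) : (0 < p)%N ->
  (forall k, `|g k| <= real_complex R (a k)) ->
  (\esum_(k in [set: 'rV[int]_d]) (a k)%:E < +oo)%E ->
  (forall theta, summability.partial_sum
      (fun k => expi2pi (dot (freq p k) theta) * g k)
      @ summability.totally --> (0 : Cplx R)) ->
  forall m, g m = 0.
Proof.
move=> p0 ga afin gcvg m.
have a0 k : 0 <= a k.
  by rewrite -ler_Cplx; exact: le_trans (normr_ge0 _) (ga k).
suff bnd e : 0 < e -> `|g m| <= real_complex R (e + e).
  apply/eqP; rewrite -normr_le0 norm_CplxE ler_Cplx leNgt; apply/negP => n0.
  have := bnd (ComplexField.Normc.normc (g m) / 4).
  rewrite norm_CplxE ler_Cplx; lra.
move=> e0.
have [S HS] := esum_tail a0 afin e0.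
pose S' := (m |` S)%fset.
pose N := (\sum_(k <- S') \sum_i `|k 0%R i - m 0%R i|%N).+1.
have NR : (N%:R : R) != 0 by rewrite pnatr_eq0.
have pR : (p%:R : R) != 0 by rewrite pnatr_eq0 -lt0n.
have HN k i : k \in S' -> (`|((k - m)%R : 'rV_d) 0%R i| < N)%N.
  move=> kS; rewrite !mxE ltnS (big_fsetD1 k)//= (bigD1 i)//=.
  by rewrite -addnA leq_addr.
pose th (f : {ffun 'I_d -> 'I_N}) : 'rV[R]_d :=
  \row_i (p%:R * ((f i)%:R / N%:R)).
have dotth k f : dot (freq p k) (th f) =
    \sum_i (k 0 i)%:~R * ((f i)%:R / N%:R).
  apply: eq_bigr => i _; rewrite !mxE.
  by rewrite [p%:R^-1 * _]mulrC -mulrA mulKf.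
have HA f : exists A : {fset 'rV[int]_d}, forall B, (A `<=` B)%fset ->
    `|\sum_(k <- B) expi2pi (dot (freq p k) (th f)) * g k|
      <= real_complex R e.
  have /cvgrPdist_lt := gcvg (th f).
  move=> /(_ (real_complex R e)); rewrite (ltr_Cplx 0 e) => /(_ e0) [A _ sA].
  exists A => B AB; have := sA B AB; rewrite /= sub0r normrN => /ltW.
  by rewrite /summability.partial_sum big_seq_fsetE.
have [A {}HA] := choice HA.
pose J := (S' `|` \big[@fsetU _/fset0]_(f : {ffun 'I_d -> 'I_N}) A f)%fset.
pose c k : Cplx R := \sum_f expi2pi (dot (freq p (k - m)) (th f)).
pose M := #|{ffun 'I_d -> 'I_N}|.
have M0 : (0 < M)%N by apply/card_gt0P; exists [ffun=> ord0].
have cm : c m = M%:R.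
  rewrite /c subrr /freq /rvint map_mx0 scaler0.
  under eq_bigr => f _.
    rewrite /dot big1 ?expi2pi0; last by move=> i _; rewrite mxE mul0r.
    over.
  by rewrite sumr_const.
have c0 k : k \in S' -> k != m -> c k = 0.
  move=> kS km; rewrite /c; under eq_bigr => f _ do rewrite dotth.
  by apply: sum_grid; [rewrite subr_eq0|move=> i; exact: HN].
have cM k : `|c k| <= M%:R.
  apply: le_trans (ler_norm_sum _ _ _) _.
  by under eq_bigr => f _ do rewrite norm_expi2pi; rewrite sumr_const.
have mS : m \in S' by rewrite !inE eqxx.
have mJ : m \in J by rewrite inE mS.
pose T f : Cplx R := expi2pi (- dot (freq p m) (th f)) *
  \sum_(k <- J) expi2pi (dot (freq p k) (th f)) * g k.
have TE : \sum_f T f = \sum_(k <- J) c k * g k.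
  under eq_bigr => f _ do rewrite /T mulr_sumr.
  rewrite exchange_big/=; apply: eq_bigr => k _; rewrite /c mulr_suml.
  apply: eq_bigr => f _; rewrite mulrA -expi2piD; congr (expi2pi _ * _).
  rewrite -[in dot (freq p k) _](subrK m k) freqD dotD.
  by rewrite addrC addrK.
have TM : `|\sum_f T f| <= real_complex R e *+ M.
  apply: le_trans (ler_norm_sum _ _ _) _; rewrite -sumr_const.
  apply: ler_sum => f _; rewrite normrM norm_expi2pi mul1r; apply: HA.
  by apply: fsubset_trans (bigfcup_sup _ (mem_index_enum f) isT) (fsubsetUr _ _).
have Jsplit : \sum_(k <- J) c k * g k =
    M%:R * g m + \sum_(k <- J | k \notin S') c k * g k.
  rewrite (bigD1_seq m) ?fset_uniq//= cm; congr (_ + _).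
  rewrite big_mkcond [RHS]big_mkcond; apply: eq_bigr => k _.
  have [->|km] := eqVneq k m; first by rewrite mS.
  by case: ifPn => // /negPn kS; rewrite c0 ?mul0r.
have tail : `|\sum_(k <- J | k \notin S') c k * g k| <= real_complex R e *+ M.
  apply: le_trans (ler_norm_sum _ _ _) _.
  have : \sum_(k <- J | k \notin S') `|c k * g k| <=
      \sum_(k <- J | k \notin S') (real_complex R (a k) *+ M).
    apply: ler_sum => k _; rewrite normrM -mulr_natl.
    by apply: ler_pM.
  move=> /le_trans; apply; rewrite sumrMnl -rmorph_sum/=.
  rewrite lerMn2r ler_Cplx; apply/orP; right; apply: ltW.
  rewrite big_fset_condE/=; apply: HS; apply/fdisjointP => k.
  by rewrite !inE negb_or => /andP[_ /andP[]].
have : `|M%:R * g m| <= real_complex R e *+ M + real_complex R e *+ M.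
  have -> : M%:R * g m =
      \sum_f T f - \sum_(k <- J | k \notin S') c k * g k.
    by rewrite TE Jsplit addrK.
  by apply: le_trans (ler_normB _ _) _; exact: lerD.
by rewrite -mulrnDl mulr_natl normrMn lerMn2r (gtn_eqF M0)/= -rmorphD.
Qed.

Lemma norm_le_cmxnorm (B : 'M[Cplx R]_2) i j :
  `|B i j| <= real_complex R (cmxnorm B).
Proof.
rewrite norm_CplxE ler_Cplx /cmxnorm.
exact: (le_bigmax _ (fun ij : 'I_2 * 'I_2 =>
  ComplexField.Normc.normc (B ij.1 ij.2)) (i, j)).
Qed.

Lemma cmxnorm_ge0 (B : 'M[Cplx R]_2) : 0 <= cmxnorm B.
Proof.
by rewrite -ler_Cplx; exact: le_trans (normr_ge0 _) (norm_le_cmxnorm B 0 0).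
Qed.

Lemma fourier_expansion_uniq (d p : nat) (F : 'rV[R]_d -> 'M[R]_2) c c' :
  (0 < p)%N -> fourier_expansion p F c -> fourier_expansion p F c' -> c = c'.
Proof.
move=> p0 [fc cF] [fc' cF']; apply/funext => m; apply/matrixP => i j.
apply/eqP; rewrite -subr_eq0; apply/eqP.
apply: (@fourier_coef_eq0 d p (fun k => c k i j - c' k i j)
  (fun k => cmxnorm (c k) + cmxnorm (c' k)) p0) => [k||theta].
- apply: le_trans (ler_normB _ _) _; rewrite rmorphD/=.
  by apply: lerD; exact: norm_le_cmxnorm.
- under eq_esum => k _ do rewrite EFinD.
  by rewrite esumD ?lte_add_pinfty// => k _; rewrite lee_fin cmxnorm_ge0.
- apply/cvgrPdist_lt => e e0.
  have cB := cvgB (cF theta) (cF' theta); rewrite subrr in cB.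
  have /cvgrPdist_lt /(_ e e0) := cB summability.totally_filter; apply: filterS => B.
  apply: le_lt_trans; rewrite !sub0r !normrN.
  set X := (X in _ <= `|X|).
  have -> : summability.partial_sum (fun k =>
     expi2pi (dot (freq p k) theta) * (c k i j - c' k i j)) B = X i j.
    rewrite /X/= /summability.partial_sum !mxE !summxE -sumrB.
    by apply: eq_bigr => k _; rewrite !mxE mulrBr.
  rewrite [leRHS]/Num.norm/= mx_normE.
  have := @le_bigmax _ _ _ _ (fun ij : 'I_2 * 'I_2 => `|X ij.1 ij.2|%:nng)%R (i, j).
  exact.
Qed.

Lemma fourier_coefE (d p : nat) (F : 'rV[R]_d -> 'M[R]_2) c :
  (0 < p)%N -> fourier_expansion p F c -> fourier_coef p F = c.
Proof.
move=> p0 Fc; apply: (fourier_expansion_uniq p0 _ Fc).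
by apply: xgetPex; exists c.
Qed.

End FourierCoefficients.

(* Main.v *)
Require Import Defs.
From mathcomp Require Import all_boot all_order all_algebra finmap.
From mathcomp Require Import all_classical all_reals all_analysis.
From mathcomp Require Import complex.
From mathcomp.analysis.showcase Require summability.
From mathcomp Require Import ring lra zify.
Import Order.TTheory GRing.Theory Num.Theory.
Import numFieldNormedType.Exports.
Local Open Scope classical_set_scope.
Local Open Scope ring_scope.

Set Implicit Arguments.
Unset Strict Implicit.
Unset Printing Implicit Defensive.

(** A KAM scheme. At step j the error has size exp(-b_j), with b_j growing geometrically, and only
    the frequencies of size at most t_j / 8 are removed; the Brjuno-Ruessmann integral bounds the total
    loss of analyticity. The linearised equation is solvable unless 4 det A is close to
    (2 pi <m, omega>)^2 for some m <> 0 in this range. In that case a rotation of frequency m / 2,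
    which is 1-periodic up to sign, makes det A so small that no further resonance occurs during a
    fixed number of steps, after which the accuracy reached pays for the rotation.

    The rotations are too large on the wide strip to be part of the conjugacy psi_eps, so the frame is
    written chi R_n: chi stays small, the part of A commuting with the generator of R_n goes to A_eps,
    and the anticommuting part, which is exponentially small in Lambda(n), goes to the error. R_n is
    merged into chi only at steps at which A is smaller than kappa exp(-b_j / 200). Either this happens
    infinitely often, and A_eps is small for arbitrarily small eps, or from some step on successive chi
    are so close that their quotient is absorbed in Z_eps and psi_eps is constant. *)

(** The obstacle: Lambda(t_j) is much larger than b_j, so at width [r j] a rotation of frequency n /
    2 has a norm that no power of the error exp(-b_j) pays for. Hence the frame [psi] is never
    bounded on that strip. The linearised equation has constant coefficients only in the frame, but
    data and solution are measured after conjugation back to the original coordinates. This costs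
    nothing in n: the rotation shifts the frequency of an eigenvector of ad J by n, and conjugating
    back undoes the shift. Besides [r j], which is at least s1 = r0 / 2, two widths occur: s1 for
    [chi], and s0 = s1 / 10^6 for the results. The increments of the anticommuting part of A are
    Fourier coefficients at frequency n of functions bounded at width s1; their decay pays for the
    rotations at width s0. The unit of the estimates is p_j = b_j / 10^5: exp(p_j) dominates 100,
    [mnorm A0 + 1], 1 / kappa and Psi at the frequencies of the next 23 steps, so that constants,
    small divisors and frames only add multiples of p_j to the exponents. *)

Section RealMatrices.
Context {R : realType}.
Implicit Types (M K A B J : 'M[R]_2) (a b c d x y : R).

(** * Algebra and norms of real matrices of size two *)

Definition mk a b c d : 'M[R]_2 :=
  \matrix_(i < 2, j < 2)
    if i == 0 then (if j == 0 then a else b) else (if j == 0 then c else d).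

Lemma ord2P (P : 'I_2 -> Prop) : P 0 -> P 1 -> forall i, P i.
Proof.
move=> P0 P1 [[|[|//]] h]; first by rewrite (_ : Ordinal h = 0)//; apply: val_inj.
by rewrite (_ : Ordinal h = 1)//; apply: val_inj.
Qed.

Lemma sum2 (V : nmodType) (F : 'I_2 -> V) : \sum_i F i = F 0 + F 1.
Proof. by rewrite big_ord_recl big_ord1; congr (_ + F _); apply: val_inj. Qed.

Lemma mkE M : M = mk (M 0 0) (M 0 1) (M 1 0) (M 1 1).
Proof.
by apply/matrixP; apply: ord2P; apply: ord2P; rewrite mxE.
Qed.

Lemma mkD a b c d a' b' c' d' :
  mk a b c d + mk a' b' c' d' = mk (a + a') (b + b') (c + c') (d + d').
Proof. by apply/matrixP; apply: ord2P; apply: ord2P; rewrite !mxE. Qed.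

Lemma mkN a b c d : - mk a b c d = mk (- a) (- b) (- c) (- d).
Proof. by apply/matrixP; apply: ord2P; apply: ord2P; rewrite !mxE. Qed.

Lemma mkZ x a b c d : x *: mk a b c d = mk (x * a) (x * b) (x * c) (x * d).
Proof. by apply/matrixP; apply: ord2P; apply: ord2P; rewrite !mxE. Qed.

Lemma mkM a b c d a' b' c' d' : mk a b c d * mk a' b' c' d' =
  mk (a * a' + b * c') (a * b' + b * d') (c * a' + d * c') (c * b' + d * d').
Proof.
by apply/matrixP; apply: ord2P; apply: ord2P; rewrite !mxE sum2 !mxE.
Qed.

Lemma mk1 : 1 = mk 1 0 0 1.
Proof. by apply/matrixP; apply: ord2P; apply: ord2P; rewrite !mxE. Qed.

Lemma tr2E M : \tr M = M 0 0 + M 1 1.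
Proof. by rewrite /mxtrace sum2. Qed.

Lemma det2E M : \det M = M 0 0 * M 1 1 - M 0 1 * M 1 0.
Proof.
rewrite (expand_det_row _ 0) sum2 /cofactor !det_mx11 !mxE /=.
have -> : lift 0 (0 : 'I_1) = 1 :> 'I_2 by apply: val_inj.
have -> : lift 1 (0 : 'I_1) = 0 :> 'I_2 by apply: val_inj.
by rewrite expr0 expr1 mul1r mulN1r mulrN.
Qed.

Lemma mk_inj a b c d a' b' c' d' : mk a b c d = mk a' b' c' d' ->
  [/\ a = a', b = b', c = c' & d = d'].
Proof.
move=> /matrixP h; split; [move: (h 0 0)|move: (h 0 1)|move: (h 1 0)|move: (h 1 1)];
  by rewrite !mxE.
Qed.

(** The inverse on determinant one. In size two it is linear and preserves [mnorm], so bounds and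
    derivatives of inverses come from those of the matrix. *)
Definition adj2 M : 'M[R]_2 := mk (M 1 1) (- M 0 1) (- M 1 0) (M 0 0).

(** The entrywise sum is submultiplicative, which the maximum of the statement is not, and it
    dominates that maximum. *)
Definition mnorm M : R := \sum_i \sum_j `|M i j|.

Lemma mnormE M : mnorm M = `|M 0 0| + `|M 0 1| + (`|M 1 0| + `|M 1 1|).
Proof. by rewrite /mnorm !sum2. Qed.

Lemma mnorm_mk a b c d : mnorm (mk a b c d) = `|a| + `|b| + (`|c| + `|d|).
Proof. by rewrite mnormE !mxE. Qed.

Lemma mnorm_ge0 M : 0 <= mnorm M.
Proof. by rewrite /mnorm !sumr_ge0// => i _; rewrite sumr_ge0. Qed.

Lemma mnorm_entry M i j : `|M i j| <= mnorm M.
Proof.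
move: i j; apply: ord2P; apply: ord2P; rewrite mnormE;
have := normr_ge0 (M 0 0); have := normr_ge0 (M 0 1);
have := normr_ge0 (M 1 0); have := normr_ge0 (M 1 1); lra.
Qed.

Lemma mnorm0 : mnorm 0 = 0.
Proof. by rewrite mnormE !mxE normr0 !addr0. Qed.

Lemma mnorm_eq0 M : mnorm M <= 0 -> M = 0.
Proof.
move=> h; apply/matrixP => i j; rewrite mxE; apply/eqP.
by rewrite -normr_le0 (le_trans (mnorm_entry M i j)).
Qed.

Lemma mnorm1 : mnorm 1 = 2.
Proof. by rewrite mk1 mnorm_mk normr0 normr1; lra. Qed.

Lemma mnormN M : mnorm (- M) = mnorm M.
Proof. by rewrite !mnormE !mxE !normrN. Qed.

Lemma mnormZ x M : mnorm (x *: M) = `|x| * mnorm M.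
Proof. by rewrite !mnormE !mxE !normrM -!mulrDr. Qed.

Lemma mnormD M K : mnorm (M + K) <= mnorm M + mnorm K.
Proof.
rewrite !mnormE !mxE.
have := ler_normD (M 0 0) (K 0 0); have := ler_normD (M 0 1) (K 0 1).
have := ler_normD (M 1 0) (K 1 0); have := ler_normD (M 1 1) (K 1 1); lra.
Qed.

Lemma mnormB M K : mnorm (M - K) <= mnorm M + mnorm K.
Proof. by rewrite -(mnormN K) mnormD. Qed.

Lemma mnormM M K : mnorm (M * K) <= mnorm M * mnorm K.
Proof.
rewrite !mnormE !mxE !sum2 (mkE M) (mkE K) !mxE/=.
move: (M 0 0) (M 0 1) (M 1 0) (M 1 1) (K 0 0) (K 0 1) (K 1 0) (K 1 1).
move=> a b c d a' b' c' d'.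
have h x y z t : `|x * y + z * t| <= `|x| * `|y| + `|z| * `|t|.
  by rewrite (le_trans (ler_normD _ _))// !normrM.
have := h a a' b c'; have := h a b' b d'; have := h c a' d c'; have := h c b' d d'.
have := mulr_ge0 (normr_ge0 a) (normr_ge0 c'); have := mulr_ge0 (normr_ge0 a) (normr_ge0 d').
have := mulr_ge0 (normr_ge0 b) (normr_ge0 a'); have := mulr_ge0 (normr_ge0 b) (normr_ge0 b').
have := mulr_ge0 (normr_ge0 c) (normr_ge0 c'); have := mulr_ge0 (normr_ge0 c) (normr_ge0 d').
have := mulr_ge0 (normr_ge0 d) (normr_ge0 a'); have := mulr_ge0 (normr_ge0 d) (normr_ge0 b').
nra.
Qed.

Lemma mnorm_adj2 M : mnorm (adj2 M) = mnorm M.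
Proof. rewrite /adj2 mnorm_mk mnormE !normrN; ring. Qed.

Lemma mnorm_sum I (r : seq I) (F : I -> 'M[R]_2) :
  mnorm (\sum_(i <- r) F i) <= \sum_(i <- r) mnorm (F i).
Proof.
elim: r => [|i r IH]; first by rewrite !big_nil mnorm0.
rewrite !big_cons; apply: le_trans (mnormD _ _) _; lra.
Qed.

Lemma adj2D M K : adj2 (M + K) = adj2 M + adj2 K.
Proof. by rewrite /adj2 mkD !mxE !opprD. Qed.

Lemma adj2Z x M : adj2 (x *: M) = x *: adj2 M.
Proof. by rewrite /adj2 mkZ !mxE !mulrN. Qed.

Lemma adj2M M K : adj2 (M * K) = adj2 K * adj2 M.
Proof. by rewrite (mkE M) (mkE K) mkM /adj2 !mxE/= mkM; congr mk; ring. Qed.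

Lemma adj2K M : adj2 (adj2 M) = M.
Proof. by rewrite [RHS]mkE /adj2 !mxE/= !opprK. Qed.

Lemma mul_adj2 M : M * adj2 M = (\det M)%:M.
Proof.
rewrite det2E (mkE M) /adj2 !mxE/= mkM [RHS]mkE !mxE /=.
by congr mk; ring.
Qed.

Lemma mul_adj2l M : adj2 M * M = (\det M)%:M.
Proof.
rewrite det2E (mkE M) /adj2 !mxE/= mkM [RHS]mkE !mxE /=.
by congr mk; ring.
Qed.

Lemma adj2_det1 M : \det M = 1 -> M * adj2 M = 1.
Proof. by move=> h; rewrite mul_adj2 h. Qed.

Lemma adj2_det1l M : \det M = 1 -> adj2 M * M = 1.
Proof. by move=> h; rewrite mul_adj2l h. Qed.

Lemma det_adj2 M : \det (adj2 M) = \det M.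
Proof. by rewrite !det2E !mxE/=; ring. Qed.

Lemma det1_invmx M : \det M = 1 -> invmx M = adj2 M.
Proof.
move=> h; have Mu : M \in unitmx by rewrite unitmxE h unitr1.
have : M *m adj2 M = 1%:M by exact: adj2_det1.
by move/(congr1 (mulmx (invmx M))); rewrite mulmxA mulVmx// mul1mx mulmx1.
Qed.

Lemma det1M M K : \det M = 1 -> \det K = 1 -> \det (M * K) = 1.
Proof. by move=> h k; rewrite -mulmxE det_mulmx h k mulr1. Qed.

(** The projection onto sl(2). Truncating the series of a traceless function can leave coefficients
    with a trace; this removes it without increasing [mnorm]. *)
Definition tl M := M - (2^-1 * \tr M) *: 1.

Lemma tr_tl M : \tr (tl M) = 0.
Proof. by rewrite /tl tr2E !mxE/= tr2E; field. Qed.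

Lemma tl_id M : \tr M = 0 -> tl M = M.
Proof. by rewrite /tl => ->; rewrite mulr0 scale0r subr0. Qed.

Lemma mnorm_tl M : mnorm (tl M) <= mnorm M.
Proof.
rewrite /tl mnormE !mxE/= tr2E mnormE !mulr0 !subr0 mulr1.
set a := M 0 0; set d := M 1 1.
have -> : a - 2^-1 * (a + d) = 2^-1 * (a - d) by field.
have -> : d - 2^-1 * (a + d) = 2^-1 * (d - a) by field.
rewrite !normrM distrC (ger0_norm (x := 2^-1))//.
have := ler_normB d a; lra.
Qed.

Lemma tlD M K : tl (M + K) = tl M + tl K.
Proof. by rewrite /tl raddfD/= mulrDr scalerDl opprD addrACA. Qed.

Lemma tlZ x M : tl (x *: M) = x *: tl M.
Proof. by rewrite /tl scalerBr scalerA mxtraceZ mulrCA. Qed.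

Lemma tlN M : tl (- M) = - tl M.
Proof. by rewrite -scaleN1r tlZ scaleN1r. Qed.

Definition ad A B := A * B - B * A.

Lemma tl_ad A B : tl (ad A B) = ad A B.
Proof. by apply: tl_id; rewrite /ad raddfB/= -!mulmxE mxtrace_mulC subrr. Qed.

Lemma adDr A B K : ad A (B + K) = ad A B + ad A K.
Proof. by rewrite /ad mulrDr mulrDl opprD addrACA. Qed.

Lemma adZr A x B : ad A (x *: B) = x *: ad A B.
Proof. by rewrite /ad scalerBr -scalerAr -scalerAl. Qed.

Lemma adNr A B : ad A (- B) = - ad A B.
Proof. by rewrite /ad mulrN mulNr opprD. Qed.

Lemma ad_tlr A B : ad A (tl B) = ad A B.
Proof.
by rewrite /tl adDr adNr adZr /ad mulr1 mul1r subrr scaler0 subr0.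
Qed.

(** The eigenvalues of ad A are 0 and the differences of the eigenvalues of A, which are the two
    square roots of - 4 det A. The cubic relation turns the resolvent of ad A into a polynomial of
    degree two. *)
Lemma ad3 A B : \tr A = 0 -> ad A (ad A (ad A B)) = (- 4 * \det A) *: ad A B.
Proof.
rewrite tr2E => h; rewrite det2E (mkE A) (mkE B) !mxE/=.
have -> : A 1 1 = - A 0 0 by lra.
move: (A 0 0) (A 0 1) (A 1 0) (B 0 0) (B 0 1) (B 1 0) (B 1 1) => a b c p q r s.
by rewrite /ad !(mkM, mkN, mkD, mkZ); congr mk; ring.
Qed.

Lemma det2_abs M : `|\det M| <= mnorm M ^+ 2.
Proof.
rewrite det2E (le_trans (ler_normB _ _))// !normrM mnormE.
have := normr_ge0 (M 0 0); have := normr_ge0 (M 0 1);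
have := normr_ge0 (M 1 0); have := normr_ge0 (M 1 1); nra.
Qed.

Lemma det2D M K : `|\det (M + K) - \det M| <= mnorm K * (mnorm M + mnorm K).
Proof.
rewrite !det2E !mxE.
set a := M 0 0; set b := M 0 1; set c := M 1 0; set d := M 1 1.
set a' := K 0 0; set b' := K 0 1; set c' := K 1 0; set d' := K 1 1.
have -> : (a + a') * (d + d') - (b + b') * (c + c') - (a * d - b * c) =
  (a' * d + a * d' + a' * d') - (b' * c + b * c' + b' * c') by ring.
rewrite (le_trans (ler_normB _ _))//.
have h x y z : `|x + y + z| <= `|x| + `|y| + `|z|.
  by rewrite (le_trans (ler_normD _ _))// lerD2r ler_normD.
have := h (a' * d) (a * d') (a' * d'); have := h (b' * c) (b * c') (b' * c').
rewrite !normrM !mnormE -/a -/b -/c -/d -/a' -/b' -/c' -/d'.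
have := normr_ge0 a; have := normr_ge0 b; have := normr_ge0 c; have := normr_ge0 d.
have := normr_ge0 a'; have := normr_ge0 b'; have := normr_ge0 c'; have := normr_ge0 d'.
move: `|a| `|b| `|c| `|d| `|a'| `|b'| `|c'| `|d'| => p q s t p' q' s' t' *.
have : 0 <= p' * p + p' * q + p' * s + q' * p + q' * q + q' * t + s' * p + s' * s + s' * t
   + t' * q + t' * s + t' * t + p' * p' + p' * q' + p' * s' + q' * q' + q' * t' + q' * p'
   + s' * s' + s' * p' + s' * t' + t' * t' + t' * q' + t' * s' + p' * t'+ s' * q'.
  by rewrite !addr_ge0// mulr_ge0.
lra.
Qed.

End RealMatrices.

(** * Limits of sequences of matrices *)

Section Convergence.
Context {R : realType}.
Implicit Types (u v : nat -> 'M[R]_2) (l m : 'M[R]_2).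

Definition conv u l := forall e, 0 < e ->
  exists n0, forall n, (n0 <= n)%N -> mnorm (l - u n) <= e.

Lemma conv_ext u v l : (forall n, u n = v n) -> conv u l -> conv v l.
Proof.
by move=> uv h e e0; have [n0 H] := h e e0; exists n0 => n /H; rewrite uv.
Qed.

Lemma convD u v l m : conv u l -> conv v m -> conv (fun n => u n + v n) (l + m).
Proof.
move=> h k e e0; have [n0 H] := h (e / 2) ltac:(lra).
have [n1 K] := k (e / 2) ltac:(lra).
exists (maxn n0 n1) => n; rewrite geq_max => /andP[/H {}H /K {}K].
by rewrite opprD addrACA (le_trans (mnormD _ _))//; lra.
Qed.

Lemma conv_lin (f : 'M[R]_2 -> 'M[R]_2) K u l :
  (forall U V, f (U + V) = f U + f V) -> (forall U, f (- U) = - f U) ->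
  (forall U, mnorm (f U) <= K * mnorm U) -> conv u l ->
  conv (fun n => f (u n)) (f l).
Proof.
move=> fD fN fK h e e0; have K1 : 0 < `|K| + 1 by have := normr_ge0 K; lra.
have [n0 H] := h (e / (`|K| + 1)) (divr_gt0 e0 K1).
exists n0 => n /H {}H; rewrite -fN -fD (le_trans (fK _))//.
rewrite ler_pdivlMr// in H.
have := mnorm_ge0 (l - u n); have := ler_norm K; nra.
Qed.

Lemma conv_bound u l x : (forall n, mnorm (u n) <= x) -> conv u l -> mnorm l <= x.
Proof.
move=> h c; apply/ler_addgt0Pr => e e0; have [n0 /(_ n0 (leqnn _)) H] := c e e0.
rewrite -(subrK (u n0) l) (le_trans (mnormD _ _))//.
by rewrite addrC lerD.
Qed.

Lemma conv_cst l : conv (fun=> l) l.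
Proof. by move=> e e0; exists 0%N => n _; rewrite subrr mnorm0 ltW. Qed.

Lemma convM u v l m : conv u l -> conv v m -> conv (fun n => u n * v n) (l * m).
Proof.
move=> h k e e0.
pose a := mnorm l + 1; pose b := mnorm m + 1.
have a0 : 0 < a by have := mnorm_ge0 l; rewrite /a; lra.
have b0 : 0 < b by have := mnorm_ge0 m; rewrite /b; lra.
pose e1 := Num.min 1 (e / 2 / (a + b)).
have e10 : 0 < e1 by rewrite lt_min ltr01 !divr_gt0// addr_gt0.
have [n0 H] := h e1 e10; have [n1 K] := k e1 e10.
exists (maxn n0 n1) => n; rewrite geq_max => /andP[/H {}H /K {}K].
have -> : l * m - u n * v n = (l - u n) * m + u n * (m - v n).
  by rewrite mulrBl mulrBr addrA subrK.
have un : mnorm (u n) <= a.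
  rewrite -(subKr l (u n)) (le_trans (mnormB _ _))// /a lerD2l (le_trans H)//.
  by rewrite ge_min lexx.
apply: le_trans (mnormD _ _) _.
have e1e : e1 * (a + b) <= e.
  have : e1 <= e / 2 / (a + b) by rewrite ge_min lexx orbT.
  by rewrite (ler_pdivlMr _ _ (addr_gt0 a0 b0)) => e1h; apply: (le_trans e1h); lra.
apply: le_trans (le_trans (lerD (mnormM _ _) (mnormM _ _)) _) e1e.
rewrite mulrDr [e1 * a + _]addrC [e1 * a]mulrC.
by apply: lerD; apply: ler_pM => //; try exact: mnorm_ge0; rewrite /b lerDl.
Qed.

Lemma contraction_cvg0 (e eta : nat -> R) (x : R) : 0 <= x < 1 ->
  (forall n, 0 <= e n) -> (forall n, e n.+1 <= x * e n + eta n) ->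
  (forall a, 0 < a -> exists n0, forall n, (n0 <= n)%N -> eta n <= a) ->
  forall a, 0 < a -> exists n0, forall n, (n0 <= n)%N -> e n <= a.
Proof.
move=> /andP[x0 x1] e0 he heta a a0.
(* Once eta is at most this, the bound a / 2 reproduces itself under the recursion and the excess
   over it decays like x ^ k. *)
have h0 : 0 < a / 2 * (1 - x) by apply: mulr_gt0; lra.
have [n0 H] := heta _ h0.
have A k : e (n0 + k)%N <= x ^+ k * e n0 + a / 2.
  elim: k => [|k IH]; first by rewrite addn0 expr0 mul1r; lra.
  rewrite addnS (le_trans (he _))// exprS.
  have := H (n0 + k)%N (leq_addr _ _).
  move=> {}H; have := ler_wpM2l x0 IH; rewrite mulrDr mulrA.
  move: H; move: (e (n0 + k)%N) (eta (n0 + k)%N) (x * x ^+ k * e n0) => s t y; lra.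
have xc : x ^+ n @[n --> \oo] --> 0 by apply: cvg_expr; rewrite ger0_norm.
have /cvgrPdist_le/(_ (a / 2 / (e n0 + 1))) := xc.
have e1 : 0 < e n0 + 1 by have := e0 n0; lra.
have a2 : 0 < a / 2 by lra.
move=> /(_ (divr_gt0 a2 e1)) [n1 _ K]; exists (n0 + n1)%N => n nn.
have nn0 : (n0 <= n)%N by rewrite (leq_trans _ nn)// leq_addr.
rewrite -(subnKC nn0) (le_trans (A _))//.
have /= := K (n - n0)%N; rewrite leq_subRL// => /(_ nn).
rewrite sub0r normrN ger0_norm ?exprn_ge0// ler_pdivlMr//.
have : 0 <= x ^+ (n - n0) by rewrite exprn_ge0.
lra.
Qed.

End Convergence.

(** * Real trigonometric series and their weighted norms *)

Section Atoms.
Context {R : realType} {d : nat}.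
Variable p : nat.
Implicit Types (k l : 'rV[int]_d) (phi : R) (theta : 'rV[R]_d).
Implicit Types (U V : 'M[R]_2).

(** A frequency, a phase phi and an amplitude U, for the function cos(phase + phi) U. Free phases
    keep real trigonometric sums closed under products, by the product-to-sum formula. *)
Definition atom := ('rV[int]_d * R * 'M[R]_2)%type.
Implicit Types (s t : seq atom).

Definition phase k theta : R := 2 * pi * dot (freq p k) theta.

Definition trig k phi theta : R := cos (phase k theta + phi).

Lemma phaseD k l theta : phase (k + l) theta = phase k theta + phase l theta.
Proof. by rewrite /phase freqD dotD mulrDr. Qed.

Lemma phase0 theta : phase 0 theta = 0.
Proof.
rewrite /phase /freq /rvint map_mx0 scaler0 /dot big1 ?mulr0// => i _.
by rewrite mxE mul0r.
Qed.

Lemma phaseN k theta : phase (- k) theta = - phase k theta.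
Proof. by apply/eqP; rewrite -subr_eq0 opprK -phaseD addNr phase0. Qed.

Lemma trigM k phi l psi theta : trig k phi theta * trig l psi theta =
  2^-1 * trig (k + l) (phi + psi) theta + 2^-1 * trig (k - l) (phi - psi) theta.
Proof.
rewrite /trig !phaseD phaseN.
have -> : phase k theta + phase l theta + (phi + psi) =
  (phase k theta + phi) + (phase l theta + psi) by ring.
have -> : phase k theta - phase l theta + (phi - psi) =
  (phase k theta + phi) - (phase l theta + psi) by ring.
move: (phase k theta + phi) (phase l theta + psi) => a b.
rewrite cosD cosB; lra.
Qed.

Lemma trig_le1 k phi theta : `|trig k phi theta| <= 1.
Proof. by rewrite ler_norml cos_geN1 cos_le1. Qed.

Definition ev s theta : 'M[R]_2 := \sum_(a <- s) trig a.1.1 a.1.2 theta *: a.2.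

Definition tmul k phi s : seq atom :=
  flatten [seq [:: (k + a.1.1, phi + a.1.2, 2^-1 *: a.2);
                   (k - a.1.1, phi - a.1.2, 2^-1 *: a.2)] | a <- s].

Definition amap (f : 'M[R]_2 -> 'M[R]_2) s : seq atom :=
  [seq (a.1, f a.2) | a <- s].

Definition lmul s t : seq atom :=
  flatten [seq amap (fun U => a.2 * U) (tmul a.1.1 a.1.2 t) | a <- s].

Lemma ev_nil theta : ev [::] theta = 0.
Proof. by rewrite /ev big_nil. Qed.

Lemma ev_cons a s theta : ev (a :: s) theta = trig a.1.1 a.1.2 theta *: a.2 + ev s theta.
Proof. by rewrite /ev big_cons. Qed.

Lemma ev_cat s t theta : ev (s ++ t) theta = ev s theta + ev t theta.
Proof. by rewrite /ev big_cat. Qed.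

Lemma ev_tmul k phi s theta : ev (tmul k phi s) theta = trig k phi theta *: ev s theta.
Proof.
elim: s => [|a s IH]; first by rewrite /tmul/= !ev_nil scaler0.
rewrite /tmul/= !ev_cons -/(tmul k phi s) IH/= scalerDr !scalerA trigM.
by rewrite !(mulrC _ 2^-1) scalerDl !addrA.
Qed.

Lemma ev_amap f s theta : (forall U V, f (U + V) = f U + f V) ->
  (forall c U, f (c *: U) = c *: f U) -> ev (amap f s) theta = f (ev s theta).
Proof.
move=> fD fZ; elim: s => [|a s IH].
  by rewrite /= !ev_nil -[in RHS](scale0r (0 : 'M[R]_2)) fZ scale0r.
by rewrite /= !ev_cons/= IH fD fZ.
Qed.

Lemma ev_lmul s t theta : ev (lmul s t) theta = ev s theta * ev t theta.
Proof.
elim: s => [|a s IH]; first by rewrite /lmul/= !ev_nil mul0r.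
rewrite /lmul/= ev_cat -/(lmul s t) IH ev_cons mulrDl; congr (_ + _).
rewrite ev_amap; last 2 first.
- by move=> U V; rewrite mulrDr.
- by move=> c U; rewrite scalerAr.
by rewrite ev_tmul -scalerAr scalerAl.
Qed.

Fixpoint pre (S : nat -> seq atom) n : seq atom :=
  if n is m.+1 then pre S m ++ S m else [::].

Section Weight.
Variable w : 'rV[int]_d -> R.

Definition weight := [/\ forall k, 1 <= w k, w 0 = 1, forall k, w (- k) = w k
  & forall k l, w (k + l) <= w k * w l].

Definition nm s : R := \sum_(a <- s) w a.1.1 * mnorm a.2.

(* F is the sum of a real trigonometric series of weighted norm at most x; different lists of the
   same mode need not be grouped, so that products and conjugations act termwise. *)
Definition bnd (F : 'rV[R]_d -> 'M[R]_2) (x : R) :=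
  exists S, (forall n, nm (pre S n) <= x) /\
    forall theta, conv (fun n => ev (pre S n) theta) (F theta).

Lemma nm_nil : nm [::] = 0. Proof. by rewrite /nm big_nil. Qed.

Lemma nm_cons a s : nm (a :: s) = w a.1.1 * mnorm a.2 + nm s.
Proof. by rewrite /nm big_cons. Qed.

Lemma nm_cat s t : nm (s ++ t) = nm s + nm t.
Proof. by rewrite /nm big_cat. Qed.

Hypothesis wW : weight.

Let w1 k : 1 <= w k. Proof. by case: wW. Qed.
Let w0 k : 0 <= w k. Proof. by rewrite (le_trans _ (w1 k)). Qed.
Let wB k l : w (k - l) <= w k * w l.
Proof. by case: wW => _ _ wN wD; rewrite -(wN l) wD. Qed.
Let wD k l : w (k + l) <= w k * w l. Proof. by case: wW. Qed.

Lemma nm_ge0 s : 0 <= nm s.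
Proof. by rewrite /nm sumr_ge0// => a _; rewrite mulr_ge0 ?mnorm_ge0. Qed.

Lemma nm_tmul k phi s : nm (tmul k phi s) <= w k * nm s.
Proof.
elim: s => [|a s IH]; first by rewrite /tmul/= nm_nil mulr0.
rewrite /tmul/= !nm_cons -/(tmul k phi s)/= mulrDr !mnormZ ger0_norm//.
have := wD k a.1.1; have := wB k a.1.1; have := mnorm_ge0 a.2.
move: (w (k + _)) (w (k - _)) (mnorm a.2) => x y z *; rewrite !addrA lerD//.
nra.
Qed.

Lemma nm_amap f K s : (forall U, mnorm (f U) <= K * mnorm U) ->
  nm (amap f s) <= K * nm s.
Proof.
move=> fK; elim: s => [|a s IH]; first by rewrite nm_nil mulr0.
rewrite /= !nm_cons/= mulrDr lerD// mulrCA ler_wpM2l//.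
Qed.

Lemma nm_lmul s t : nm (lmul s t) <= nm s * nm t.
Proof.
elim: s => [|a s IH]; first by rewrite /lmul/= nm_nil mul0r.
rewrite /lmul/= nm_cat nm_cons -/(lmul s t) mulrDl lerD//.
apply: le_trans (nm_amap _ (fun U => mnormM a.2 U)) _.
by rewrite [w _ * _]mulrC -mulrA ler_wpM2l ?mnorm_ge0// nm_tmul.
Qed.

Lemma mnorm_ev s theta : mnorm (ev s theta) <= nm s.
Proof.
elim: s => [|a s IH]; first by rewrite ev_nil nm_nil mnorm0.
rewrite ev_cons nm_cons (le_trans (mnormD _ _))// lerD// mnormZ.
by rewrite ler_wpM2r ?mnorm_ge0// (le_trans (trig_le1 _ _ _)).
Qed.

Lemma bnd_ge0 F x : bnd F x -> 0 <= x.
Proof. by move=> [S [/(_ 0%N)/=]]; rewrite nm_nil. Qed.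

Lemma bnd_le F x y : x <= y -> bnd F x -> bnd F y.
Proof. by move=> xy [S [h c]]; exists S; split => // n; apply: le_trans (h n) _. Qed.

Lemma bnd_ext F G x : (forall theta, F theta = G theta) -> bnd F x -> bnd G x.
Proof.
by move=> FG [S [h c]]; exists S; split => // theta; rewrite -FG.
Qed.

Lemma mnorm_bnd F x theta : bnd F x -> mnorm (F theta) <= x.
Proof.
move=> [S [h /(_ theta) c]]; apply: conv_bound c => n.
exact: le_trans (mnorm_ev _ _) (h n).
Qed.

Lemma bnd_ev s : bnd (ev s) (nm s).
Proof.
pose S n := if n is 0%N then s else [::].
have pS n : pre S n.+1 = s by elim: n => //= n ->; rewrite cats0.
exists S; split => [[|n]|theta]; rewrite ?pS//= ?nm_nil ?nm_ge0// => e e0.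
by exists 1%N => -[//|n] _; rewrite pS subrr mnorm0 ltW.
Qed.

Lemma bndD F G x y : bnd F x -> bnd G y -> bnd (fun th => F th + G th) (x + y).
Proof.
move=> [S [h c]] [T [k e]]; exists (fun n => S n ++ T n).
have evp n th : ev (pre (fun n => S n ++ T n) n) th = ev (pre S n) th + ev (pre T n) th.
  elim: n => [|n IH]/=; first by rewrite !ev_nil addr0.
  by rewrite !ev_cat IH addrACA.
have nmp n : nm (pre (fun n => S n ++ T n) n) = nm (pre S n) + nm (pre T n).
  elim: n => [|n IH]/=; first by rewrite !nm_nil addr0.
  by rewrite !nm_cat IH addrACA.
split => [n|th]; first by rewrite nmp lerD.
by apply: conv_ext (convD (c th) (e th)) => n; rewrite evp.
Qed.

Lemma bnd_lin f K F x : (forall U V, f (U + V) = f U + f V) ->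
  (forall c U, f (c *: U) = c *: f U) -> 0 <= K ->
  (forall U, mnorm (f U) <= K * mnorm U) -> bnd F x -> bnd (fun th => f (F th)) (K * x).
Proof.
move=> fD fZ K0 fK [S [h c]]; exists (fun n => amap f (S n)).
have pm n : pre (fun n => amap f (S n)) n = amap f (pre S n).
  by elim: n => [//|n /= ->]; rewrite /amap map_cat.
split => [n|th].
  by rewrite pm (le_trans (nm_amap _ fK))// ler_wpM2l.
apply: conv_ext (conv_lin fD _ fK (c th)) => [n|U]; first by rewrite pm ev_amap.
by rewrite -scaleN1r fZ scaleN1r.
Qed.

Lemma bndZ c F x : bnd F x -> bnd (fun th => c *: F th) (`|c| * x).
Proof.
apply: bnd_lin => // [U V|b U|U]; first exact: scalerDr.
  by rewrite !scalerA mulrC.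
by rewrite mnormZ.
Qed.

Lemma bndN F x : bnd F x -> bnd (fun th => - F th) x.
Proof.
rewrite -[X in _ -> bnd _ X]mul1r; apply: bnd_lin => // [U V|c U|U].
- exact: opprD.
- by rewrite scalerN.
- by rewrite mnormN mul1r.
Qed.

Lemma bndB F G x y : bnd F x -> bnd G y -> bnd (fun th => F th - G th) (x + y).
Proof. by move=> h k; apply: bndD => //; exact: bndN. Qed.

Lemma bnd_tl F x : bnd F x -> bnd (fun th => tl (F th)) x.
Proof.
rewrite -[X in _ -> bnd _ X]mul1r; apply: bnd_lin => // [U V|c U|U].
- exact: tlD.
- exact: tlZ.
- by rewrite mul1r mnorm_tl.
Qed.

Lemma bnd_adj2 F x : bnd F x -> bnd (fun th => adj2 (F th)) x.
Proof.
rewrite -[X in _ -> bnd _ X]mul1r; apply: bnd_lin => // [U V|c U|U].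
- exact: adj2D.
- exact: adj2Z.
- by rewrite mul1r mnorm_adj2.
Qed.

Lemma bnd_trig k phi F x : bnd F x -> bnd (fun th => trig k phi th *: F th) (w k * x).
Proof.
move=> [S [h c]]; exists (fun n => tmul k phi (S n)).
have pm n : pre (fun n => tmul k phi (S n)) n = tmul k phi (pre S n).
  by elim: n => [//|n /= ->]; rewrite /tmul map_cat flatten_cat.
split => [n|th]; first by rewrite pm (le_trans (nm_tmul _ _ _))// ler_wpM2l.
apply: conv_ext (conv_lin (f := fun U => trig k phi th *: U) (K := 1) _ _ _ (c th)).
- by move=> n; rewrite pm ev_tmul.
- exact: scalerDr.
- exact: scalerN.
- by move=> U; rewrite mnormZ ler_wpM2r ?mnorm_ge0// trig_le1.
Qed.

Lemma bnd_cst U : bnd (fun=> U) (mnorm U).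
Proof.
have := bnd_ev [:: (0, 0, U)]; rewrite nm_cons nm_nil addr0/=.
case: wW => _ -> _ _; rewrite mul1r; apply: bnd_ext => th.
by rewrite ev_cons ev_nil addr0 /trig phase0 addr0 cos0 scale1r.
Qed.

Lemma bnd0 : bnd (fun=> 0) 0.
Proof. by have := bnd_cst 0; rewrite mnorm0. Qed.

Lemma bndM F G x y : bnd F x -> bnd G y -> bnd (fun th => F th * G th) (x * y).
Proof.
move=> hF hG; have x0 := bnd_ge0 hF; have y0 := bnd_ge0 hG.
case: hF hG => [S [h c]] [T [k e]].
(* The increment of the product of two partial sums, written without subtraction; the prefixes of Q
   evaluate to these products. *)
pose Q n := lmul (S n) (pre T n.+1) ++ lmul (pre S n) (T n).
have evQ n th : ev (pre Q n) th = ev (pre S n) th * ev (pre T n) th.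
  elim: n => [|n IH]; first by rewrite !ev_nil mulr0.
  rewrite [pre Q _]/= ev_cat IH /Q !ev_cat !ev_lmul/= !ev_cat.
  by rewrite mulrDl [ev (pre S n) th * (_ + _)]mulrDr -addrA [ev (S n) th * _ + _]addrC.
have nmQ n : nm (pre Q n) <= nm (pre S n) * nm (pre T n).
  elim: n => [|n IH]; first by rewrite !nm_nil mulr0.
  rewrite [pre Q _]/= nm_cat /Q !nm_cat.
  have := nm_lmul (S n) (pre T n.+1); have := nm_lmul (pre S n) (T n).
  rewrite /= !nm_cat; lra.
exists Q; split => [n|th].
  by rewrite (le_trans (nmQ n))// ler_pM ?nm_ge0.
by apply: conv_ext (convM (c th) (e th)) => n; rewrite evQ.
Qed.

(** The norms of the prefixes increase to a supremum. Beyond a prefix whose norm is within e of it,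
    all the remaining blocks together have norm at most e. *)
Lemma bnd_split F x e : bnd F x -> 0 < e ->
  exists s, nm s <= x /\ bnd (fun th => F th - ev s th) e.
Proof.
move=> [S [h c]] e0.
pose A := [set nm (pre S n) | n in [set: nat]].
have hA : has_sup A.
  by split; [exists (nm (pre S 0)), 0%N|exists x => _ [n _ <-]].
have [_ [n _ <-] Hn] := sup_adherent e0 hA.
have ub m : nm (pre S m) <= sup A by apply: ub_le_sup; [case: hA|exists m].
exists (pre S n); split => //.
pose T i := S (n + i)%N.
have pT i : pre S (n + i) = pre S n ++ pre T i.
  elim: i => [|i IH]; first by rewrite addn0 cats0.
  by rewrite addnS/= IH catA.
exists T; split => [i|th].
  by have := ub (n + i)%N; rewrite pT nm_cat; lra.
move=> a a0; have [n0 H] := c th a a0; exists n0 => i ni.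
have := H (n + i)%N (leq_trans ni (leq_addl _ _)).
by rewrite pT ev_cat opprD addrA.
Qed.

(** The Neumann series of (1 - F)^-1, with F replaced by its prefixes P_n: the lists G_n evaluate
    according to G_(n+1) = P_(n+1) (1 + G_n), and their norms stay below the fixed point x / (1 - x)
    of y -> x (1 + y). *)
Lemma bnd_neumann F W x : bnd F x -> x < 1 ->
  (forall th, W th = 1 + F th * W th) ->
  bnd (fun th => W th - 1) (x / (1 - x)).
Proof.
move=> hF x1 hW; have x0 := bnd_ge0 hF; case: hF => [S [h c]].
(* G_(n+1) has to extend G_n as a list. The block D_(n+1) represents P_(n+1) (1 + G_n) - P_n (1 +
   G_(n-1)) as S_n (1 + G_n) + P_n D_n, so that no cancellation inflates the norm. *)
have [G [D [G0 D0 GS DS]]] : exists G D : nat -> seq atom, [/\ G 0%N = [::], D 0%N = [::],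
    forall n, G n.+1 = G n ++ D n.+1 &
    forall n, D n.+1 = S n ++ lmul (S n) (G n) ++ lmul (pre S n) (D n)].
  pose fix GD n : seq atom * seq atom := if n is m.+1 then
   let D := S m ++ lmul (S m) (GD m).1 ++ lmul (pre S m) (GD m).2 in
   ((GD m).1 ++ D, D) else ([::], [::]).
  by exists (fun n => (GD n).1), (fun n => (GD n).2).
have preS n : pre S n.+1 = pre S n ++ S n by [].
move: h c preS DS (erefl : pre S 0 = [::]); move: (pre S) => P h c preS DS P0.
have evG n th : ev (G n.+1) th = ev (P n.+1) th * (1 + ev (G n) th).
  elim: n => [|n IH].
    by rewrite GS DS G0 D0 preS P0 !ev_cat !ev_lmul !ev_nil !mulr0 !addr0 !add0r mulr1.
  have E : ev (D n.+1) th = ev (G n.+1) th - ev (G n) th.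
    by rewrite GS ev_cat addrC addKr.
  rewrite GS DS !ev_cat !ev_lmul E {1}IH (preS n.+1) ev_cat.
  move: (ev (P n.+1) th) (ev (G n) th) (ev (G n.+1) th) (ev (S n.+1) th).
  move=> a b g s.
  have -> : a * (g - b) = a * (1 + g) - a * (1 + b).
    by rewrite -mulrBr opprD addrACA subrr add0r.
  have -> r : s + (s * g + r) = s * (1 + g) + r by rewrite mulrDr mulr1 addrA.
  by rewrite addrCA [_ + (_ - _)]addrC subrK addrC mulrDl.
have nmG n : nm (G n.+1) <= nm (P n.+1) * (1 + nm (G n)).
  elim: n => [|n IH].
    have := nm_lmul (S 0%N) [::]; have := nm_lmul [::] [::].
    by rewrite GS DS G0 D0 preS P0 !nm_cat !nm_nil !mulr0 ?addr0 ?mulr1 ?add0r => ? ?; lra.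
  rewrite GS DS !nm_cat.
  have E : nm (D n.+1) = nm (G n.+1) - nm (G n) by rewrite GS nm_cat addrC addKr.
  have := nm_lmul (S n.+1) (G n.+1); have := nm_lmul (P n.+1) (D n.+1).
  rewrite (preS n.+1) nm_cat E.
  move: IH; move: (nm (P n.+1)) (nm (G n)) (nm (G n.+1)) (nm (D n.+1)).
  move=> a b g D' *; nra.
have pG n : pre (fun n => D n.+1) n = G n.
  by elim: n => [|n IH]; rewrite ?G0// GS /= IH.
have xx : 0 <= x / (1 - x) by rewrite divr_ge0// subr_ge0 ltW.
have x1' : 0 < 1 - x by lra.
exists (fun n => D n.+1); split => [n|th].
  rewrite pG; elim: n => [|n IH]; first by rewrite G0 nm_nil.
  rewrite (le_trans (nmG n))// (le_trans (y := x * (1 + x / (1 - x))))//.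
    by rewrite ler_pM ?nm_ge0// ?addr_ge0 ?nm_ge0// lerD2l.
  have -> : 1 + x / (1 - x) = 1 / (1 - x) by field; lra.
  by rewrite mulrA mulr1.
have Fx : mnorm (F th) <= x.
  by apply: conv_bound (c th) => n; apply: le_trans (mnorm_ev _ _) (h n).
pose K := mnorm (W th).
pose e n := mnorm (W th - 1 - ev (G n) th).
pose eta n := mnorm (F th - ev (P n.+1) th) * (1 + (1 + x / (1 - x)) + 1).
suff H : forall a, 0 < a -> exists n0, forall n, (n0 <= n)%N -> e n <= a.
  by move=> a /H [n0 {}H]; exists n0 => n /H; rewrite pG.
(* The error W - 1 - G_n is multiplied at each turn by F, of norm at most x < 1, up to the
   truncation error of F. *)
apply: (contraction_cvg0 (x := x) (eta := eta)); first by rewrite x0.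
- by move=> n; exact: mnorm_ge0.
- move=> n; rewrite /e /eta evG {1}hW [1 + _ - 1]addrAC subrr add0r.
  set g := ev (G n) th; set T := ev _ th.
  have -> : F th * W th - T * (1 + g) = F th * (W th - 1 - g) + (F th - T) * (1 + g).
    rewrite -addrA -opprD mulrBl mulrBr addrA subrK//.
  rewrite (le_trans (mnormD _ _))// lerD//.
    by rewrite (le_trans (mnormM _ _))// ler_wpM2r ?mnorm_ge0.
  rewrite (le_trans (mnormM _ _))// ler_wpM2l ?mnorm_ge0//.
  rewrite (le_trans (mnormD _ _))// mnorm1.
  have : mnorm g <= x / (1 - x).
    rewrite (le_trans (mnorm_ev _ _))//; elim: n {g T} => [|n IH]; first by rewrite G0 nm_nil.
    rewrite (le_trans (nmG n))// (le_trans (y := x * (1 + x / (1 - x))))//.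
      by rewrite ler_pM ?nm_ge0// ?addr_ge0 ?nm_ge0// lerD2l.
    have -> : 1 + x / (1 - x) = 1 / (1 - x) by field; lra.
    by rewrite mulrA mulr1.
  lra.
- move=> a a0; set y := 1 + (1 + x / (1 - x)) + 1 in eta *.
  have y0 : 0 < y by rewrite /y; lra.
  have [n0 H] := c th (a / y) (divr_gt0 a0 y0).
  exists n0 => n nn; rewrite /eta -ler_pdivlMr//; apply: H.
  exact: leq_trans nn (leqnSn _).
Qed.

End Weight.
End Atoms.

(** * The weights exp(2 pi Lambda(|k|) r) *)

Section Weights.
Context {R : realType} {d : nat}.
Implicit Types (k l : 'rV[int]_d) (theta : 'rV[R]_d) (r : R).

Lemma norm1_ge0 (u : 'rV[R]_d) : 0 <= norm1 u.
Proof. by rewrite sumr_ge0. Qed.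

Lemma norm1D (u v : 'rV[R]_d) : norm1 (u + v) <= norm1 u + norm1 v.
Proof.
by rewrite /norm1 -big_split ler_sum// => i _; rewrite mxE ler_normD.
Qed.

Lemma norm1N (u : 'rV[R]_d) : norm1 (- u) = norm1 u.
Proof. by apply: eq_bigr => i _; rewrite mxE normrN. Qed.

Lemma norm1Z (c : R) (u : 'rV[R]_d) : norm1 (c *: u) = `|c| * norm1 u.
Proof. by rewrite /norm1 mulr_sumr; apply: eq_bigr => i _; rewrite mxE normrM. Qed.

Lemma norm1_entry (u : 'rV[R]_d) i : `|u 0 i| <= norm1 u.
Proof. by rewrite /norm1 (bigD1 i)//= lerDl sumr_ge0. Qed.

Lemma freqN p k : freq p (- k) = - freq p k :> 'rV[R]_d.
Proof. by rewrite /freq /rvint map_mxN scalerN. Qed.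

Lemma freq1 k : freq 1 k = rvint k :> 'rV[R]_d.
Proof. by rewrite /freq invr1 scale1r. Qed.

Lemma freq_double k : freq 2 (k *+ 2) = freq 1 k :> 'rV[R]_d.
Proof.
rewrite freq1 mulr2n freqD -scalerDl -[LHS]scale1r.
by rewrite /freq scalerA mul1r (_ : 2^-1 + 2^-1 = 1) ?scale1r//; lra.
Qed.

Lemma rvint_neq0_norm1 k : k != 0 -> 1 <= norm1 (rvint k : 'rV[R]_d).
Proof.
move=> /rV0Pn [i ki]; apply: le_trans (norm1_entry _ i); rewrite mxE.
rewrite -intr_norm -[1]/(1%:~R) ler_int.
by move: ki; case: (k 0 i) => [[|n]|n].
Qed.

Variable L : R -> R.
Hypothesis hL : weight_function L.

Lemma weight_le (x y : R) : 0 <= x -> x <= y -> L x <= L y.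
Proof.
move=> x0; rewrite le_eqVlt => /orP[/eqP -> //|xy].
by apply: ltW; case: hL => _ h _ _; apply: h.
Qed.

(** [L 0] may be positive. The value 0 at k = 0 gives constants the weight 1; the price is a factor
    exp(2 pi [L 0] r) when returning to |.|_r. *)
Definition lam p k : R := if k == 0 then 0 else L (norm1 (freq p k)).

Definition wt p r k : R := expR (2 * pi * lam p k * r).

Lemma lam_ge0 p k : 0 <= lam p k.
Proof.
by rewrite /lam; case: ifP => // _; case: hL => h _ _ _; rewrite h ?norm1_ge0.
Qed.

Lemma lamN p k : lam p (- k) = lam p k.
Proof. by rewrite /lam oppr_eq0 freqN norm1N. Qed.

Lemma lamD p k l : lam p (k + l) <= lam p k + lam p l.
Proof.
rewrite {1}/lam; case: ifPn => [_|kl0]; first by rewrite addr_ge0 ?lam_ge0.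
move: kl0; have [->|k0] := eqVneq k 0.
  by rewrite add0r => l0; rewrite [lam p 0]/lam eqxx add0r /lam (negPf l0).
have [->|l0] := eqVneq l 0 => _.
  by rewrite addr0 [lam p 0]/lam eqxx addr0 /lam (negPf k0).
rewrite /lam (negPf k0) (negPf l0) freqD.
case: hL => _ _ _ h; apply: le_trans (h _ _ (norm1_ge0 _) (norm1_ge0 _)).
by apply: weight_le; [exact: norm1_ge0|exact: norm1D].
Qed.

Lemma lam_double k : lam 2 (k *+ 2) = lam 1 k.
Proof.
rewrite /lam freq_double; congr (if _ then _ else _).
apply/eqP/eqP => [/matrixP h|->]; last by rewrite mul0rn.
by apply/matrixP => i j; have := h i j; rewrite mulr2n !mxE -mulr2n => /eqP; rewrite mulrn_eq0 => /eqP.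
Qed.

Lemma wt_weight p r : 0 <= r -> weight (wt p r).
Proof.
move=> r0; have pp := pi_ge0 R; split => [k||k|k l].
- by rewrite -expR0 ler_expR mulr_ge0// mulr_ge0 ?lam_ge0// mulr_ge0.
- by rewrite /wt /lam eqxx mulr0 mul0r expR0.
- by rewrite /wt lamN.
- rewrite /wt -expRD ler_expR -mulrDl ler_wpM2r// -mulrDr ler_wpM2l ?lamD//.
  by rewrite mulr_ge0.
Qed.

Lemma wt_le p r s k : r <= s -> wt p r k <= wt p s k.
Proof.
move=> rs; rewrite /wt ler_expR ler_wpM2l// mulr_ge0 ?lam_ge0// mulr_ge0 ?pi_ge0//.
Qed.

End Weights.

(** * Passage between T^d and 2T^d *)

Section BoundTransfer.
Context {R : realType} {d : nat}.
Implicit Types (k l : 'rV[int]_d) (theta : 'rV[R]_d) (F : 'rV[R]_d -> 'M[R]_2).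

Lemma nm_wle (w w' : 'rV[int]_d -> R) s : (forall k, w' k <= w k) -> nm w' s <= nm w s.
Proof.
by move=> h; rewrite /nm ler_sum// => a _; rewrite ler_wpM2r ?mnorm_ge0.
Qed.

Lemma bnd_wle p (w w' : 'rV[int]_d -> R) F x : (forall k, w' k <= w k) ->
  bnd p w F x -> bnd p w' F x.
Proof.
by move=> h [S [H c]]; exists S; split => // n; apply: le_trans (nm_wle _ h) (H n).
Qed.

Lemma bnd_reindex p p' (w w' : 'rV[int]_d -> R) (h : 'rV[int]_d -> 'rV[int]_d)
    (P : pred 'rV[int]_d) (S : nat -> seq (@atom R d)) F x :
  (forall k theta, P k -> phase p' (h k) theta = phase p k theta) ->
  (forall k, P k -> w' (h k) = w k) ->
  (forall n, all (fun a => P a.1.1) (S n)) ->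
  (forall n, nm w (pre S n) <= x) ->
  (forall theta, conv (fun n => ev p (pre S n) theta) (F theta)) ->
  bnd p' w' F x.
Proof.
move=> hp hw PS nS cS.
pose g (a : @atom R d) : @atom R d := (h a.1.1, a.1.2, a.2).
exists (fun n => map g (S n)).
have pm n : pre (fun n => map g (S n)) n = map g (pre S n).
  by elim: n => [//|n /= ->]; rewrite map_cat.
have Pp n : all (fun a => P a.1.1) (pre S n).
  by elim: n => [//|n IH] /=; rewrite all_cat IH PS.
split => [n|th].
  apply: le_trans (nS n); rewrite pm /nm big_map le_eqVlt; apply/orP; left; apply/eqP.
  by apply: eq_big_seq => a /(allP (Pp n)) Pa /=; rewrite hw.
apply: conv_ext (cS th) => n; rewrite pm /ev big_map.
by apply: eq_big_seq => a /(allP (Pp n)) Pa /=; rewrite /trig hp.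
Qed.

Lemma bnd12 (L : R -> R) r F x : bnd 1 (wt L 1 r) F x -> bnd 2 (wt L 2 r) F x.
Proof.
move=> [S [nS cS]].
apply: (bnd_reindex (h := fun k => k *+ 2) (P := predT) _ _ _ nS cS).
- by move=> k theta _; rewrite /phase freq_double.
- by move=> k _; rewrite /wt lam_double.
- by move=> n; exact/allP.
Qed.

Lemma cos_int_period (x : R) (q : int) : cos (x + 2 * pi * q%:~R) = cos x.
Proof.
have := expi2pi_int (R := R) q; rewrite /expi2pi => -[c s].
by rewrite cosD c s mulr1 mulr0 subr0.
Qed.

Definition ustep i : 'rV[R]_d := delta_mx 0 i.

Lemma phase_ustep p k theta i :
  phase p k (theta + ustep i) = phase p k theta + 2 * pi * (p%:R^-1 * (k 0 i)%:~R).
Proof.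
rewrite /phase -mulrDr; congr (_ * _); rewrite /dot.
under eq_bigr => j _ do rewrite [(theta + _) 0 j]mxE mulrDr.
rewrite big_split/=; congr (_ + _).
rewrite (bigD1 i)//= big1 ?addr0 => [|j ji]; first by rewrite !mxE !eqxx mulr1.
by rewrite /ustep [delta_mx _ _ _ _]mxE (negPf ji) andbF mulr0.
Qed.

Lemma trig_ustep k phi theta i : trig 2 k phi (theta + ustep i) =
  (if (2 %| k 0%R i)%Z then 1 else -1) * trig 2 k phi theta.
Proof.
rewrite /trig phase_ustep; case: ifPn => [/dvdzP [q ->]|].
  rewrite mul1r intrM -[RHS](cos_int_period _ q); congr cos.
  by rewrite (_ : 2%:~R = 2)//; field.
move=> h; have [q ->] : exists q : int, k 0 i = q * 2 + 1.
  exists ((k 0%R i %/ 2)%Z); rewrite {1}(divz_eq (k 0 i) 2); congr (_ + _).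
  have := modz_ge0 (k 0 i) (d := 2) isT; have := ltz_mod (k 0 i) (d := 2) isT.
  by move: h; rewrite /dvdz/=; move: (k 0 i) => m; lia.
rewrite mulN1r -[cos _ in RHS](cos_int_period _ q) -cosDpi; congr cos.
by rewrite intrD intrM (_ : 2%:~R = 2)// (_ : 1%:~R = 1)//; field.
Qed.

(** Averaging with the translate by the i-th unit vector leaves a 1-periodic function unchanged and
    deletes the atoms whose index has an odd i-th component. After all coordinates only integer
    frequencies remain, and no norm has increased. *)
Lemma bnd21 (L : R -> R) r F x : bnd 2 (wt L 2 r) F x ->
  (forall theta i, F (theta + ustep i) = F theta) -> bnd 1 (wt L 1 r) F x.
Proof.
move=> [S [nS cS]] per.
pose even (s : seq 'I_d) (a : @atom R d) := all (fun i => (2 %| a.1.1 0%R i)%Z) s.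
pose T s n := seq.filter (even s) (S n).
have pT s n : pre (T s) n = seq.filter (even s) (pre S n).
  by elim: n => [//|n /= ->]; rewrite filter_cat.
have cT s theta : conv (fun n => ev 2 (pre (T s) n) theta) (F theta).
  elim: s theta => [|i s IH] theta.
    apply: conv_ext (cS theta) => n; rewrite pT.
    by rewrite (eq_filter (a2 := predT)) ?filter_predT.
  have c1 := conv_lin (f := fun U => 2^-1 *: U) (K := 2^-1) _ _ _
    (convD (IH theta) (IH (theta + ustep i))).
  rewrite per in c1.
  have -> : F theta = 2^-1 *: (F theta + F theta).
    by rewrite scalerDr -scalerDl (_ : 2^-1 + 2^-1 = 1) ?scale1r//; lra.
  apply: conv_ext (c1 _ _ _) => [n|U V|U|U].
  - rewrite !pT /ev !big_filter -big_split scaler_sumr/=.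
    rewrite [RHS]big_mkcond [LHS]big_mkcond/=; apply: eq_bigr => a _.
    rewrite trig_ustep/=; case: (even s a); rewrite ?andbF//= andbT -scalerDl scalerA.
    case: ifP => _; last by rewrite mulN1r subrr mulr0 scale0r.
    by congr (_ *: _); lra.
  - exact: scalerDr.
  - exact: scalerN.
  - by rewrite mnormZ ger0_norm.
pose P k := all (fun i => (2 %| (k : 'rV[int]_d) 0%R i)%Z) (enum 'I_d).
pose h (k : 'rV[int]_d) : 'rV[int]_d := map_mx (fun z => (z %/ 2)%Z) k.
have hk k : P k -> h k *+ 2 = k.
  move=> /allP Pk; apply/matrixP => i j; rewrite mulr2n !mxE ord1.
  by have /divzK h2 := Pk j (mem_enum _ j); rewrite -[in RHS]h2; ring.
apply: (bnd_reindex (S := T (enum 'I_d)) (w := wt L 2 r) (h := h) (P := P) _ _ _ _ (cT _)).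
- by move=> k theta Pk; rewrite -{2}(hk k Pk) /phase freq_double.
- by move=> k Pk; rewrite -{2}(hk k Pk) /wt lam_double.
- by move=> n; rewrite all_filter; apply/allP => a _; exact/implyP.
- move=> n; rewrite pT; apply: le_trans (nS n).
  rewrite /nm big_filter [leLHS]big_mkcond ler_sum// => a _.
  by case: ifP => // _; rewrite mulr_ge0 ?mnorm_ge0// expR_ge0.
Qed.

End BoundTransfer.
#[local] Existing Instance summability.totally_filter.

(** * Comparison with the Fourier norm |.|_r *)

Section FourierNorm.
Context {R : realType} {d : nat}.
Implicit Types (k : 'rV[int]_d) (theta : 'rV[R]_d) (s : seq (@atom R d)).
Local Notation C := (Cplx R).

(** Each entry of v plus q is nondecreasing and each entry minus q is nonincreasing; together with
    the bound on q this gives a bounded monotone sequence. *)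
Lemma conv_exists (v : nat -> 'M[R]_2) (q : nat -> R) x :
  (forall n, mnorm (v n.+1 - v n) <= q n.+1 - q n) -> (forall n, q n <= x) ->
  exists l, conv v l.
Proof.
move=> hv hq.
have qmono n : q n <= q n.+1 by have := hv n; have := mnorm_ge0 (v n.+1 - v n); lra.
have cq : cvgn q.
  by apply: nondecreasing_is_cvgn; [apply/nondecreasing_seqP|exists x => _ [n _ <-]].
have ce i j : cvgn (fun n => v n i j).
  have -> : (fun n => v n i j) = (fun n => (v n i j + q n)) \- q.
    by apply/funext => n /=; rewrite addrK.
  have hd n : `|v n.+1 i j - v n i j| <= q n.+1 - q n.
    apply: le_trans (hv n); have := mnorm_entry (v n.+1 - v n) i j.
    by rewrite !mxE.
  apply: is_cvgB => //; apply: nondecreasing_is_cvgn.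
    by apply/nondecreasing_seqP => n; have := hd n; rewrite ler_norml; lra.
  exists (v 0%N i j - q 0%N + 2 * x) => _ [n _ <-].
  have : v n i j - q n <= v 0%N i j - q 0%N.
    elim: n => // n IH; have := hd n; rewrite ler_norml; lra.
  have := hq n; lra.
exists (\matrix_(i, j) limn (fun n => v n i j)) => e e0.
have h i j : exists n0, forall n, (n0 <= n)%N ->
    `|limn (fun n => v n i j) - v n i j| <= e / 4.
  have /cvgrPdist_le/(_ (e / 4)) := ce i j; move=> /(_ ltac:(lra)) [n0 _ H].
  by exists n0 => n nn; apply: H.
have [n0 h0] := h 0 0; have [n1 h1] := h 0 1.
have [n2 h2] := h 1 0; have [n3 h3] := h 1 1.
exists (maxn (maxn n0 n1) (maxn n2 n3)) => n; rewrite !geq_max => /andP[/andP[a b] /andP[c f]].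
rewrite mnormE !mxE; have := h0 n a; have := h1 n b; have := h2 n c; have := h3 n f; lra.
Qed.

Lemma cplx_le0 (z : C) e : `|complex.Re z| + `|complex.Im z| <= e ->
  `|z| <= real_complex R e.
Proof.
move=> h; rewrite norm_CplxE ler_Cplx (le_trans _ h)//.
case: z {h} => a b /=; rewrite -[leRHS]ger0_norm ?addr_ge0// -sqrtr_sqr.
rewrite ler_wsqrtr// sqrrD !real_normK ?num_real// lerD2r lerDl.
by rewrite mulrn_wge0// mulr_ge0.
Qed.

Lemma cmx_norm_le (M : 'M[C]_2) (e : R) : 0 <= e ->
  (forall i j, `|M i j| <= real_complex R e) -> `|M| <= real_complex R e.
Proof.
move=> e0 h; have e0' : 0 <= real_complex R e by rewrite (ler_Cplx 0).
rewrite [leLHS]/Num.norm/= mx_normE -[leRHS]/((NngNum e0')%:num) num_le.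
by apply/bigmax_leP; split => [|i _]; rewrite -num_le//=.
Qed.

Lemma normc_subRe (x : R) (z : C) :
  `|x - complex.Re z| <= ComplexField.Normc.normc (real_complex R x - z).
Proof. by case: z => a b; rewrite /= -sqrtr_sqr ler_wsqrtr// lerDl sqr_ge0. Qed.

Definition cz (l m : 'M[R]_2) : 'M[C]_2 := \matrix_(i, j) (l i j +i* m i j)%C.

Lemma cmxnorm_cz l m : cmxnorm (cz l m) <= mnorm l + mnorm m.
Proof.
apply/bigmax_le => [|[i j] _]; first by rewrite addr_ge0 ?mnorm_ge0.
rewrite mxE -ler_Cplx -norm_CplxE; apply: cplx_le0 => /=.
by rewrite lerD ?mnorm_entry.
Qed.

(** Real part of the coefficient at k: an atom of phase phi contributes exp(i phi) / 2 at its own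
    frequency and exp(- i phi) / 2 at the opposite one. [cim] is the imaginary part. *)
Definition cre s k : 'M[R]_2 :=
  \sum_(a <- s) (((a.1.1 == k)%:R + (a.1.1 == - k)%:R) * (2^-1 * cos a.1.2)) *: a.2.
Definition cim s k : 'M[R]_2 :=
  \sum_(a <- s) (((a.1.1 == k)%:R - (a.1.1 == - k)%:R) * (2^-1 * sin a.1.2)) *: a.2.

Lemma cre_cat s t k : cre (s ++ t) k = cre s k + cre t k.
Proof. by rewrite /cre big_cat. Qed.
Lemma cim_cat s t k : cim (s ++ t) k = cim s k + cim t k.
Proof. by rewrite /cim big_cat. Qed.

Definition nmk s k : R :=
  \sum_(a <- s) (((a.1.1 == k)%:R + (a.1.1 == - k)%:R) * 2^-1 * mnorm a.2).

Lemma mnorm_cre s k : mnorm (cre s k) <= nmk s k.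
Proof.
rewrite (le_trans (mnorm_sum _ _))// ler_sum// => a _; rewrite mnormZ.
rewrite ler_wpM2r ?mnorm_ge0// !normrM ger0_norm ?addr_ge0// ler_wpM2l ?addr_ge0//.
by rewrite ger0_norm// ler_piMr// ler_norml cos_geN1 cos_le1.
Qed.

Lemma mnorm_cim s k : mnorm (cim s k) <= nmk s k.
Proof.
rewrite (le_trans (mnorm_sum _ _))// ler_sum// => a _; rewrite mnormZ.
rewrite ler_wpM2r ?mnorm_ge0// !normrM ler_pM// ?mulr_ge0//.
  by rewrite (le_trans (ler_normB _ _))// !ger0_norm.
by rewrite ger0_norm// ler_piMr// ler_norml sin_geN1 sin_le1.
Qed.

Lemma sum_delta (B : seq 'rV[int]_d) (f : 'rV[int]_d -> R) m : uniq B ->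
  \sum_(k <- B) (m == k)%:R * f k = if m \in B then f m else 0.
Proof.
move=> uB; case: ifPn => mB.
  rewrite (bigD1_seq m)//= eqxx mul1r big1 ?addr0// => k km.
  by rewrite eq_sym (negPf km) mul0r.
rewrite big_seq big1// => k kB; case: eqVneq => [mk|_]; rewrite ?mul0r//.
by rewrite mk kB in mB.
Qed.

Section Coefficients.
Variable w : 'rV[int]_d -> R.
Hypothesis wW : weight w.

Lemma nmk_le s k : nmk s k <= nm w s.
Proof.
rewrite /nmk /nm ler_sum// => a _; rewrite ler_wpM2r ?mnorm_ge0//.
case: wW => /(_ a.1.1) w1 _ _ _; apply: le_trans w1.
by case: (_ == k); case: (_ == - k); rewrite /=; lra.
Qed.

(** Each atom is counted with half its norm at two opposite frequencies, which have the same
    weight. *)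
Lemma sum_nmk s (B : seq 'rV[int]_d) : uniq B ->
  \sum_(k <- B) w k * nmk s k <= nm w s.
Proof.
move=> uB; rewrite /nmk; under eq_bigr do rewrite mulr_sumr.
rewrite exchange_big/= ler_sum// => a _.
have -> : \sum_(k <- B) w k * (((a.1.1 == k)%:R + (a.1.1 == - k)%:R) / 2 * mnorm a.2) =
    (\sum_(k <- B) (a.1.1 == k)%:R * w k + \sum_(k <- B) (- a.1.1 == k)%:R * w k) / 2 * mnorm a.2.
  rewrite -big_split !mulr_suml; apply: eq_bigr => k _.
  by rewrite /= eqr_oppLR; ring.
rewrite ler_wpM2r ?mnorm_ge0// !sum_delta//.
case: wW => w1 _ -> _; have := w1 a.1.1.
by case: (_ \in B); case: (_ \in B); lra.
Qed.

(** For finitely many k a single prefix approximates all the coefficients; the factor 2 is for real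
    and imaginary parts. *)
Lemma coef_limit_bound S x (l m : 'rV[int]_d -> 'M[R]_2) (B : seq 'rV[int]_d) : uniq B ->
  (forall n, nm w (pre S n) <= x) ->
  (forall k, conv (fun n => cre (pre S n) k) (l k)) ->
  (forall k, conv (fun n => cim (pre S n) k) (m k)) ->
  \sum_(k <- B) w k * (mnorm (l k) + mnorm (m k)) <= 2 * x.
Proof.
move=> uB nS cl cm; apply/ler_addgt0Pr => e e0.
have w1 k : 1 <= w k by case: wW.
have w0 k : 0 <= w k by rewrite (le_trans _ (w1 k)).
pose W := \sum_(k <- B) w k.
have W0 : 0 <= W by rewrite sumr_ge0.
pose e1 := e / 2 / (W + 1).
have e10 : 0 < e1 by rewrite !divr_gt0//; lra.
have [n H] : exists n0, forall n, (n0 <= n)%N -> forall k, k \in B ->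
    mnorm (l k - cre (pre S n) k) <= e1 /\ mnorm (m k - cim (pre S n) k) <= e1.
  elim: (B) => [|k B' [n0 IH]]; first by exists 0%N.
  have [n1 h1] := cl k e1 e10; have [n2 h2] := cm k e1 e10.
  exists (maxn n0 (maxn n1 n2)) => n; rewrite !geq_max => /andP[a /andP[b c]] k'.
  rewrite inE => /predU1P[->|]; first by split; [exact: h1|exact: h2].
  exact: IH.
have {}H := H n (leqnn _).
apply: (le_trans (y := \sum_(k <- B) (2 * (w k * nmk (pre S n) k) + 2 * e1 * w k))).
  rewrite big_seq [leRHS]big_seq ler_sum// => k /H[h1 h2].
  have a1 : mnorm (l k) <= e1 + nmk (pre S n) k.
    rewrite -(subrK (cre (pre S n) k) (l k)) (le_trans (mnormD _ _))// lerD//.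
    exact: mnorm_cre.
  have a2 : mnorm (m k) <= e1 + nmk (pre S n) k.
    rewrite -(subrK (cim (pre S n) k) (m k)) (le_trans (mnormD _ _))// lerD//.
    exact: mnorm_cim.
  have := ler_wpM2l (w0 k) (lerD a1 a2); lra.
rewrite big_split/= -!mulr_sumr -/W.
have := le_trans (sum_nmk (pre S n) uB) (nS n).
have : 2 * e1 * W <= e.
  have -> : 2 * e1 * W = e * (W / (W + 1)) by rewrite /e1; field; lra.
  by rewrite ler_piMr ?(ltW e0)// ler_pdivrMr; lra.
lra.
Qed.

End Coefficients.

Lemma sum_complex (I : Type) (B : seq I) (u v : I -> R) :
  \sum_(k <- B) (u k +i* v k)%C = ((\sum_(k <- B) u k) +i* (\sum_(k <- B) v k))%C :> C.
Proof.
by elim: B => [|k B IH]; rewrite ?big_nil// !big_cons IH.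
Qed.

Lemma fourier_ev p s (B : seq 'rV[int]_d) theta : uniq B ->
  (forall a, a \in s -> (a.1.1 \in B) && (- a.1.1 \in B)) ->
  \sum_(k <- B) expi2pi (dot (freq p k) theta) *: cz (cre s k) (cim s k) =
  map_mx (real_complex R) (ev p s theta).
Proof.
move=> uB hB; apply/matrixP => i j; rewrite summxE mxE.
under eq_bigr => k _ do rewrite mxE [cz _ _ _ _]mxE /expi2pi -/(phase p k theta).
have E k : (cos (phase p k theta) +i* sin (phase p k theta))%C *
   (cre s k i j +i* cim s k i j)%C =
   ((\sum_(a <- s) (((a.1.1 == k)%:R * (2^-1 * cos (phase p k theta + a.1.2))
     + (- a.1.1 == k)%:R * (2^-1 * cos (phase p k theta - a.1.2))) * a.2 i j)) +i*
   (\sum_(a <- s) (((a.1.1 == k)%:R * (2^-1 * sin (phase p k theta + a.1.2))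
     + (- a.1.1 == k)%:R * (2^-1 * sin (phase p k theta - a.1.2))) * a.2 i j)))%C :> C.
  rewrite /cre /cim !summxE; simpc; congr (_ +i* _)%C.
    rewrite !mulr_sumr -sumrB; apply: eq_bigr => a _.
    by rewrite !mxE cosD cosB [- _ == k]eqr_oppLR; ring.
  rewrite !mulr_sumr -big_split; apply: eq_bigr => a _.
  by rewrite !mxE sinD sinB [- _ == k]eqr_oppLR/=; ring.
rewrite (eq_bigr _ (fun k _ => E k)) sum_complex.
rewrite exchange_big/= [X in (_ +i* X)%C]exchange_big/= /ev summxE.
rewrite -[RHS]/((_ +i* 0)%C); congr (_ +i* _)%C.
  apply: eq_big_seq => a /hB/andP[h1 h2].
  rewrite -mulr_suml big_split/= !sum_delta// h1 h2 mxE; congr (_ * _).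
  rewrite /trig phaseN -opprD cosN; lra.
rewrite big_seq big1// => a /hB/andP[h1 h2].
rewrite -mulr_suml big_split/= !sum_delta// h1 h2.
by rewrite phaseN -opprD sinN mulrN subrr mul0r.
Qed.

Variable L : R -> R.
Hypothesis hL : weight_function L.

Lemma conv_shift (u : nat -> 'M[R]_2) l n : conv u l -> conv (fun i => u (n + i)%N) l.
Proof.
move=> h e /h [n0 H]; exists n0 => i ni; apply: H.
exact: leq_trans ni (leq_addl _ _).
Qed.

Lemma convBr (u : nat -> 'M[R]_2) l m : conv u l -> conv (fun i => u i - m) (l - m).
Proof. by move=> h; apply: convD h (conv_cst _). Qed.

Lemma esum_le_fset (a : 'rV[int]_d -> R) y :
  (forall B : {fset 'rV[int]_d}, \sum_(k <- B) a k <= y) ->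
  (\esum_(k in [set: 'rV[int]_d]) (a k)%:E <= y%:E)%E.
Proof.
move=> h; apply: ge_ereal_sup => _ [X [finX _] <-].
rewrite -[X](fset_setK finX) fsbig_finite//= set_fsetK sumEFin lee_fin.
exact: h.
Qed.

Lemma fset_le_esum (a : 'rV[int]_d -> R) y (B : {fset 'rV[int]_d}) :
  (\esum_(k in [set: 'rV[int]_d]) (a k)%:E <= y%:E)%E ->
  \sum_(k <- B) a k <= y.
Proof.
rewrite -lee_fin; apply: le_trans; apply: esum_ge; exists [set` B]; first by split.
by rewrite fsbig_finite//= set_fsetK sumEFin.
Qed.

Lemma cplx_pos (e : C) : 0 < e -> exists2 e' : R, 0 < e' & e = real_complex R e'.
Proof.
case: e => a b; rewrite ltcE/= => /andP[/eqP h a0]; exists a => //; congr (_ +i* _)%C; by rewrite ?h// -h.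
Qed.

Lemma psumE (f : 'rV[int]_d -> 'M[C]_2) (B : {fset 'rV[int]_d}) :
  summability.partial_sum f B = \sum_(k <- B) f k.
Proof. by rewrite /summability.partial_sum big_seq_fsetE. Qed.

(** The factor 2 is for real and imaginary parts, and exp(2 pi [L 0] r) for the frequency 0, where
    [lam] differs from [L]. *)
Lemma unorm_bnd p r (F : 'rV[R]_d -> 'M[R]_2) x :
  (0 < p)%N -> 0 <= r -> bnd p (wt L p r) F x ->
  (unorm p L r F <= (2 * expR (2 * pi * L 0 * r) * x)%:E)%E.
Proof.
move=> p0 r0 [S [nS cS]]; set w := wt L p r in nS.
have wW : weight w := wt_weight hL p r0.
have ex k : exists l m, conv (fun n => cre (pre S n) k) l /\ conv (fun n => cim (pre S n) k) m.
  have [l hl] : exists l, conv (fun n => cre (pre S n) k) l.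
    apply: (conv_exists (q := fun n => nm w (pre S n)) _ nS) => n.
    rewrite /= cre_cat nm_cat addrAC subrr add0r addrAC subrr add0r.
    exact: le_trans (mnorm_cre _ _) (nmk_le wW _ _).
  have [m hm] : exists m, conv (fun n => cim (pre S n) k) m.
    apply: (conv_exists (q := fun n => nm w (pre S n)) _ nS) => n.
    rewrite /= cim_cat nm_cat addrAC subrr add0r addrAC subrr add0r.
    exact: le_trans (mnorm_cim _ _) (nmk_le wW _ _).
  by exists l, m.
have [l {}ex] := choice ex; have [m {}ex] := choice ex.
have cl k := (ex k).1; have cm k := (ex k).2.
pose c k := cz (l k) (m k).
have K1 : 1 <= expR (2 * pi * L 0 * r).
  rewrite -expR0 ler_expR !mulr_ge0 ?pi_ge0//; by case: hL => h _ _ _; apply: h.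
set K := expR _ in K1 *.
have WK k : expR (2 * pi * L (norm1 (freq p k)) * r) <= K * w k.
  rewrite /w /wt /lam; case: eqP => [->|_].
    by rewrite mulr0 mul0r expR0 mulr1 /freq /rvint map_mx0 scaler0 /norm1 big1// => i _; rewrite mxE normr0.
  by rewrite ler_peMl// expR_ge0.
have sumB (B : {fset 'rV[int]_d}) :
    \sum_(k <- B) cmxnorm (c k) * expR (2 * pi * L (norm1 (freq p k)) * r) <= 2 * K * x.
  apply: (le_trans (y := \sum_(k <- B) K * (w k * (mnorm (l k) + mnorm (m k))))).
    apply: ler_sum => k _; have := WK k; have := cmxnorm_cz (l k) (m k); rewrite -/(c k).
    have := expR_ge0 (2 * pi * L (norm1 (freq p k)) * r); have := cmxnorm_ge0 (c k).
    move: (expR _) (cmxnorm _) (mnorm _ + mnorm _) => a b e b0 a0 be aw.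
    by rewrite mulrA [leRHS]mulrC ler_pM.
  rewrite -mulr_sumr mulrAC [_ * K]mulrC ler_wpM2l//; first exact: le_trans ler01 K1.
  by apply: (coef_limit_bound wW _ nS cl cm); exact: fset_uniq.
have fe : fourier_expansion p F c.
  split.
    apply: le_lt_trans (ltry (2 * K * x)); apply: esum_le_fset => B.
    apply: le_trans (sumB B); apply: ler_sum => k _.
    rewrite ler_peMr ?cmxnorm_ge0// -expR0 ler_expR !mulr_ge0 ?pi_ge0//.
    by case: hL => h _ _ _; apply: h; exact: norm1_ge0.
  (* A prefix is a finite Fourier sum, exact as soon as B contains its frequencies and their
     opposites. What follows it has norm at most e / 3, which counts once in the value of F and at
     most twice in the coefficients. *)
  move=> theta; apply/cvgrPdist_le => e0 /cplx_pos[e e_gt0 ->].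
  pose e1 := e / 3; have e10 : 0 < e1 by rewrite /e1; lra.
  pose A := [set nm w (pre S n) | n in [set: nat]].
  have hA : has_sup A.
    by split; [exists (nm w (pre S 0)), 0%N|exists x => _ [n _ <-]].
  have [_ [n _ <-] Hn] := sup_adherent e10 hA.
  have ub i : nm w (pre S i) <= sup A by apply: ub_le_sup; [case: hA|exists i].
  pose T i := S (n + i)%N.
  have pT i : pre S (n + i) = pre S n ++ pre T i.
    elim: i => [|i IH]; first by rewrite addn0 cats0.
    by rewrite addnS/= IH catA.
  have nT i : nm w (pre T i) <= e1.
    by have := ub (n + i)%N; rewrite pT nm_cat; lra.
  pose l' k := l k - cre (pre S n) k; pose m' k := m k - cim (pre S n) k.
  have cl' k : conv (fun i => cre (pre T i) k) (l' k).
    apply: conv_ext (convBr (cre (pre S n) k) (conv_shift n (cl k))) => i.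
    by rewrite pT cre_cat addrC addKr.
  have cm' k : conv (fun i => cim (pre T i) k) (m' k).
    apply: conv_ext (convBr (cim (pre S n) k) (conv_shift n (cm k))) => i.
    by rewrite pT cim_cat addrC addKr.
  have F1 : mnorm (F theta - ev p (pre S n) theta) <= e1.
    apply: (conv_bound (u := fun i => ev p (pre T i) theta)).
      by move=> i; apply: le_trans (mnorm_ev p wW _ _) (nT i).
    apply: conv_ext (convBr (ev p (pre S n) theta) (conv_shift n (cS theta))) => i.
    by rewrite pT ev_cat addrC addKr.
  have [s0 hs0] : exists s0 : seq 'rV[int]_d, forall a, a \in pre S n ->
      (a.1.1 \in s0) && (- a.1.1 \in s0).
    exists (map (fun a : @atom R d => a.1.1) (pre S n) ++
            map (fun a : @atom R d => - a.1.1) (pre S n)) => a ha; rewrite !mem_cat.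
    apply/andP; split; apply/orP; [left|right]; by apply/mapP; exists a.
  pose B0 := [fset k in s0]%fset.
  exists B0 => // B /= /fsubsetP sB.
  rewrite psumE.
  have FE := @fourier_ev p (pre S n) B theta (fset_uniq _).
  have -> : map_mx (real_complex R) (F theta) - \sum_(k <- B) expi2pi (dot (freq p k) theta) *: c k =
     map_mx (real_complex R) (F theta - ev p (pre S n) theta) -
     \sum_(k <- B) expi2pi (dot (freq p k) theta) *: cz (l' k) (m' k).
    rewrite map_mxB -FE => [|a ha]; last first.
      by have /andP[h1 h2] := hs0 a ha; rewrite !sB// !inE.
    rewrite -[_ - _ - _]addrA -opprD -big_split/=; congr (_ - _); apply: eq_bigr => k _.
    rewrite -scalerDr; congr (_ *: _); apply/matrixP => i j; rewrite !mxE.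
    by rewrite /c /l' /m'; simpc; rewrite /= !subrKC.
  apply: cmx_norm_le => [|i j]; first exact: ltW.
  set X := map_mx _ _; set Y := \sum_(k <- B) _.
  have -> : (X - Y) i j = X i j - Y i j by rewrite [LHS]mxE [X in _ + X]mxE.
  rewrite (le_trans (ler_normB _ _))// /X /Y.
  have -> : e = e1 + 2 * e1 by rewrite /e1; field.
  have -> : real_complex R (e1 + 2 * e1) = real_complex R e1 + real_complex R (2 * e1).
    exact: rmorphD.
  apply: lerD.
    rewrite mxE; apply: cplx_le0; rewrite /= normr0 addr0.
    exact: le_trans (mnorm_entry _ _ _) F1.
  have h := coef_limit_bound wW (fset_uniq B) nT cl' cm'.
  apply: (le_trans (y := real_complex R (\sum_(k <- B) w k * (mnorm (l' k) + mnorm (m' k))))); last by rewrite ler_Cplx.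
  rewrite summxE (le_trans (ler_norm_sum _ _ _))// rmorph_sum ler_sum// => k _.
  rewrite mxE normrM norm_expi2pi mul1r mxE; apply: cplx_le0.
  rewrite /= (le_trans (lerD (mnorm_entry _ _ _) (mnorm_entry _ _ _)))//.
  by rewrite ler_peMl ?addr_ge0 ?mnorm_ge0//; case: wW => /(_ k).
rewrite /unorm; case: asboolP => [_|]; last by case; exists c.
by rewrite (fourier_coefE p0 fe); exact: esum_le_fset.
Qed.

(** The factor 8 counts four entries with real and imaginary parts. As F is real, the real part of
    its Fourier series is enough, and [at_ k] represents the real part of the term at k. *)
Lemma bnd_unorm p r (F : 'rV[R]_d -> 'M[R]_2) x :
  (0 < p)%N -> 0 <= r -> (unorm p L r F <= x%:E)%E -> bnd p (wt L p r) F (8 * x).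
Proof.
move=> p0 r0; rewrite /unorm; case: asboolP => [[c fe]|_]; last by rewrite leye_eq.
rewrite (fourier_coefE p0 fe) => hx.
have [_ cF] := fe.
pose re k : 'M[R]_2 := \matrix_(i, j) complex.Re (c k i j).
pose im k : 'M[R]_2 := \matrix_(i, j) complex.Im (c k i j).
have rei k : mnorm (re k) + mnorm (im k) <= 8 * cmxnorm (c k).
  have h i j : `|complex.Re (c k i j)| <= cmxnorm (c k) /\ `|complex.Im (c k i j)| <= cmxnorm (c k).
    have := norm_le_cmxnorm (c k) i j; rewrite norm_CplxE ler_Cplx.
    case: (c k i j) => a b /= hab; split; apply: le_trans hab; rewrite -sqrtr_sqr ler_wsqrtr//.
      by rewrite lerDl sqr_ge0.
    by rewrite lerDr sqr_ge0.
  rewrite !mnormE !mxE.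
  have [] := h 0 0; have [] := h 0 1; have [] := h 1 0; have [] := h 1 1; lra.
pose at_ k : seq (@atom R d) := [:: (k, 0, re k); (k, pi / 2, im k)].
pose K n := pmap (@choice.pickle_inv 'rV[int]_d) (iota 0 n).
(* Z^d is enumerated through its countable encoding; a number that encodes nothing gives an empty
   block. *)
pose S n := if choice.pickle_inv n is Some k then at_ k else [::].
have pS n : pre S n = flatten (map at_ (K n)).
  elim: n => [//|n IH]; rewrite [LHS]/= IH /K.
  have -> : iota 0 n.+1 = iota 0 n ++ [:: n] by rewrite -[n.+1]addn1 iotaD add0n.
  rewrite pmap_cat map_cat flatten_cat/=; congr (_ ++ _); rewrite /S; case: (choice.pickle_inv n) => [k|]//=.
have uK n : uniq (K n) by apply: (pmap_uniq choice.pickle_invK); exact: iota_uniq.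
have evS (B : seq 'rV[int]_d) theta : ev p (flatten (map at_ B)) theta =
    \matrix_(i, j) complex.Re ((\sum_(k <- B) expi2pi (dot (freq p k) theta) *: c k) i j).
  elim: B => [|k B IH].
    by rewrite ev_nil; apply/matrixP => i j; rewrite !mxE big_nil mxE.
  rewrite [ev _ _ _]/= -[_ :: _ :: flatten _]/(at_ k ++ flatten (map at_ B)) ev_cat IH.
  apply/matrixP => i j; rewrite [in RHS]mxE big_cons [in RHS]mxE [in LHS]mxE.
  rewrite [X in _ + X]mxE raddfD/=; congr (_ + _).
  rewrite !ev_cons ev_nil addr0 !mxE/= /trig addr0 cosDpihalf -/(phase p k theta).
  by rewrite /expi2pi -/(phase p k theta); case: (c k i j) => a b; simpc.
have nmS (B : seq 'rV[int]_d) : uniq B -> nm (wt L p r) (flatten (map at_ B)) <= 8 * x.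
  move=> uB; have hB := fset_le_esum [fset k in B]%fset hx.
  have : nm (wt L p r) (flatten (map at_ B)) <= 8 * \sum_(k <- B) cmxnorm (c k) * expR (2 * pi * L (norm1 (freq p k)) * r).
    elim: (B) => [|k B' IH]; first by rewrite nm_nil big_nil mulr0.
    rewrite -[flatten _]/(at_ k ++ flatten (map at_ B')) nm_cat big_cons mulrDr lerD//.
    rewrite !nm_cons nm_nil addr0/= -mulrDr mulrA mulrC ler_pM ?addr_ge0 ?mnorm_ge0 ?expR_ge0//.
    rewrite /wt ler_expR /lam; case: eqP => [->|//].
    rewrite mulr0 mul0r !mulr_ge0 ?pi_ge0//; by case: hL => h _ _ _; apply: h; exact: norm1_ge0.
  move=> /le_trans; apply; rewrite ler_wpM2l//; apply: le_trans hB.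
  rewrite le_eqVlt; apply/orP; left; apply/eqP/perm_big/uniq_perm => //; first exact: fset_uniq.
  by move=> k; rewrite !inE.
exists S; split => [n|theta]; first by rewrite pS nmS.
move=> e e0.
have /cvgrPdist_le/(_ (real_complex R (e / 4))) := cF theta.
rewrite (ltr_Cplx 0) => /(_ ltac:(lra)) [B _ HB].
exists (\sum_(k <- B) (choice.pickle k).+1)%N => n nn.
have sub : (B `<=` [fset k in K n])%fset.
  apply/fsubsetP => k kB; rewrite !inE /K mem_pmap; apply/mapP.
  exists (choice.pickle k); last by rewrite choice.pickleK_inv.
  rewrite mem_iota add0n; apply: leq_trans nn.
  by rewrite (big_fsetD1 k)//= leq_addr.
have := HB _ sub; rewrite /= psumE.
rewrite (_ : \sum_(k <- [fset k in K n]%fset) expi2pi (dot (freq p k) theta) *: c k =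
   \sum_(k <- K n) expi2pi (dot (freq p k) theta) *: c k); last first.
  by apply/perm_big/uniq_perm; rewrite ?fset_uniq// => k; rewrite !inE.
set D := (X in `|X| <= _) => hD; rewrite pS evS.
have hij i j : `|(F theta - \matrix_(i, j) complex.Re ((\sum_(k <- K n) expi2pi (dot (freq p k) theta) *: c k) i j)) i j| <= e / 4.
  have : `|D i j| <= real_complex R (e / 4).
    apply: le_trans hD; rewrite [leRHS]/Num.norm/= mx_normE.
    exact: (@le_bigmax _ _ _ _ (fun ij : 'I_2 * 'I_2 => `|D ij.1 ij.2|%:nng)%R (i, j)).
  rewrite norm_CplxE ler_Cplx; apply: le_trans; rewrite /D !mxE.
  exact: normc_subRe.
rewrite mnormE; have := hij 0 0; have := hij 0 1; have := hij 1 0; have := hij 1 1; lra.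
Qed.

End FourierNorm.

(** * Derivatives along omega *)

Section Derivatives.
Context {R : realType} {d : nat} (omega : 'rV[R]_d).
Implicit Types (t : 'rV[R]_d) (f g : 'rV[R]_d -> R) (F G : 'rV[R]_d -> 'M[R]_2).
Implicit Types (A B : 'M[R]_2).

Lemma is_derive_add f g t a b : is_derive t omega f a -> is_derive t omega g b ->
  is_derive t omega (fun x => f x + g x) (a + b).
Proof. by move=> h k; exact: is_deriveD. Qed.

Lemma is_derive_mul f g t a b : is_derive t omega f a -> is_derive t omega g b ->
  is_derive t omega (fun x => f x * g x) (a * g t + f t * b).
Proof.
move=> h k; apply: is_derive_eq (is_deriveM h k) _.
by rewrite /GRing.scale/= addrC [g t * a]mulrC.
Qed.

Lemma is_derive_const (c : R) t : is_derive t omega (fun=> c) 0.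
Proof. exact: is_derive_cst. Qed.

Lemma is_derive_line f t a :
  is_derive (0 : R) 1 (fun h : R => f (h *: omega + t)) a -> is_derive t omega f a.
Proof.
move=> [h e]; split; first exact/derivable1P.
transitivity (lim ((fun h : R => h^-1 *: (f (h *: omega + t) - f t)) @ (0 : R)^')); first by [].
rewrite (_ : (fun h : R => h^-1 *: (f (h *: omega + t) - f t)) = (fun h : R =>
   h^-1 *: (f ((h *: (1 : R) + 0) *: omega + t) - f ((0 : R) *: omega + t)))); first exact: e.
apply/funext => s /=.
by rewrite scale0r add0r addr0 /GRing.scale/= mulr1.
Qed.

(** Entrywise, so that the product rule reduces to scalar functions; [dM_is_derive] recovers the
    derivative of the statement. *)
Definition dM F A t := forall i j, is_derive t omega (fun x => F x i j) (A i j).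

Lemma dM_is_derive F A t : dM F A t -> is_derive t omega F A.
Proof.
move=> h; have dF : derivable F t omega.
  by apply/derivable_mxP => i j; have [] := h i j.
split => //; rewrite derive_mx//; apply/matrixP => i j; rewrite mxE.
by have [] := h i j.
Qed.

Lemma dM_uniq F A B t : dM F A t -> dM F B t -> A = B.
Proof.
by move=> h k; apply/matrixP => i j; have [_ <-] := h i j; have [_ <-] := k i j.
Qed.

Lemma dM_eq F A B t : dM F A t -> A = B -> dM F B t.
Proof. by move=> h <-. Qed.

Lemma dM_ext F G A t : (forall x, F x = G x) -> dM F A t -> dM G A t.
Proof. by move=> /funext ->. Qed.

Lemma dM_cst B t : dM (fun=> B) 0 t.
Proof. by move=> i j; rewrite mxE; exact: is_derive_const. Qed.

Lemma dMD F G A B t : dM F A t -> dM G B t -> dM (fun x => F x + G x) (A + B) t.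
Proof.
move=> h k i j; rewrite mxE.
rewrite (_ : (fun x => (F x + G x) i j) = fun x => F x i j + G x i j).
  exact: is_derive_add.
by apply/funext => x; rewrite mxE.
Qed.

Lemma dMZ f F a A t : is_derive t omega f a -> dM F A t ->
  dM (fun x => f x *: F x) (a *: F t + f t *: A) t.
Proof.
move=> h k i j; rewrite !mxE.
rewrite (_ : (fun x => (f x *: F x) i j) = fun x => f x * F x i j).
  exact: is_derive_mul.
by apply/funext => x; rewrite mxE.
Qed.

Lemma dMZc c F A t : dM F A t -> dM (fun x => c *: F x) (c *: A) t.
Proof.
move=> h; apply: dM_eq (dMZ (is_derive_const c t) h) _.
by rewrite scale0r add0r.
Qed.

Lemma dMN F A t : dM F A t -> dM (fun x => - F x) (- A) t.
Proof.
move=> h; apply: dM_eq (dM_ext _ (dMZc (-1) h)) _ => [x|]; by rewrite scaleN1r.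
Qed.

Lemma dMB F G A B t : dM F A t -> dM G B t -> dM (fun x => F x - G x) (A - B) t.
Proof. by move=> h k; apply: dMD h (dMN k). Qed.

Lemma dMM F G A B t : dM F A t -> dM G B t ->
  dM (fun x => F x * G x) (A * G t + F t * B) t.
Proof.
move=> h k i j; rewrite !mxE !sum2.
rewrite (_ : (fun x => (F x * G x) i j) =
    fun x => F x i 0 * G x 0 j + F x i 1 * G x 1 j); last first.
  by apply/funext => x; rewrite mxE sum2.
apply: is_derive_eq.
  by apply: is_derive_add; apply: is_derive_mul; [exact: h|exact: k|exact: h|exact: k].
by rewrite /=; ring.
Qed.

Lemma dM_adj2 F A t : dM F A t -> dM (fun x => adj2 (F x)) (adj2 A) t.
Proof.
move=> h i j.
have hN i' j' : is_derive t omega (fun x => - F x i' j') (- A i' j').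
  have hk := h i' j'; exact: is_deriveN.
rewrite (_ : (fun x => adj2 (F x) i j) = fun x => (mk (F x 1 1) (- F x 0 1) (- F x 1 0) (F x 0 0)) i j)//.
move: i j; apply: ord2P; apply: ord2P; rewrite /adj2 !mxE/=.
- rewrite (_ : (fun x => _) = fun x => F x 1 1); first exact: h.
  by apply/funext => x; rewrite mxE.
- rewrite (_ : (fun x => _) = fun x => - F x 0 1); first exact: hN.
  by apply/funext => x; rewrite mxE.
- rewrite (_ : (fun x => _) = fun x => - F x 1 0); first exact: hN.
  by apply/funext => x; rewrite mxE.
- rewrite (_ : (fun x => _) = fun x => F x 0 0); first exact: h.
  by apply/funext => x; rewrite mxE.
Qed.

Lemma dM_tl F A t : dM F A t -> dM (fun x => tl (F x)) (tl A) t.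
Proof.
move=> h; have h2 : dM (fun x => 2^-1 *: (F x - adj2 (F x))) (2^-1 *: (A - adj2 A)) t.
  exact: dMZc (dMB h (dM_adj2 h)).
have E (M : 'M[R]_2) : tl M = 2^-1 *: (M - adj2 M).
  rewrite /tl tr2E (mkE M) /adj2 !mxE/= mk1 !(mkZ, mkN, mkD).
  by congr mk; field.
by apply: dM_eq (dM_ext _ h2) _ => [x|]; rewrite E.
Qed.

(** Differentiability comes from W being the adjugate of F divided by its determinant; the value
    follows by differentiating W F = 1. *)
Lemma dM_inv F W A t : dM F A t -> (forall x, W x * F x = 1) -> (forall x, F x * W x = 1) ->
  dM W (- (W t * A * W t)) t.
Proof.
move=> h WF FW.
have dF x : \det (F x) * \det (W x) = 1 by rewrite -det_mulmx -[_ *m _]/(_ * _) FW det1.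
have dF0 x : \det (F x) != 0.
  by apply/eqP => e; move: (dF x); rewrite e mul0r => /eqP; rewrite eq_sym oner_eq0.
have WE x : W x = (\det (F x))^-1 *: adj2 (F x).
  have : adj2 (F x) * F x * W x = \det (F x) *: W x.
    by rewrite mul_adj2l -[_%:M * _]/(_ *m _) mul_scalar_mx.
  rewrite -mulrA FW mulr1 => ->; by rewrite scalerA mulVf// scale1r.
have [B dW] : exists B, dM W B t.
  pose D := fun x => F x 0 0 * F x 1 1 + (-1) * (F x 0 1 * F x 1 0).
  have [a ha] : exists a, is_derive t omega D a.
    eexists; apply: is_derive_add; first exact: is_derive_mul (h 0 0) (h 1 1).
    exact: is_derive_mul (is_derive_const (-1) t) (is_derive_mul (h 0 1) (h 1 0)).
  have DE x : D x = \det (F x) by rewrite det2E /D; ring.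
  have D0 : D t != 0 by rewrite DE.
  have [dD _] := ha; have hV := derivableP (derivableV D0 dD).
  eexists; apply: dM_ext (dMZ hV (dM_adj2 h)) => x.
  by rewrite WE -DE.
have := dMM dW h.
move/(dM_ext (G := fun=> 1)) => /(_ WF) /dM_uniq /(_ (dM_cst 1 t)) e.
apply: dM_eq dW _; apply/eqP; rewrite -addr_eq0; apply/eqP.
have := congr1 (fun X => X * W t) e.
by rewrite mul0r mulrDl -[B * _ * _]mulrA FW mulr1.
Qed.

Lemma phase_line p k (h : R) t : phase p k (h *: omega + t) = h * phase p k omega + phase p k t.
Proof.
rewrite /phase mulrCA -mulrDr; congr (_ * _); rewrite /dot mulr_sumr -big_split.
by apply: eq_bigr => i _; rewrite !mxE/=; ring.
Qed.

Lemma is_derive_trig p k phi t : is_derive t omega (trig p k phi)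
  (- (phase p k omega * sin (phase p k t + phi))).
Proof.
apply: is_derive_line.
rewrite (_ : (fun h => _) = cos \o (fun h : R => h * phase p k omega + (phase p k t + phi))); last first.
  by apply/funext => h /=; rewrite /trig phase_line addrA.
apply: is_derive_eq (is_derive1_comp (a := - sin (phase p k t + phi)) (b := phase p k omega) _ _) _; last by ring.
  by rewrite mul0r add0r; exact: is_derive_cos.
apply: is_derive_eq (is_deriveD (is_deriveM (is_derive_id _ _) (is_derive_cst (phase p k omega) _ _)) (is_derive_cst _ _ _)) _.
by rewrite scaler0 add0r addr0 /GRing.scale/= mulr1.
Qed.

Lemma trig_cos p k t : trig p k 0 t = cos (phase p k t).
Proof. by rewrite /trig addr0. Qed.

Lemma trig_sin p k t : trig p k (- (pi / 2)) t = sin (phase p k t).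
Proof. by rewrite /trig cosBpihalf. Qed.

End Derivatives.

(** * Complex structures and the rotations that they generate *)

Section Rotations.
Context {R : realType} {d : nat}.
Implicit Types (t omega : 'rV[R]_d) (n m k : 'rV[int]_d) (J X A : 'M[R]_2).

(* Tr J = 0 and det J = 1 amount to J^2 = -1: rot J below is a one-parameter group. *)
Definition cstruct J := \tr J = 0 /\ \det J = 1.

Lemma cstruct_sqr J : cstruct J -> J * J = -1.
Proof.
move=> []; rewrite tr2E det2E (mkE J) !mxE/= mk1 mkN mkM => h1 h2.
have e : J 1 1 = - J 0 0 by lra.
by rewrite e in h2 *; congr mk; try ring; rewrite -h2; ring.
Qed.

Lemma adj2_tr0 X : \tr X = 0 -> adj2 X = - X.
Proof. by rewrite tr2E => h; rewrite (mkE X) /adj2 !mxE/= mkN; congr mk; lra. Qed.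

Lemma tr0_sqr X : \tr X = 0 -> X * X = - \det X *: 1.
Proof.
rewrite tr2E det2E (mkE X) !mxE/= mk1 mkZ mkM => h.
have -> : X 1 1 = - X 0 0 by lra.
by congr mk; ring.
Qed.

Lemma cstructN J : cstruct J -> cstruct (- J).
Proof.
move=> [h1 h2]; split; first by rewrite raddfN/= h1 oppr0.
by rewrite det2E !mxE !mulrNN -h2 det2E.
Qed.

Definition rot J n t : 'M[R]_2 := cos (phase 2 n t) *: 1 + sin (phase 2 n t) *: J.

Lemma rot0 J t : rot J 0 t = 1.
Proof. by rewrite /rot phase0 cos0 sin0 scale1r scale0r addr0. Qed.

Lemma rotN J n t : rot (- J) n t = rot J (- n) t.
Proof. by rewrite /rot phaseN cosN sinN scalerN scaleNr. Qed.

Lemma rotM J n m t : cstruct J -> rot J n t * rot J m t = rot J (n + m) t.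
Proof.
move=> /cstruct_sqr JJ; rewrite /rot phaseD cosD sinD.
rewrite mulrDl !mulrDr -!scalerAl -!scalerAr !mul1r mulr1 !scalerA JJ.
rewrite scalerBl scalerDl scalerN [cos (phase 2 n t) * sin _]mulrC.
move: (_ *: 1) ((_ * sin _) *: 1) (_ *: J) ((sin (phase 2 m t) * _) *: J) => a b c e.
by rewrite addrACA [e + _]addrC [c + e]addrC; rewrite -!addrA; congr (_ + _); rewrite addrCA; congr (_ + _); rewrite addrC.
Qed.

Lemma rotVl J n t : cstruct J -> rot J (- n) t * rot J n t = 1.
Proof. by move=> h; rewrite rotM// addNr rot0. Qed.

Lemma rotVr J n t : cstruct J -> rot J n t * rot J (- n) t = 1.
Proof. by move=> h; rewrite rotM// subrr rot0. Qed.

Lemma adj2_rot J n t : cstruct J -> adj2 (rot J n t) = rot J (- n) t.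
Proof.
move=> [h _]; rewrite /rot adj2D !adj2Z (adj2_tr0 h) phaseN cosN sinN scalerN scaleNr.
by congr (_ *: _ + _); rewrite mk1 /adj2 !mxE/= oppr0.
Qed.

Lemma det_rot J n t : cstruct J -> \det (rot J n t) = 1.
Proof.
move=> h; have := rotVr n t h; rewrite -adj2_rot// mul_adj2 => /matrixP /(_ 0 0).
by rewrite !mxE.
Qed.

Lemma dM_rot omega J n t : cstruct J ->
  dM omega (rot J n) (phase 2 n omega *: (J * rot J n t)) t.
Proof.
move=> /cstruct_sqr JJ.
have h1 := is_derive_trig omega 2 n 0 t.
have h2 := is_derive_trig omega 2 n (- (pi / 2)) t.
have := dMD (dMZ h1 (dM_cst omega 1 t)) (dMZ h2 (dM_cst omega J t)).
move/(dM_ext (G := rot J n)) => h; apply: dM_eq (h _) _ => [x|].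
  by rewrite trig_cos trig_sin.
rewrite !scaler0 !addr0 /rot sinBpihalf mulrDr -!scalerAr JJ mulr1 scalerDr !scalerA.
by rewrite mulrN opprK scalerN scaleNr addrC.
Qed.

(* The parts of X that commute and anticommute with a complex structure J. *)
Definition cm J X := 2^-1 *: (X - J * X * J).
Definition ac J X := 2^-1 *: (X + J * X * J).

Lemma cm_ac J X : cm J X + ac J X = X.
Proof.
rewrite /cm /ac -scalerDr addrACA addNr addr0 scalerDr -scalerDl.
by rewrite (_ : 2^-1 + 2^-1 = 1 :> R) ?scale1r//; lra.
Qed.

Section Structure.
Variable J : 'M[R]_2.
Hypothesis hJ : cstruct J.
Let JJ := cstruct_sqr hJ.

Lemma cm_comm X : J * cm J X = cm J X * J.
Proof.
rewrite /cm -scalerAr -scalerAl; congr (_ *: _).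
by rewrite mulrBr mulrBl !mulrA JJ -!mulrA JJ !mulN1r !mulrN mulr1 !opprK addrC.
Qed.

Lemma ac_anti X : J * ac J X = - (ac J X * J).
Proof.
rewrite /ac -scalerAr -scalerAl -scalerN; congr (_ *: _).
by rewrite mulrDr mulrDl !mulrA JJ -!mulrA JJ !mulN1r !mulrN mulr1 opprB addrC.
Qed.

Lemma cm_rot X n t : cm J X * rot J n t = rot J n t * cm J X.
Proof.
move: (cm_comm X); move: (cm J X) => Y hY.
by rewrite /rot mulrDr mulrDl -!scalerAr -!scalerAl mulr1 mul1r hY.
Qed.

Lemma ac_rot X n t : ac J X * rot J n t = rot J (- n) t * ac J X.
Proof.
move: (ac_anti X); move: (ac J X) => Y hY.
rewrite /rot phaseN cosN sinN mulrDr mulrDl -!scalerAr -!scalerAl mulr1 mul1r hY.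
by rewrite scaleNr scalerN opprK.
Qed.

(** A rotation passes an anticommuting matrix by changing the sign of its frequency, so the two
    half-integer frequencies add up to an integer one. *)
Lemma conj_rot X n t :
  adj2 (rot J n t) * X * rot J n t = cm J X + rot J (- (n + n)) t * ac J X.
Proof.
rewrite adj2_rot// -{1}(cm_ac J X) opprD.
have := cm_rot X n t; have := ac_rot X n t; have := rotVl n t hJ; have := rotM (- n) (- n) t hJ.
move: (cm J X) (ac J X) (rot J n t) (rot J (- n) t) (rot J (- n - n) t) => Y Q P P' P2 h1 h2 h3 h4.
by rewrite mulrDr mulrDl -!mulrA h3 h4 !mulrA h2 h1 mul1r.
Qed.

Lemma tr_ac X : \tr X = 0 -> \tr (ac J X) = 0.
Proof.
move=> h; rewrite /ac linearZ/= raddfD/= h add0r -mulrA.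
rewrite -[J * (X * J)]/(J *m (X *m J)) mxtrace_mulC -mulmxA -[J *m J]/(J * J) JJ.
by rewrite mulmxN raddfN/= mulmx1 h oppr0 mulr0.
Qed.

Lemma tr_cm X : \tr X = 0 -> \tr (cm J X) = 0.
Proof.
by move=> h; have := congr1 mxtrace (cm_ac J X); rewrite raddfD/= tr_ac// addr0 h.
Qed.

Lemma ac_cm X : ac J X = 0 -> cm J X = X.
Proof. by move=> h; rewrite -[RHS](cm_ac J X) h addr0. Qed.

(** The centraliser of J in sl(2) is the line through J: J times such a matrix is a scalar, read off
    from its trace, and J^2 = -1. *)
Lemma cm_tr0 X : \tr X = 0 -> exists x, cm J X = x *: J.
Proof.
move=> h; exists (- (2^-1 * \tr (J * cm J X))).
have hc := cm_comm X; have hT := tr_cm h; move: (cm J X) hc hT => Y hc hT.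
have JY : J * Y = (2^-1 * \tr (J * Y)) *: 1.
  have : \tr Y = 0 := hT; case: hJ => t0 _; move: hc t0 hT.
  rewrite !tr2E (mkE J) (mkE Y) !mkM !mxE/= mk1 mkZ => /mk_inj[e1 e2 e3 e4] t0 tY _.
  have a1 : J 1 1 = - J 0 0 by lra.
  have a2 : Y 1 1 = - Y 0 0 by lra.
  rewrite a1 a2 in e1 e2 e3 e4 *.
  by congr mk; lra.
move: JY; set c := 2^-1 * _ => JY.
have := congr1 (fun Z => - (J * Z)) JY.
by rewrite mulrA JJ mulN1r opprK -scalerAr mulr1 -scaleNr.
Qed.

(** J is orthogonal, for the quadratic form det, to the matrices that anticommute with it. *)
Lemma det_cm_ac x X : \det (x *: J + ac J X) = x ^+ 2 + \det (ac J X).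
Proof.
case: hJ => t0 d0; have ha := ac_anti X; move: (ac J X) ha => Q; move: t0 d0.
rewrite !det2E !tr2E (mkE J) (mkE Q) !(mkM, mkZ, mkN, mkD) !mxE/= => t0 d0 /mk_inj[e1 e2 e3 e4].
have a1 : J 1 1 = - J 0 0 by lra.
rewrite a1 in d0 e1 e2 e3 e4 *.
(* If this entry vanished, det J would be minus a square, not 1. *)
have [c0|c0] := eqVneq (J 0 1) 0.
  by rewrite c0 in d0 *; have := sqr_ge0 (J 0 0); lra.
have e5 : J 1 0 * Q 0 1 + 2 * J 0 0 * Q 0 0 + J 0 1 * Q 1 0 = 0 by lra.
have e6 : J 0 1 * (Q 0 0 + Q 1 1) = 0 by lra.
move/eqP: e6; rewrite mulf_eq0 (negPf c0) => /eqP e6.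
have e7 : Q 1 1 = - Q 0 0 by lra.
rewrite e7 {e1 e2 e3 e4 e6 e7}.
have := congr1 (fun z => x * z) e5; have := congr1 (fun z => x ^+ 2 * z) d0; lra.
Qed.

End Structure.

Lemma mnorm_ac J X : mnorm (ac J X) <= mnorm X * (1 + mnorm J ^+ 2).
Proof.
rewrite /ac mnormZ ger0_norm//.
have := mnormD X (J * X * J); have := mnormM (J * X) J; have := mnormM J X.
have := mnorm_ge0 X; have := mnorm_ge0 J; have := mnorm_ge0 (X + J * X * J).
move: (mnorm X) (mnorm J) (mnorm (J * X)) (mnorm (J * X * J)) (mnorm (X + _)).
move=> x j a b c *; have : a * j <= j * x * j by rewrite ler_wpM2r.
nra.
Qed.

Lemma acD J X Y : ac J (X + Y) = ac J X + ac J Y.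
Proof. by rewrite /ac mulrDr mulrDl addrACA scalerDr. Qed.

Lemma cmD J X Y : cm J (X + Y) = cm J X + cm J Y.
Proof. by rewrite /cm mulrDr mulrDl opprD addrACA scalerDr. Qed.

Lemma acZ J c X : ac J (c *: X) = c *: ac J X.
Proof. by rewrite /ac -scalerAr -scalerAl -scalerDr !scalerA mulrC. Qed.

Lemma cmZ J c X : cm J (c *: X) = c *: cm J X.
Proof. by rewrite /cm -scalerAr -scalerAl -scalerBr !scalerA mulrC. Qed.

Lemma acN J X : ac (- J) X = ac J X.
Proof. by rewrite /ac mulNr mulrN mulNr opprK. Qed.

Lemma bnd_rot (w : 'rV[int]_d -> R) J n : weight w ->
  bnd 2 w (rot J n) (w n * (2 + mnorm J)).
Proof.
move=> wW; have h1 := bnd_trig wW n 0 (bnd_cst 2 wW 1).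
have h2 := bnd_trig wW n (- (pi / 2)) (bnd_cst 2 wW J).
apply: (bnd_le _ (bnd_ext _ (bndD h1 h2))) => [|x]; last by rewrite trig_cos trig_sin.
by rewrite -mulrDr mnorm1.
Qed.

End Rotations.
Ltac mring := apply/matrixP => ? ?; rewrite !mxE; ring.

(** * Modes in a rotating frame *)

Section Frames.
Context {R : realType} {d : nat}.
Implicit Types (t : 'rV[R]_d) (n k l : 'rV[int]_d) (J U V A c : 'M[R]_2) (phi y z : R).

(** The real part of exp(i (phase + phi)) (U + i V). Thanks to the free phase, differentiation and
    multiplication by i are shifts of phi by pi / 2. *)
Definition cat k phi U V t : 'M[R]_2 :=
  cos (phase 1 k t + phi) *: U - sin (phase 1 k t + phi) *: V.

Lemma catE k phi U V t :
  cat k phi U V t = trig 1 k phi t *: U + trig 1 k (phi + pi / 2) t *: V.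
Proof. by rewrite /cat /trig [_ + (phi + _)]addrA cosDpihalf scaleNr. Qed.

Lemma cat_shift k phi U V t : cat k (phi + pi / 2) U V t = cat k phi (- V) U t.
Proof.
by rewrite /cat addrA cosDpihalf sinDpihalf; mring.
Qed.

Lemma catN k phi U V t : cat k phi (- U) (- V) t = - cat k phi U V t.
Proof. by rewrite /cat !scalerN opprD. Qed.

Lemma catD k phi U V U' V' t :
  cat k phi (U + U') (V + V') t = cat k phi U V t + cat k phi U' V' t.
Proof. by rewrite /cat !scalerDr opprD addrACA. Qed.

Lemma catZ k phi y U V t : cat k phi (y *: U) (y *: V) t = y *: cat k phi U V t.
Proof. by rewrite /cat scalerBr !scalerA ![_ * y]mulrC. Qed.

Lemma cat_lin (f : 'M[R]_2 -> 'M[R]_2) k phi U V t :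
  (forall X Y, f (X + Y) = f X + f Y) -> (forall x X, f (x *: X) = x *: f X) ->
  cat k phi (f U) (f V) t = f (cat k phi U V t).
Proof.
move=> fD fZ; have fN X : f (- X) = - f X by rewrite -scaleN1r fZ scaleN1r.
by rewrite /cat fD fN !fZ.
Qed.

Lemma catDk k l phi U V t : cat (k + l) phi U V t =
  trig 1 l 0 t *: cat k phi U V t + trig 1 l (- (pi / 2)) t *: cat k (phi + pi / 2) U V t.
Proof.
rewrite trig_cos trig_sin cat_shift /cat phaseD.
have -> : phase 1 k t + phase 1 l t + phi = phase 1 l t + (phase 1 k t + phi) by ring.
move: (phase 1 l t) (phase 1 k t + phi) => v u.
rewrite cosD sinD; mring.
Qed.

Lemma trig_cat k phi l U V t : trig 1 k phi t *: cat l 0 U V t =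
  2^-1 *: cat (l + k) phi U V t + 2^-1 *: cat (l - k) (- phi) U V t.
Proof.
rewrite -scalerDr /trig /cat !phaseD phaseN addr0.
have -> : phase 1 l t + phase 1 k t + phi = phase 1 l t + (phase 1 k t + phi) by ring.
have -> : phase 1 l t - phase 1 k t - phi = phase 1 l t - (phase 1 k t + phi) by ring.
move: (phase 1 l t) (phase 1 k t + phi) => u v.
rewrite cosD cosB sinD sinB scalerBr !scalerA addrACA -opprD -!scalerDl scalerBr !scalerA.
by congr (_ *: _ - _ *: _); field.
Qed.

Section Frame.
Variables (psi : 'rV[R]_d -> 'M[R]_2) (w : 'rV[int]_d -> R) (M : R).

(* Finite sums of modes in the frame psi, the bounds being those of the
   modes transported back to the original coordinates. *)
Inductive fdec : ('rV[R]_d -> 'M[R]_2) -> R -> Prop :=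
| fdec_atom k U V x : norm1 (rvint k : 'rV[R]_d) <= M ->
    (forall phi, bnd 1 w (fun t => psi t * cat k phi U V t * adj2 (psi t)) x) ->
    fdec (cat k 0 U V) x
| fdec_add G H x y : fdec G x -> fdec H y -> fdec (fun t => G t + H t) (x + y)
| fdec_ext G H x : (forall t, G t = H t) -> fdec G x -> fdec H x.

End Frame.

(** The linearised equation is solved in the frame mode by mode, so a constant has to become a
    finite sum of modes there; C is the loss in bounds measured outside the frame. *)
Definition frame psi w M C :=
  forall c, fdec psi w M (fun t => adj2 (psi t) * c * psi t) (C * mnorm c).

Lemma cat00 k phi t : cat k phi 0 0 t = 0.
Proof. by rewrite /cat !scaler0 subrr. Qed.

(** A mode of zero amplitude absorbs the slack y - x. *)
Lemma fdec_le psi w M G x y : weight w -> 0 <= M -> x <= y ->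
  fdec psi w M G x -> fdec psi w M G y.
Proof.
move=> wW M0 xy hG.
have h0 : fdec psi w M (cat 0 0 0 0) (y - x).
  apply: fdec_atom => [|phi]; first by rewrite /rvint map_mx0 /norm1 big1// => i _; rewrite mxE normr0.
  apply: (bnd_le _ (bnd_ext _ (bnd0 1 wW))) => [|t]; first by rewrite subr_ge0.
  by rewrite cat00 mulr0 mul0r.
have := fdec_add hG h0; rewrite subrKC; apply: fdec_ext => t.
by rewrite cat00 addr0.
Qed.

Lemma frame_le psi w M C C' : weight w -> 0 <= M -> C <= C' ->
  frame psi w M C -> frame psi w M C'.
Proof.
move=> wW M0 CC h c; apply: fdec_le (h c) => //.
by rewrite ler_wpM2r ?mnorm_ge0.
Qed.

Lemma adj21 : adj2 1 = 1 :> 'M[R]_2.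
Proof. by rewrite mk1 /adj2 !mxE/= oppr0. Qed.

Lemma frame1 w : weight w -> frame (fun=> 1) w 0 2.
Proof.
move=> wW c; apply: (fdec_ext (G := cat 0 0 c 0)) => [t|].
  by rewrite adj21 mulr1 mul1r /cat phase0 addr0 cos0 scale1r scaler0 subr0.
apply: fdec_atom => [|phi].
  by rewrite /rvint map_mx0 /norm1 big1// => i _; rewrite mxE normr0.
apply: (bnd_le _ (bnd_ext _ (bndZ wW (cos phi) (bnd_cst 1 wW c)))) => [|t].
  rewrite ler_wpM2r ?mnorm_ge0// (le_trans (y := 1))//; last by lra.
  by rewrite ler_norml cos_geN1 cos_le1.
by rewrite adj21 mulr1 mul1r /cat phase0 add0r scaler0 subr0.
Qed.

(* The one-parameter group exp(-yJ). *)
Definition ej J y : 'M[R]_2 := cos y *: 1 - sin y *: J.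

Lemma rot_ej J n t : rot J n t = ej J (- phase 2 n t).
Proof. by rewrite /rot /ej cosN sinN scaleNr opprK. Qed.

Lemma ejN J y : ej (- J) y = ej J (- y).
Proof. by rewrite /ej cosN sinN scalerN scaleNr. Qed.

Lemma ejD J y z : cstruct J -> ej J (y + z) = ej J y * ej J z.
Proof.
move=> /cstruct_sqr JJ; rewrite /ej cosD sinD.
rewrite mulrBl !mulrBr -!scalerAl -!scalerAr !mul1r mulr1 !scalerA JJ.
mring.
Qed.

Lemma cat_ej J k phi A t : cat k phi A (J * A) t = ej J (phase 1 k t + phi) * A.
Proof. by rewrite /cat /ej mulrBl -!scalerAl mul1r. Qed.

Lemma anti_ej J A y : J * A = - (A * J) -> A * ej J y = ej J (- y) * A.
Proof.
move=> h; rewrite /ej mulrBr mulrBl -!scalerAr -!scalerAl mulr1 mul1r h cosN sinN.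
by rewrite scaleNr scalerN opprK.
Qed.

Lemma phase12 n t : phase 1 n t = phase 2 n t + phase 2 n t.
Proof. by rewrite -phaseD -mulr2n /phase freq_double. Qed.

(** A mode with amplitudes A and J A is a rotation of angle the phase applied to A, so the two
    factors of the conjugation cancel the shift of the frequency by n. A bound for the mode k thus
    serves for the mode k + n of the rotated frame, without the weight of n. *)
Lemma rot_cat_conj J n k phi A t : cstruct J -> J * A = - (A * J) ->
  rot J n t * cat (k + n) phi A (J * A) t * adj2 (rot J n t) = cat k phi A (J * A) t.
Proof.
move=> hJ hA; rewrite !cat_ej adj2_rot// !rot_ej phaseN opprK phaseD (phase12 n).
rewrite -!mulrA anti_ej// !mulrA -!ejD//; congr (ej _ _ * _); ring.
Qed.

(* In the rotated frame the part of a mode k that anticommutes with J splits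
   into eigenvectors of ad J, of modes k + n and k - n. *)
Lemma anti_split J n k Q1 Q2 t : cstruct J ->
  let A := 2^-1 *: (Q1 - J * Q2) in let A' := 2^-1 *: (Q1 + J * Q2) in
  rot J (- (n + n)) t * cat k 0 Q1 Q2 t =
  cat (k + n) 0 A (J * A) t + cat (k - n) 0 A' (- J * A') t.
Proof.
move=> hJ A A'; rewrite !cat_ej ejN rot_ej phaseN !phaseD !addr0 phaseN opprK opprB -phase12.
rewrite [phase 1 k t + _]addrC !ejD// -!mulrA -mulrDr; congr (_ * _).
rewrite /cat /A /A' addr0 /ej cosN sinN -!scalerAr -scalerDr mulrBr mulrDr addrACA -mulrDl.
have -> : cos (phase 1 k t) *: 1 - sin (phase 1 k t) *: J +
   (cos (phase 1 k t) *: 1 - - sin (phase 1 k t) *: J) = (2 * cos (phase 1 k t)) *: 1.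
  mring.
rewrite -mulNr -mulrDl.
have -> : - (cos (phase 1 k t) *: 1 - sin (phase 1 k t) *: J) +
   (cos (phase 1 k t) *: 1 - - sin (phase 1 k t) *: J) = (2 * sin (phase 1 k t)) *: J.
  mring.
rewrite -!scalerAl mul1r mulrA (cstruct_sqr hJ) mulN1r scalerDr !scalerA scalerN.
by rewrite !mulrA mulVf// !mul1r.
Qed.

(** The splittings by J are bounded before the rotation, where J costs j. The frequency n enlarges
    the range of the modes but does not enter the constant. *)
Lemma fdec_rot psi w M J n j G x : weight w -> cstruct J -> (forall t, \det (psi t) = 1) ->
  1 <= j -> bnd 1 w (fun t => psi t * J * adj2 (psi t)) j -> fdec psi w M G x ->
  fdec (fun t => psi t * rot J n t) w (M + norm1 (rvint n : 'rV[R]_d))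
    (fun t => adj2 (rot J n t) * G t * rot J n t) (3 * j ^+ 3 * x).
Proof.
move=> wW hJ psi1 j1 bJ; elim=> {G x} [k U V x kM hx|G H x y _ IG _ IH|G H x GH _ IG].
- pose Q1 := ac J U; pose Q2 := ac J V.
  have hM : M <= M + norm1 (rvint n : 'rV[R]_d) by rewrite lerDl norm1_ge0.
  have JJ := cstruct_sqr hJ.
  have conjM (X Y : 'M[R]_2) t : psi t * (X * Y) * adj2 (psi t) =
      (psi t * X * adj2 (psi t)) * (psi t * Y * adj2 (psi t)).
    rewrite -!mulrA; congr (_ * (_ * _)); rewrite !mulrA adj2_det1l ?psi1// mul1r.
    by [].
  have conjD (X Y : 'M[R]_2) t : psi t * (X + Y) * adj2 (psi t) =
      (psi t * X * adj2 (psi t)) + (psi t * Y * adj2 (psi t)).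
    by rewrite mulrDr mulrDl.
  have conjZ a (Y : 'M[R]_2) t : psi t * (a *: Y) * adj2 (psi t) = a *: (psi t * Y * adj2 (psi t)).
    by rewrite -scalerAr -scalerAl.
  have x0 : 0 <= x := bnd_ge0 (hx 0).
  have bJXJ phi : bnd 1 w (fun t => psi t * (J * cat k phi U V t * J) * adj2 (psi t)) (j * x * j).
    by apply: bnd_ext (bndM wW (bndM wW bJ (hx phi)) bJ) => t; rewrite !conjM.
  have bcm phi : bnd 1 w (fun t => psi t * cat k phi (cm J U) (cm J V) t * adj2 (psi t))
      (2^-1 * (x + j * x * j)).
    have := bndZ wW 2^-1 (bndB wW (hx phi) (bJXJ phi)); rewrite ger0_norm//.
    apply: bnd_ext => t.
    rewrite (cat_lin (f := cm J)); [|exact: cmD|by move=> *; rewrite cmZ].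
    by rewrite /cm conjZ conjD -[- (J * _ * _)]scaleN1r conjZ scaleN1r.
  have bac phi : bnd 1 w (fun t => psi t * cat k phi Q1 Q2 t * adj2 (psi t))
      (2^-1 * (x + j * x * j)).
    have := bndZ wW 2^-1 (bndD (hx phi) (bJXJ phi)); rewrite ger0_norm//.
    apply: bnd_ext => t.
    rewrite (cat_lin (f := ac J)); [|exact: acD|by move=> *; rewrite acZ].
    by rewrite /ac conjZ conjD.
  pose z := 2^-1 * (2^-1 * (x + j * x * j) + j * (2^-1 * (x + j * x * j))).
  (* The values 1 and -1 of s give the two eigenvectors of [anti_split], one for J and one for -
     J. *)
  have bA phi (s : R) : `|s| = 1 -> let A := 2^-1 *: (Q1 - s *: J * Q2) in
      bnd 1 w (fun t => psi t * cat k phi A (s *: J * A) t * adj2 (psi t)) z.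
    move=> s1 A.
    have s2 : s * s = 1 by have := real_normK (num_real s); rewrite s1 expr1n expr2 => <-.
    have := bndM wW bJ (bac (phi + pi / 2)) => h1.
    have := bndD (bac phi) (bndZ wW s h1); rewrite s1 mul1r => h2.
    have := bndZ wW 2^-1 h2; rewrite ger0_norm//; apply: bnd_ext => t.
    rewrite -conjM -conjZ -conjD -conjZ; congr (_ * _ * _).
    rewrite cat_shift scalerAl.
    have -> : s *: J * cat k phi (- Q2) Q1 t = cat k phi (s *: J * - Q2) (s *: J * Q1) t.
      by rewrite (cat_lin (f := fun X => s *: J * X))// => *; rewrite ?mulrDr -?scalerAr.
    rewrite -catD -catZ; congr (cat _ _ _ _ _); first by rewrite /A mulrN.
    have : s *: J * (s *: J) = -1 by rewrite -scalerAl -scalerAr scalerA s2 scale1r JJ.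
    rewrite /A; move: (s *: J) => K KK.
    by rewrite -[RHS]scalerAr mulrBr mulrA KK mulN1r opprK addrC.
  (* One commuting mode and two eigenvectors cost x (1 + j^2) (2 + j) / 2, which is at most 3 j^3 x
     because 1 <= j. *)
  have tot : 2^-1 * (x + j * x * j) + (z + z) <= 3 * j ^+ 3 * x.
    have -> : 2^-1 * (x + j * x * j) + (z + z) = x * (2^-1 * (1 + j ^+ 2) * (2 + j)).
      by rewrite /z; field.
    rewrite mulrC ler_wpM2r// !exprS expr0 mulr1.
    have : 1 <= j * j by rewrite -[1]mulr1 ler_pM.
    have : j * j <= j * (j * j) by rewrite ler_peMl// mulr_ge0//; lra.
    have : j <= j * j by rewrite ler_peMl//; lra.
    lra.
  have bound (b : bool) : norm1 (rvint (if b then k + n else k - n) : 'rV[R]_d) <=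
      M + norm1 (rvint n : 'rV[R]_d).
    case: b; rewrite -!freq1 freqD (le_trans (norm1D _ _))// ?freqN ?norm1N lerD// freq1//.
  apply: (fdec_le wW _ tot).
    by rewrite addr_ge0 ?norm1_ge0// (le_trans (norm1_ge0 _) kM).
  pose A := 2^-1 *: (Q1 - J * Q2); pose A' := 2^-1 *: (Q1 + J * Q2).
  have aQ : J * Q1 = - (Q1 * J) := ac_anti hJ U.
  have aQ2 : J * Q2 = - (Q2 * J) := ac_anti hJ V.
  have aJQ2 : J * (J * Q2) = - ((J * Q2) * J).
    by rewrite -mulrA; have -> : Q2 * J = - (J * Q2); [rewrite aQ2 opprK|rewrite mulrN opprK].
  apply: (fdec_ext (G := fun t => cat k 0 (cm J U) (cm J V) t +
      (cat (k + n) 0 A (J * A) t + cat (k - n) 0 A' (- J * A') t))) => [t|].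
    have E := anti_split n k Q1 Q2 t hJ; rewrite /= -/A -/A' in E; rewrite -E conj_rot//.
    rewrite (cat_lin (f := cm J)); [|exact: cmD|by move=> *; rewrite cmZ].
    by rewrite (cat_lin (f := ac J)); [|exact: acD|by move=> *; rewrite acZ].
  apply: fdec_add; last apply: fdec_add.
  + apply: fdec_atom => [|phi]; first exact: le_trans kM hM.
    apply: bnd_ext (bcm phi) => t; rewrite adj2M -!mulrA; congr (_ * _); rewrite !mulrA; congr (_ * _).
    rewrite (cat_lin (f := cm J)); [|exact: cmD|by move=> *; rewrite cmZ].
    by rewrite -cm_rot// -mulrA adj2_rot// rotVr// mulr1.
  + apply: fdec_atom => [|phi]; first exact: (bound true).
    have := bA phi 1 (normr1 _); rewrite /= !scale1r -/A; apply: bnd_ext => t.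
    rewrite adj2M -!mulrA; congr (_ * _); rewrite !mulrA; congr (_ * _).
    rewrite rot_cat_conj// /A -scalerAr -scalerAl -scalerN; congr (_ *: _).
    by rewrite mulrBr mulrBl aQ aJQ2 opprB addrC opprK.
  + apply: fdec_atom => [|phi]; first exact: (bound false).
    have := bA phi (-1) (normrN1 _); rewrite /= !scaleN1r mulNr opprK -/A'; apply: bnd_ext => t.
    rewrite adj2M -!mulrA; congr (_ * _); rewrite !mulrA; congr (_ * _).
    rewrite -[in rot J n t](opprK J) rotN rot_cat_conj//; first exact: cstructN.
    rewrite /A' -scalerAr -scalerAl -scalerN; congr (_ *: _).
    by rewrite mulrDr mulrDl !mulNr !mulrN aQ aJQ2 !opprK opprD !opprK.
- rewrite mulrDr; apply: fdec_ext (fdec_add IG IH) => t.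
  by move: (adj2 (rot J n t)) (rot J n t) => a b; rewrite mulrDr mulrDl.
- by apply: fdec_ext IG => t; rewrite GH.
Qed.

Lemma frame_rot psi w M C J n j : weight w -> cstruct J -> (forall t, \det (psi t) = 1) ->
  1 <= j -> bnd 1 w (fun t => psi t * J * adj2 (psi t)) j -> frame psi w M C ->
  frame (fun t => psi t * rot J n t) w (M + norm1 (rvint n : 'rV[R]_d)) (3 * j ^+ 3 * C).
Proof.
move=> wW hJ psi1 j1 bJ hf c; rewrite -[_ * C * _]mulrA.
apply: (fdec_ext _ (fdec_rot n wW hJ psi1 j1 bJ (hf c))) => t.
by rewrite adj2M !mulrA.
Qed.

End Frames.

(** * Averages over the torus *)

Section Mean.
Context {R : realType} {d : nat}.
Implicit Types (t : 'rV[R]_d) (n k l : 'rV[int]_d) (U V A B : 'M[R]_2) (N : nat).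
Implicit Types (G H : 'rV[R]_d -> 'M[R]_2).

Definition grid N (f : {ffun 'I_d -> 'I_N}) : 'rV[R]_d := \row_i (2 * ((f i)%:R / N%:R)).

Definition avg N G : 'M[R]_2 :=
  (#|{ffun 'I_d -> 'I_N}|%:R)^-1 *: \sum_(f : {ffun 'I_d -> 'I_N}) G (grid f).

(** The torus average as a limit over grids of step 2 / N: a mode of nonzero frequency averages to
    exactly 0 as soon as N exceeds the components of its index. *)
Definition mean G B := forall e, 0 < e ->
  exists n0 : nat, forall N, (n0 <= N)%N -> mnorm (avg N G - B) <= e.

Let M0 N : (0 < N)%N -> 0 < #|{ffun 'I_d -> 'I_N}|%:R :> R.
Proof. by case: N => // N _; rewrite ltr0n; apply/card_gt0P; exists [ffun=> ord0]. Qed.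

Lemma avgD N G H : avg N (fun t => G t + H t) = avg N G + avg N H.
Proof. by rewrite /avg big_split scalerDr. Qed.

Lemma avg_lin N (f : 'M[R]_2 -> 'M[R]_2) G : (forall X Y, f (X + Y) = f X + f Y) ->
  (forall x X, f (x *: X) = x *: f X) -> avg N (fun t => f (G t)) = f (avg N G).
Proof.
move=> fD fZ; have f0 : f 0 = 0 by have := fZ 0 0; rewrite !scale0r.
by rewrite /avg fZ; congr (_ *: _); rewrite (big_morph f fD f0).
Qed.

Lemma avg_ext N G H : (forall t, G t = H t) -> avg N G = avg N H.
Proof. by move=> /funext ->. Qed.

Lemma mnorm_avg N G x : (0 < N)%N -> (forall t, mnorm (G t) <= x) -> mnorm (avg N G) <= x.
Proof.
move=> N0 h; rewrite /avg mnormZ ger0_norm ?invr_ge0//.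
rewrite mulrC ler_pdivrMr ?M0// (le_trans (mnorm_sum _ _))//.
by rewrite mulr_natr -sumr_const ler_sum.
Qed.

Lemma avg_cst N U : (0 < N)%N -> avg N (fun=> U) = U.
Proof.
move=> N0; rewrite /avg sumr_const -[U *+ _]scaler_nat scalerA mulVf ?scale1r//.
by rewrite gt_eqF// M0.
Qed.

Lemma phase_grid N k (f : {ffun 'I_d -> 'I_N}) :
  phase 2 k (grid f) = 2 * pi * \sum_i (k 0 i)%:~R * ((f i)%:R / N%:R).
Proof.
rewrite /phase; congr (_ * _); apply: eq_bigr => i _; rewrite !mxE.
by rewrite [2^-1 * _]mulrC -mulrA mulKf.
Qed.

Lemma avg_trig N k phi U : k != 0 -> (forall i, (`|k 0%R i| < N)%N) ->
  avg N (fun t => trig 2 k phi t *: U) = 0.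
Proof.
move=> k0 kN; rewrite /avg -scaler_suml.
have := sum_grid (R := R) k0 kN.
have cs (x : R) : cos (2 * pi * x) = complex.Re (expi2pi x) /\ sin (2 * pi * x) = complex.Im (expi2pi x) by [].
move=> h; have hc : \sum_(f : {ffun 'I_d -> 'I_N}) cos (phase 2 k (grid f)) = 0.
  have e1 := congr1 (@complex.Re R) h; rewrite raddf_sum/= in e1; rewrite -[RHS]e1.
  by apply: eq_bigr => f _; rewrite phase_grid (cs _).1.
have hs : \sum_(f : {ffun 'I_d -> 'I_N}) sin (phase 2 k (grid f)) = 0.
  have e1 := congr1 (@complex.Im R) h; rewrite raddf_sum/= in e1; rewrite -[RHS]e1.
  by apply: eq_bigr => f _; rewrite phase_grid (cs _).2.
rewrite (_ : \sum_i trig 2 k phi (grid i) = 0) ?scale0r ?scaler0//.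
under eq_bigr do rewrite /trig cosD.
by rewrite sumrB -!mulr_suml hc hs !mul0r subrr.
Qed.

Lemma meanD G H A B : mean G A -> mean H B -> mean (fun t => G t + H t) (A + B).
Proof.
move=> hG hH e e0; have [n0 h0] := hG (e / 2) ltac:(lra).
have [n1 h1] := hH (e / 2) ltac:(lra).
exists (maxn n0 n1) => N; rewrite geq_max => /andP[/h0 {}h0 /h1 {}h1].
rewrite avgD opprD addrACA (le_trans (mnormD _ _))//; lra.
Qed.

Lemma mean_ext G H A : (forall t, G t = H t) -> mean G A -> mean H A.
Proof. by move=> /funext ->. Qed.

Lemma mean_lin (f : 'M[R]_2 -> 'M[R]_2) K G A : (forall X Y, f (X + Y) = f X + f Y) ->
  (forall x X, f (x *: X) = x *: f X) -> (forall X, mnorm (f X) <= K * mnorm X) ->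
  mean G A -> mean (fun t => f (G t)) (f A).
Proof.
move=> fD fZ fK hG e e0; have K1 : 0 < `|K| + 1 by have := normr_ge0 K; lra.
have [n0 h] := hG (e / (`|K| + 1)) (divr_gt0 e0 K1).
exists n0 => N /h {}h; rewrite avg_lin// -[- f A]scaleN1r -fZ scaleN1r -fD.
apply: le_trans (fK _) _; rewrite ler_pdivlMr// in h.
apply: le_trans h; rewrite mulrC ler_wpM2l ?mnorm_ge0//.
by have := ler_norm K; lra.
Qed.

Definition ksize k : nat := (\sum_i `|k 0%R i|).+1.

Lemma ksizeP k N i : (ksize k <= N)%N -> (`|k 0%R i| < N)%N.
Proof. by move=> h; apply: leq_trans h; rewrite ltnS (bigD1 i)//= leq_addr. Qed.

Lemma ksize_gt0 k N : (ksize k <= N)%N -> (0 < N)%N.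
Proof. exact: leq_trans. Qed.

Lemma mean_trig2 k phi U :
  mean (fun t => trig 2 k phi t *: U) (if k == 0 then cos phi *: U else 0).
Proof.
move=> e e0; exists (ksize k) => N kN; case: eqVneq => [->|k0].
  rewrite (@avg_ext N _ (fun=> cos phi *: U)) => [|t]; last by rewrite /trig phase0 add0r.
  by rewrite avg_cst ?subrr ?mnorm0 ?ltW// (ksize_gt0 kN).
by rewrite avg_trig ?subrr ?mnorm0 ?ltW// => i; exact: ksizeP.
Qed.

Lemma double_eq0 k : (k *+ 2 == 0) = (k == 0).
Proof.
apply/eqP/eqP => [/matrixP h|->]; last by rewrite mul0rn.
by apply/matrixP => i j; have := h i j; rewrite mulr2n !mxE -mulr2n => /eqP; rewrite mulrn_eq0 => /eqP.
Qed.

Lemma mean_cat k phi U V :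
  mean (cat k phi U V) (if k == 0 then cos phi *: U - sin phi *: V else 0).
Proof.
have h := meanD (mean_trig2 (k *+ 2) phi U) (mean_trig2 (k *+ 2) (phi + pi / 2) V).
rewrite double_eq0 in h; apply: mean_ext (_ : mean _ _) => [t|].
  by rewrite catE /trig -![phase 1 k t]/(2 * pi * dot (freq 1 k) t) -freq_double.
by case: (k == 0) h; rewrite ?addr0// cosDpihalf scaleNr.
Qed.

(** The average of G against a mode of frequency k is a Fourier coefficient of G, hence the gain 1 /
    w k. On a finite part of G the grid averages are exact for large N. *)
Lemma mean_trig_bound (w : 'rV[int]_d -> R) G1 G2 y1 y2 k phi1 phi2 B :
  weight w -> bnd 2 w G1 y1 -> bnd 2 w G2 y2 ->
  mean (fun t => trig 2 k phi1 t *: G1 t + trig 2 k phi2 t *: G2 t) B ->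
  mnorm B <= (y1 + y2) / w k.
Proof.
move=> wW; have [w1 wz wN _] := wW; have wk : 0 < w k by apply: lt_le_trans ltr01 (w1 k).
have one G y phi e : bnd 2 w G y -> 0 < e -> exists n0 : nat, forall N, (n0 <= N)%N ->
    mnorm (avg N (fun t => trig 2 k phi t *: G t)) <= y / w k + e.
  move=> hG e0; have [s [ns hs]] := bnd_split hG e0.
  have [n0 h0] : exists n0 : nat, forall N, (n0 <= N)%N ->
      mnorm (avg N (fun t => ev 2 (tmul k phi s) t)) <= nm w s / w k.
    elim: s {ns hs} => [|a s [n0 IH]].
      exists 1%N => N N1; rewrite nm_nil mul0r; apply: mnorm_avg => // t.
      by rewrite /tmul/= ev_nil mnorm0.
    exists (maxn n0 (maxn (ksize (k + a.1.1)) (ksize (k - a.1.1)))) => N.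
    rewrite !geq_max => /andP[/IH {}IH /andP[h1 h2]].
    have N0 := ksize_gt0 h1.
    rewrite (@avg_ext N _ (fun t => (trig 2 (k + a.1.1) (phi + a.1.2) t *: (2^-1 *: a.2)
        + trig 2 (k - a.1.1) (phi - a.1.2) t *: (2^-1 *: a.2)) + ev 2 (tmul k phi s) t)); last first.
      by move=> t; rewrite /tmul/= !ev_cons addrA.
    rewrite avgD nm_cons mulrDl (le_trans (mnormD _ _))// lerD//.
    have half l psi : (ksize l <= N)%N -> (l == 0 -> w a.1.1 = w k) ->
        mnorm (avg N (fun t => trig 2 l psi t *: (2^-1 *: a.2))) <= 2^-1 * (w a.1.1 * mnorm a.2 / w k).
      move=> lN lw; have [l0|l0] := eqVneq l 0.
        rewrite lw ?l0// mulrAC mulfV ?gt_eqF// mul1r; apply: mnorm_avg => // t.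
        have -> : 2^-1 * mnorm a.2 = mnorm (2^-1 *: a.2) by rewrite mnormZ ger0_norm.
        by rewrite [leLHS]mnormZ ler_piMl ?mnorm_ge0// trig_le1.
      rewrite avg_trig ?mnorm0// => [|i]; last exact: ksizeP.
      by rewrite !mulr_ge0 ?invr_ge0 ?mnorm_ge0// ltW// (lt_le_trans ltr01).
    rewrite avgD (le_trans (mnormD _ _))//.
    have := half (k + a.1.1) (phi + a.1.2) h1 _; have := half (k - a.1.1) (phi - a.1.2) h2 _.
    rewrite subr_eq0 addrC addr_eq0 => /(_ ltac:(by move=> /eqP ->)) i1 /(_ ltac:(by move=> /eqP ->)) i2.
    lra.
  exists (maxn n0 1) => N; rewrite geq_max => /andP[/h0 {}h0 N0].
  rewrite (@avg_ext N _ (fun t => ev 2 (tmul k phi s) t + trig 2 k phi t *: (G t - ev 2 s t))); last first.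
    by move=> t; rewrite ev_tmul scalerBr addrC subrK.
  rewrite avgD (le_trans (mnormD _ _))// lerD//.
    by rewrite (le_trans h0)// ler_pdivrMr// mulrVK ?unitfE ?gt_eqF.
  apply: mnorm_avg => // t; rewrite mnormZ.
  have := mnorm_bnd wW t hs; have := trig_le1 2 k phi t.
  have := normr_ge0 (trig 2 k phi t); have := mnorm_ge0 (G t - ev 2 s t); nra.
move=> b1 b2 hB; apply/ler_addgt0Pr => e e0.
have [n0 h0] := hB (e / 3) ltac:(lra).
have [n1 h1] := one _ _ phi1 (e / 3) b1 ltac:(lra).
have [n2 h2] := one _ _ phi2 (e / 3) b2 ltac:(lra).
pose N := maxn n0 (maxn n1 n2).
have {}h0 := h0 N (leq_maxl _ _).
have {}h1 := h1 N (leq_trans (leq_maxl _ _) (leq_maxr _ _)).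
have {}h2 := h2 N (leq_trans (leq_maxr _ _) (leq_maxr _ _)).
rewrite avgD in h0.
set P := avg N _ in h0 h1; set Q := avg N _ in h0 h2.
have -> : B = (P + Q) - (P + Q - B) by rewrite subKr.
rewrite (le_trans (mnormB _ _))// mulrDl; have := mnormD P Q; lra.
Qed.

End Mean.

(** * The linearised equation in a frame *)

Section Homological.
Context {R : realType} {d : nat} (omega : 'rV[R]_d).
Implicit Types (t : 'rV[R]_d) (n k l : 'rV[int]_d) (U V B : 'M[R]_2) (N : nat).
Implicit Types (G H : 'rV[R]_d -> 'M[R]_2).
Variables (psi : 'rV[R]_d -> 'M[R]_2) (w : 'rV[int]_d -> R) (A : 'M[R]_2) (a Dv : R).
Hypothesis (wW : weight w) (psi1 : forall t, \det (psi t) = 1) (trA : \tr A = 0).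
Hypothesis bA : bnd 1 w (fun t => psi t * A * adj2 (psi t)) a.

(** All bounds are taken after conjugation by [psi]. The unsolved constant B is recorded as the mean
    of G because its anticommuting part will be estimated as a Fourier coefficient. *)
Definition hsol G y := exists X X' B, [/\
  forall t, dM omega X (X' t) t,
  forall t, X' t - ad A (X t) = G t - B,
  bnd 1 w (fun t => psi t * X t * adj2 (psi t)) (Dv * y),
  bnd 1 w (fun t => psi t * B * adj2 (psi t)) y
  & mean G B].

Lemma hsol_add G H x y : hsol G x -> hsol H y -> hsol (fun t => G t + H t) (x + y).
Proof.
move=> [X [X' [B [h1 h2 h3 h4 h5]]]] [Y [Y' [C [k1 k2 k3 k4 k5]]]].
exists (fun t => X t + Y t), (fun t => X' t + Y' t), (B + C); split.
- by move=> t; apply: dMD.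
- by move=> t; rewrite adDr opprD addrACA h2 k2 opprD addrACA.
- rewrite mulrDr; apply: bnd_ext (bndD h3 k3) => t; by rewrite mulrDr mulrDl.
- by apply: bnd_ext (bndD h4 k4) => t; rewrite mulrDr mulrDl.
- exact: meanD.
Qed.

Lemma hsol_ext G H x : (forall t, G t = H t) -> hsol G x -> hsol H x.
Proof. by move=> /funext ->. Qed.

Lemma dM_cat k phi U V t :
  dM omega (cat k phi U V) (phase 1 k omega *: cat k (phi + pi / 2) U V t) t.
Proof.
have h := dMD (dMZ (is_derive_trig omega 1 k phi t) (dM_cst omega U t))
             (dMZ (is_derive_trig omega 1 k (phi + pi / 2) t) (dM_cst omega V t)).
apply: dM_eq (dM_ext _ h) _ => [x|]; first by rewrite catE.
rewrite !scaler0 !addr0 cat_shift /cat !addrA sinDpihalf.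
by mring.
Qed.

Lemma conj_ad X t : psi t * ad A X * adj2 (psi t) =
  ad (psi t * A * adj2 (psi t)) (psi t * X * adj2 (psi t)).
Proof.
have conjM (Y Z : 'M[R]_2) : (psi t * Y * adj2 (psi t)) * (psi t * Z * adj2 (psi t)) =
     psi t * (Y * Z) * adj2 (psi t).
  rewrite -!mulrA; congr (_ * (_ * _)); rewrite !mulrA adj2_det1l ?psi1// mul1r.
  by [].
by rewrite /ad !conjM mulrBr mulrBl.
Qed.

Lemma bnd_ad F x : bnd 1 w F x ->
  bnd 1 w (fun t => ad (psi t * A * adj2 (psi t)) (F t)) (2 * a * x).
Proof.
move=> hF; apply: (bnd_le _ (bndB wW (bndM wW bA hF) (bndM wW hF bA))).
by lra.
Qed.

Variables (m e M : R).
Hypothesis (m0 : 0 <= m) (e0 : 0 <= e).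

(** On a mode l, the derivative minus ad A has three eigenvalues: the first divisor comes from the
    eigenvalue 0 of ad A, the second is the product of the other two. *)
Definition divisors := forall l, l != 0 -> norm1 (rvint l : 'rV[R]_d) <= M ->
  [/\ phase 1 l omega != 0, 4 * \det A - phase 1 l omega ^+ 2 != 0,
     `|(phase 1 l omega)^-1| <= m & `|(4 * \det A - phase 1 l omega ^+ 2)^-1| <= e].

Hypothesis hD : divisors.
Hypothesis hDv : m + 2 * a * e + 4 * a ^+ 2 * (m * e) <= Dv.

Lemma hsol_cat l phi U V x : norm1 (rvint l : 'rV[R]_d) <= M ->
  (forall phi, bnd 1 w (fun t => psi t * cat l phi U V t * adj2 (psi t)) x) ->
  hsol (cat l phi U V) x.
Proof.
move=> lM hx; have x0 : 0 <= x := bnd_ge0 (hx 0).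
have a0 : 0 <= a := bnd_ge0 bA.
have D0 : 0 <= Dv.
  by apply: le_trans hDv; rewrite !addr_ge0// !mulr_ge0// sqr_ge0.
(* The constant mode is not solved: it becomes B. *)
have [l0|l0] := eqVneq l 0.
  exists (fun=> 0), (fun=> 0), (cat l phi U V 0); split.
  - by move=> t; exact: dM_cst.
  - move=> t; rewrite /ad mulr0 mul0r subrr subr0.
    by rewrite /cat l0 !phase0 subrr.
  - apply: (bnd_le _ (bnd_ext _ (bnd0 1 wW))) => [|t]; first exact: mulr_ge0.
    by rewrite mulr0 mul0r.
  - by apply: bnd_ext (hx phi) => t; rewrite /cat l0 !phase0.
  - have := mean_cat l phi U V; rewrite l0 eqxx.
    by rewrite [in X in _ -> mean _ X]/cat phase0 add0r.
have [mu0 dl0 hm he] := hD l0 lM.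
set mu := phase 1 l omega in mu0 hm dl0 he; set dl := _ - _ in dl0 he.
pose P0 := cat l phi U V; pose Pm := cat l (phi - pi / 2) U V.
(* With D the derivative along omega and a = ad A, the relations [ad3] and D^2 = - mu^2 give (D -
   a)^-1 = D^-1 + dl^-1 a + dl^-1 D^-1 a^2. Here mu^-1 [Pm] is D^-1 [P0]. *)
exists (fun t => mu^-1 *: Pm t + dl^-1 *: ad A (P0 t) + (mu * dl)^-1 *: ad A (ad A (Pm t))).
exists (fun t => mu^-1 *: (mu *: P0 t) + dl^-1 *: ad A (- (mu *: Pm t))
     + (mu * dl)^-1 *: ad A (ad A (mu *: P0 t))).
exists 0.
have ddP F F' t : dM omega F F' t -> dM omega (fun t => ad A (F t)) (ad A F') t.
  move=> h; apply: dM_eq (dMB (dMM (dM_cst omega A t) h) (dMM h (dM_cst omega A t))) _.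
  by rewrite mul0r add0r mulr0 addr0.
have dPm t : dM omega Pm (mu *: P0 t) t.
  by have := dM_cat l (phi - pi / 2) U V t; rewrite subrK.
have dP0 t : dM omega P0 (- (mu *: Pm t)) t.
  apply: dM_eq (dM_cat l phi U V t) _; rewrite -scalerN; congr (_ *: _).
  by rewrite cat_shift -[phi in LHS](subrK (pi / 2) phi) cat_shift catN.
split.
- move=> t; apply: dMD; first apply: dMD; apply: dMZc.
  + exact: dPm.
  + exact: (ddP _ _ _ (dP0 t)).
  + exact: (ddP _ _ _ (ddP _ _ _ (dPm t))).
- move=> t; rewrite subr0 -[cat l phi U V t]/(P0 t).
  move: (P0 t) (Pm t) => P Q.
  have -> : ad A (- (mu *: Q)) = - (mu *: ad A Q) by rewrite adNr adZr.
  have -> : ad A (ad A (mu *: P)) = mu *: ad A (ad A P) by rewrite !adZr.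
  have -> : ad A (mu^-1 *: Q + dl^-1 *: ad A P + (mu * dl)^-1 *: ad A (ad A Q)) =
      mu^-1 *: ad A Q + dl^-1 *: ad A (ad A P) + (mu * dl)^-1 *: ((- 4 * \det A) *: ad A Q).
    by rewrite (adDr A (mu^-1 *: Q + _)) (adDr A (mu^-1 *: Q)) !adZr ad3.
  move: (ad A P) (ad A Q) (ad A (ad A P)) => aP aQ aaP.
  have dE : \det A = (dl + mu ^+ 2) / 4 by rewrite /dl; field.
  rewrite dE; apply/matrixP => i j; rewrite !mxE; field; by rewrite mu0 dl0.
- have b0 := hx phi; have bm := hx (phi - pi / 2).
  have c1 := bndZ wW mu^-1 bm.
  have c2 := bndZ wW dl^-1 (bnd_ad b0).
  have c3 := bndZ wW (mu * dl)^-1 (bnd_ad (bnd_ad bm)).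
  apply: (bnd_le _ (bnd_ext _ (bndD (bndD c1 c2) c3))) => [|t]; last first.
    have cl c1' c2' c3' (P Y Z : 'M[R]_2) :
        psi t * (c1' *: P + c2' *: Y + c3' *: Z) * adj2 (psi t) =
        c1' *: (psi t * P * adj2 (psi t)) + c2' *: (psi t * Y * adj2 (psi t)) +
        c3' *: (psi t * Z * adj2 (psi t)).
      move: (adj2 (psi t)) (psi t) => p q.
      by rewrite !mulrDr !mulrDl -!scalerAr -!scalerAl.
    by rewrite cl !conj_ad.
  rewrite (invfM mu dl) (normrM mu^-1 dl^-1).
  have := normr_ge0 mu^-1; have := normr_ge0 dl^-1.
  move: `|mu^-1| `|dl^-1| hm he => u v um ve v0 u0.
  have i1 := ler_wpM2r x0 hDv; have i2 := ler_wpM2r x0 um.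
  have ax : 0 <= a * x by rewrite mulr_ge0.
  have i3 := ler_wpM2r ax ve.
  have i4 := ler_wpM2r (mulr_ge0 a0 ax) (ler_pM u0 v0 um ve).
  lra.
- apply: (bnd_le _ (bnd_ext _ (bnd0 1 wW))) => // t.
  by rewrite mulr0 mul0r.
- by have := mean_cat l phi U V; rewrite (negPf l0).
Qed.

Lemma conj_catDk k l phi U V x : (forall phi, bnd 1 w (fun t => psi t * cat k phi U V t * adj2 (psi t)) x) ->
  bnd 1 w (fun t => psi t * cat (k + l) phi U V t * adj2 (psi t)) (2 * w l * x).
Proof.
move=> hx; have b1 := bnd_trig wW l 0 (hx phi).
have b2 := bnd_trig wW l (- (pi / 2)) (hx (phi + pi / 2)).
apply: (bnd_le _ (bnd_ext _ (bndD b1 b2))) => [|t]; first by lra.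
rewrite catDk; move: (cat k phi U V t) (cat k (phi + pi / 2) U V t) (adj2 (psi t)) (psi t) => X Y a' b.
by rewrite mulrDr mulrDl -!scalerAr -!scalerAl.
Qed.

Lemma hsol_fdec (N' M' : R) G x k phi : N' + M' <= M -> norm1 (rvint k : 'rV[R]_d) <= N' ->
  fdec psi w M' G x -> hsol (fun t => trig 1 k phi t *: G t) (2 * w k * x).
Proof.
move=> NM kN; elim=> {G x} [l U V x lM hx|G H x y _ IG _ IH|G H x GH _ IG].
- have wk : 0 <= w k by case: wW => w1 _ _ _; apply: le_trans (w1 k).
  have lk s : norm1 (rvint (l + s) : 'rV[R]_d) <= norm1 (rvint l : 'rV[R]_d) + norm1 (rvint s : 'rV[R]_d).
    by rewrite -!freq1 freqD norm1D.
  have [_ _ wN _] := wW.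
  have scal f b : hsol (cat b f U V) (2 * w k * x) ->
      hsol (fun t => 2^-1 *: cat b f U V t) (2^-1 * (2 * w k * x)).
    move=> [X [X' [B [h1 h2 h3 h4 h5]]]].
    exists (fun t => 2^-1 *: X t), (fun t => 2^-1 *: X' t), (2^-1 *: B); split.
    + by move=> t; apply: dMZc.
    + by move=> t; rewrite adZr -!scalerBr h2.
    + rewrite mulrCA; have := bndZ wW 2^-1 h3; rewrite ger0_norm//; apply: bnd_ext => t.
      by rewrite -scalerAr -scalerAl.
    + have := bndZ wW 2^-1 h4; rewrite ger0_norm//; apply: bnd_ext => t.
      by rewrite -scalerAr -scalerAl.
    + apply: (mean_lin (f := fun X => 2^-1 *: X) (K := 2^-1)) => //.
      * exact: scalerDr.
      * by move=> y Y; rewrite !scalerA mulrC.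
      * by move=> Y; rewrite mnormZ ger0_norm.
  have -> : 2 * w k * x = 2^-1 * (2 * w k * x) + 2^-1 * (2 * w k * x) by field.
  apply: (hsol_ext (G := fun t => 2^-1 *: cat (l + k) phi U V t + 2^-1 *: cat (l - k) (- phi) U V t)).
    by move=> t; rewrite trig_cat.
  apply: hsol_add; apply: scal; apply: hsol_cat.
  + by apply: le_trans (lk k) _; rewrite addrC (le_trans _ NM)// lerD.
  + by move=> f; apply: conj_catDk.
  + apply: le_trans (lk _) _; rewrite -[rvint (- k)]freq1 freqN norm1N freq1 addrC (le_trans _ NM)// lerD//.
  + by move=> f; have := conj_catDk (- k) f hx; rewrite wN.
- rewrite mulrDr; apply: (hsol_ext _ (hsol_add IG IH)) => t.
  by rewrite scalerDr.
- by apply: (hsol_ext _ IG) => t; rewrite GH.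
Qed.

Lemma homological (N' M' C : R) (s : seq (@atom R d)) : 0 <= Dv -> N' + M' <= M ->
  (forall b, b \in s -> norm1 (rvint b.1.1 : 'rV[R]_d) <= N') -> frame psi w M' C ->
  hsol (fun t => adj2 (psi t) * ev 1 s t * psi t) (2 * C * nm w s).
Proof.
move=> D0 NM; elim: s => [|b s IH] hs hf.
  rewrite nm_nil mulr0; exists (fun=> 0), (fun=> 0), 0; split.
  - by move=> t; exact: dM_cst.
  - by move=> t; rewrite /ad mulr0 mul0r ev_nil mulr0 mul0r !subrr.
  - by rewrite mulr0; apply: bnd_ext (bnd0 1 wW) => t; rewrite mulr0 mul0r.
  - by apply: bnd_ext (bnd0 1 wW) => t; rewrite mulr0 mul0r.
  - move=> e1 e10; exists 1%N => N N0.
    rewrite (@avg_ext _ _ N _ (fun=> 0)) ?avg_cst ?subr0 ?mnorm0 ?ltW// => t.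
    by rewrite ev_nil mulr0 mul0r.
have hb : norm1 (rvint b.1.1 : 'rV[R]_d) <= N' by apply: hs; rewrite inE eqxx.
have h1 := hsol_fdec b.1.2 NM hb (hf b.2).
have h2 := IH (fun c hc => hs c (mem_behead (s := b :: s) hc)) hf.
rewrite nm_cons mulrDr.
have -> : 2 * C * (w b.1.1 * mnorm b.2) = 2 * w b.1.1 * (C * mnorm b.2) by ring.
apply: (hsol_ext _ (hsol_add h1 h2)) => t.
by rewrite ev_cons mulrDr mulrDl -scalerAr -scalerAl.
Qed.

End Homological.

(** * One Newton step *)

Section KamStep.
Context {R : realType} {d : nat} (omega : 'rV[R]_d).
Implicit Types (t : 'rV[R]_d) (k : 'rV[int]_d) (A B V : 'M[R]_2).

Lemma mean_uniq (G : 'rV[R]_d -> 'M[R]_2) A B : mean G A -> mean G B -> A = B.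
Proof.
move=> hA hB; apply/eqP; rewrite -subr_eq0; apply/eqP/mnorm_eq0.
apply/ler_addgt0Pr => e e0; rewrite add0r.
have [n0 h0] := hA (e / 2) ltac:(lra); have [n1 h1] := hB (e / 2) ltac:(lra).
have {}h0 := h0 _ (leq_maxl n0 n1); have {}h1 := h1 _ (leq_maxr n0 n1).
have -> : A - B = (avg (maxn n0 n1) G - B) - (avg (maxn n0 n1) G - A).
  by move: (avg _ G) => X; mring.
rewrite (le_trans (mnormB _ _))//; lra.
Qed.

Lemma mean_tr0 (G : 'rV[R]_d -> 'M[R]_2) B : (forall t, \tr (G t) = 0) -> mean G B -> \tr B = 0.
Proof.
move=> G0 hB; have h := mean_lin (f := @tl R) (K := 1) (@tlD R) (@tlZ R) _ hB.
have -> : B = tl B; last exact: tr_tl.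
apply: mean_uniq hB _; apply: (mean_ext _ (h _)) => [t|X]; first by rewrite tl_id.
by rewrite mul1r mnorm_tl.
Qed.

Lemma tr_conj A B : \det A = 1 -> \tr (A * B * adj2 A) = \tr B.
Proof.
move=> h; rewrite -[A * B * _]/((A * B) *m adj2 A) mxtrace_mulC mulmxE mulrA adj2_det1l//.
by rewrite mul1r.
Qed.

Lemma tr_conjV A B : \det A = 1 -> \tr (adj2 A * B * A) = \tr B.
Proof. by move=> h; rewrite -{2}(adj2K A) tr_conj// det_adj2. Qed.

Lemma amap_tr0 (s : seq (@atom R d)) t : \tr (ev 1 (amap (@tl R) s) t) = 0.
Proof. by rewrite ev_amap ?tr_tl//; [exact: tlD|exact: tlZ]. Qed.

(** A finite part of the series is cut at frequency N. What is discarded, the tail of the series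
    included, is small for the weaker weight w'; [tl] restores the zero trace of what is kept. *)
Lemma low_part (w w' : 'rV[int]_d -> R) F eps h N :
  weight w -> weight w' -> (forall k, w' k <= w k) -> 0 < h -> 0 < eps ->
  (forall k, N < norm1 (rvint k : 'rV[R]_d) -> w' k <= h * w k) ->
  (forall t, \tr (F t) = 0) -> bnd 1 w F eps ->
  exists s : seq (@atom R d), [/\ forall b, b \in s -> norm1 (rvint b.1.1 : 'rV[R]_d) <= N,
    nm w s <= eps, forall t, \tr (ev 1 s t) = 0 & bnd 1 w' (fun t => F t - ev 1 s t) (2 * (h * eps))].
Proof.
move=> wW wW' ww h0 e0 hN F0 bF.
have [s [ns hs]] := bnd_split bF (mulr_gt0 h0 e0).
pose P := fun b : @atom R d => norm1 (rvint b.1.1 : 'rV[R]_d) <= N.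
pose lo := seq.filter P s; pose hi := seq.filter (predC P) s.
have evs t : ev 1 s t = ev 1 lo t + ev 1 hi t.
  by rewrite /ev !big_filter (bigID P).
have nms : nm w s = nm w lo + nm w hi by rewrite /nm !big_filter (bigID P).
have nhi : nm w' hi <= h * eps.
  apply: (le_trans (y := h * nm w hi)).
    rewrite /nm mulr_sumr big_seq [leRHS]big_seq ler_sum// => b.
    rewrite mem_filter /= /P -ltNge => /andP[/hN bN _].
    by rewrite mulrA ler_wpM2r ?mnorm_ge0.
  rewrite ler_wpM2l ?(ltW h0)//; have := nm_ge0 wW lo; lra.
exists (amap (@tl R) lo); split.
- move=> b /mapP[b' + ->]/=; by rewrite mem_filter => /andP[].
- apply: le_trans (nm_amap (K := 1) wW _ _) _ => [U|]; first by rewrite mul1r mnorm_tl.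
  rewrite mul1r; have := nm_ge0 wW hi; lra.
- by move=> t; exact: amap_tr0.
- have h1 := bndD (bnd_wle ww hs) (bnd_le nhi (bnd_ev 1 wW' hi)).
  apply: (bnd_le _ (bnd_ext _ (bnd_tl wW' h1))) => [|t]; first by lra.
  rewrite evs ev_amap; [|exact: tlD|exact: tlZ].
  rewrite opprD addrA subrK tlD tlN tl_id//.
Qed.

(* The Cayley transform of V = Y / 2 conjugates Abar + F to Abar + E + F'. *)
Lemma cayley_conj (Ab F E Et V : 'M[R]_2) : let Y := V + V in
  ad Ab Y + (F - Et) - E = (1 - V) * (Ab + F) * (1 + V) - (1 + V) * (Ab + E) * (1 - V)
   - (Et + (ad (F + E) V - V * (F - E) * V)).
Proof.
rewrite /ad mk1 (mkE Ab) (mkE F) (mkE E) (mkE Et) (mkE V).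
move: (Ab 0 0) (Ab 0 1) (Ab 1 0) (Ab 1 1) => a b c a'.
move: (F 0 0) (F 0 1) (F 1 0) (F 1 1) => f1 f2 f3 f4.
move: (E 0 0) (E 0 1) (E 1 0) (E 1 1) => e1 e2 e3 e4.
move: (Et 0 0) (Et 0 1) (Et 1 0) (Et 1 1) => g1 g2 g3 g4.
move: (V 0 0) (V 0 1) (V 1 0) (V 1 1) => v1 v2 v3 v4.
by rewrite !(mkN, mkD, mkM); congr mk; ring.
Qed.

(** [psi] need not change: E = psi B psi^-1 satisfies E psi = psi B, so the same [psi] reduces Abar
    + E to A + B. The Cayley transform Q = (1 + V) (1 - V)^-1 = 2 (1 - V)^-1 - 1 of a traceless V
    has determinant exactly 1, and bounding it takes only a Neumann series. The new error consists
    of the discarded frequencies and of terms of order eps y. *)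
Lemma kam_step psi (w w' : 'rV[int]_d -> R) (Abar F : 'rV[R]_d -> 'M[R]_2) A
    (a C M N h eps Dv m e : R) : let y := Dv * (2 * C * eps) in
  weight w -> weight w' -> (forall k, w' k <= w k) -> 0 < h -> 0 < eps ->
  (forall k, N < norm1 (rvint k : 'rV[R]_d) -> w' k <= h * w k) ->
  (forall t, \det (psi t) = 1) -> \tr A = 0 -> (forall t, \tr (Abar t) = 0) ->
  (forall t, \tr (F t) = 0) ->
  (forall t, dM omega psi (Abar t * psi t - psi t * A) t) ->
  bnd 1 w (fun t => psi t * A * adj2 (psi t)) a -> frame psi w M C -> 0 <= C ->
  0 <= m -> 0 <= e -> divisors omega A m e (N + M) ->
  m + 2 * a * e + 4 * a ^+ 2 * (m * e) <= Dv ->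
  bnd 1 w F eps -> y <= 2^-1 ->
  exists B Q F' G,
  [/\ [/\ \tr B = 0, bnd 1 w (fun t => psi t * B * adj2 (psi t)) (2 * C * eps),
          bnd 1 w G eps & mean (fun t => adj2 (psi t) * G t * psi t) B],
      [/\ forall t, \det (Q t) = 1, bnd 1 w' (fun t => Q t - 1) (2 * y)
        & bnd 1 w' (fun t => adj2 (Q t) - 1) (2 * y)],
      forall t, \tr (F' t) = 0,
      bnd 1 w' F' (9 * (2 * (h * eps) + 2 * (1 + 2 * C) * eps * y))
    & forall t, dM omega Q ((Abar t + F t) * Q t
         - Q t * (Abar t + psi t * B * adj2 (psi t) + F' t)) t].
Proof.
move=> y wW wW' ww h0 e0 hN psi1 trA trAb trF dpsi bA hf C0 m0 ee0 hD hDv bF y2.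
have [s [sN ns trs bEt]] := low_part wW wW' ww h0 e0 hN trF bF.
have a0 : 0 <= a := bnd_ge0 bA.
have Dv0 : 0 <= Dv by apply: le_trans hDv; rewrite !addr_ge0// !mulr_ge0// sqr_ge0.
have [X [X' [B [dX eX bX bB mB]]]] :=
  homological wW psi1 trA bA m0 ee0 hD hDv Dv0 (lexx _) sN hf.
have Cns : 2 * C * nm w s <= 2 * C * eps by rewrite ler_wpM2l// mulr_ge0.
have trB : \tr B = 0 by apply: mean_tr0 mB => t; rewrite tr_conjV.
pose E t := psi t * B * adj2 (psi t).
have trE t : \tr (E t) = 0 by rewrite /E tr_conj.
have bE : bnd 1 w E (2 * C * eps) := bnd_le Cns bB.
pose Et t := F t - ev 1 s t.
pose Y0 t := psi t * X t * adj2 (psi t).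
(* The trace part of Y0 commutes with everything, so Y satisfies the same equation, and zero trace
   is what gives det Q = 1. *)
pose Y t := tl (Y0 t).
have pV t : adj2 (psi t) * psi t = 1 by rewrite adj2_det1l.
have pV' t : psi t * adj2 (psi t) = 1 by rewrite adj2_det1.
have dY t : dM omega Y (ad (Abar t) (Y t) + (F t - Et t) - E t) t.
  have h1 := dM_tl (dMM (dMM (dpsi t) (dX t)) (dM_adj2 (dpsi t))).
  apply: dM_eq h1 _.
  have -> : adj2 (Abar t * psi t - psi t * A) = A * adj2 (psi t) - adj2 (psi t) * Abar t.
    rewrite adj2D -scaleN1r adj2Z !adj2M (adj2_tr0 trA) (adj2_tr0 (trAb t)) scaleN1r.
    by rewrite mulrN mulNr opprK addrC.
  have X'E : X' t = ad A (X t) + (adj2 (psi t) * ev 1 s t * psi t - B) by rewrite -eX addrC subrK.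
  have -> : ((Abar t * psi t - psi t * A) * X t + psi t * X' t) * adj2 (psi t) +
      psi t * X t * (A * adj2 (psi t) - adj2 (psi t) * Abar t) =
      ad (Abar t) (Y0 t) + (ev 1 s t - E t).
    have -> : ev 1 s t - E t = psi t * (X' t - ad A (X t)) * adj2 (psi t).
      by rewrite eX mulrBr mulrBl -/(E t) !mulrA pV' mul1r -mulrA pV' mulr1.
    rewrite /Y0 /ad; move: (psi t) (adj2 (psi t)) (X t) (X' t) (Abar t) => P P' Z Z' K.
    rewrite !(mulrDl, mulrDr, mulrBl, mulrBr, mulNr, mulrN, opprB, opprD, opprK) !mulrA.
    by mring.
  rewrite tlD tl_ad ad_tlr tl_id; last by rewrite raddfB/= trs trE subrr.
  by rewrite /Et subKr addrA.
have bY : bnd 1 w Y y.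
  by apply: (bnd_le _ (bnd_tl wW bX)); rewrite ler_wpM2l.
pose V t := 2^-1 *: Y t.
have VV t : V t + V t = Y t.
  by rewrite /V -scalerDl (_ : 2^-1 + 2^-1 = 1) ?scale1r//; lra.
have trV t : \tr (V t) = 0 by rewrite /V linearZ/= tr_tl mulr0.
have bV : bnd 1 w' V (2^-1 * y).
  by have := bndZ wW' 2^-1 (bnd_wle ww bY); rewrite ger0_norm.
have y0 : 0 <= y := bnd_ge0 bY.
have V2 t : V t * V t = - \det (V t) *: 1 := tr0_sqr (trV t).
pose g t := (1 + \det (V t))^-1.
(* V^2 = - det V, so (1 + V) (1 - V) is the scalar 1 + det V, kept away from 0 by y <= 1 / 2. *)
have gne t : 1 + \det (V t) != 0.
  have := mnorm_bnd wW' t bV; have := mnorm_ge0 (V t); have := det2_abs (V t).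
  rewrite ler_norml expr2 => /andP[dv _] v0 v1; rewrite gt_eqF//.
  have : mnorm (V t) * mnorm (V t) <= 2^-1 * y * (2^-1 * y) by rewrite ler_pM.
  have : y * y <= 2^-1 * 2^-1 by rewrite ler_pM.
  lra.
pose W t := g t *: (1 + V t); pose U t := g t *: (1 - V t).
have PM t : (1 + V t) * (1 - V t) = (1 + \det (V t)) *: 1.
  by rewrite mulrBr mulr1 mulrDl mul1r opprD addrA addrK V2 scaleNr opprK scalerDl scale1r.
have MP t : (1 - V t) * (1 + V t) = (1 + \det (V t)) *: 1.
  by rewrite mulrDr mulr1 mulrBl mul1r addrA subrK V2 scaleNr opprK scalerDl scale1r.
have W1 t : W t * (1 - V t) = 1 by rewrite -scalerAl PM scalerA mulVf// scale1r.
have W2 t : (1 - V t) * W t = 1 by rewrite -scalerAr MP scalerA mulVf// scale1r.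
have U1 t : U t * (1 + V t) = 1 by rewrite -scalerAl MP scalerA mulVf// scale1r.
have U2 t : (1 + V t) * U t = 1 by rewrite -scalerAr PM scalerA mulVf// scale1r.
have nb : 2^-1 * y / (1 - 2^-1 * y) <= y.
  rewrite ler_pdivrMr; last by lra.
  by rewrite mulrC ler_wpM2l//; lra.
have bW1 : bnd 1 w' (fun t => W t - 1) y.
  apply: (bnd_le nb); apply: (bnd_neumann wW' bV); first by lra.
  by move=> t; have := W2 t; rewrite mulrBl mul1r => <-; rewrite subrK.
have bU1 : bnd 1 w' (fun t => U t - 1) y.
  apply: (bnd_le nb); apply: (bnd_neumann wW' (bndN wW' bV)); first by lra.
  by move=> t; have := U2 t; rewrite mulrDl mul1r => <-; rewrite mulNr addrK.
have bW : bnd 1 w' W 3.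
  apply: (bnd_le _ (bnd_ext _ (bndD bW1 (bnd_cst 1 wW' 1)))) => [|t]; last by rewrite subrK.
  rewrite mnorm1; lra.
have bU : bnd 1 w' U 3.
  apply: (bnd_le _ (bnd_ext _ (bndD bU1 (bnd_cst 1 wW' 1)))) => [|t]; last by rewrite subrK.
  rewrite mnorm1; lra.
pose Q t := 2 *: W t - 1.
have QE t : Q t = W t * (1 + V t).
  have -> : 1 + V t = 2 *: 1 - (1 - V t) by move: (V t) => v; mring.
  by rewrite mulrBr W1 -scalerAr mulr1.
have QE' t : Q t = (1 + V t) * W t.
  have -> : 1 + V t = 2 *: 1 - (1 - V t) by move: (V t) => v; mring.
  by rewrite mulrBl W2 -scalerAl mul1r.
have adjW t : adj2 (W t) = U t.
  by rewrite /W /U adj2Z adj2D adj21 (adj2_tr0 (trV t)).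
have adjQ t : adj2 (Q t) = 2 *: U t - 1.
  by rewrite /Q adj2D -scaleN1r (adj2Z 2 (W t)) (adj2Z (-1) 1) adjW adj21 scaleN1r.
have adjQE t : adj2 (Q t) = U t * (1 - V t).
  have -> : 1 - V t = 2 *: 1 - (1 + V t) by move: (V t) => v; mring.
  by rewrite adjQ mulrBr U1 -scalerAr mulr1.
pose S t := Et t + (ad (F t + E t) (V t) - V t * (F t - E t) * V t).
pose F' t := U t * S t * W t.
exists B, Q, F', (ev 1 s); split.
- split => //; exact: bnd_le ns (bnd_ev 1 wW s).
- split.
  + move=> t; have : Q t * adj2 (Q t) = 1.
      have WU : W t * U t = g t *: 1.
        by rewrite /W /U -scalerAl -scalerAr PM !scalerA -mulrA mulVf ?mulr1.
      rewrite {1}QE' adjQE -mulrA [W t * (_ * _)]mulrA WU -scalerAl mul1r -scalerAr PM.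
      by rewrite scalerA mulVf// scale1r.
    by rewrite mul_adj2 => /matrixP/(_ 0 0); rewrite !mxE.
  + have := bndZ wW' 2 bW1; rewrite ger0_norm//; apply: bnd_ext => t.
    by rewrite /Q scalerBr [2 *: 1]scaler_nat mulr2n opprD addrA.
  + have := bndZ wW' 2 bU1; rewrite ger0_norm//; apply: bnd_ext => t.
    by rewrite adjQ scalerBr [2 *: 1]scaler_nat mulr2n opprD addrA.
- move=> t; rewrite /F'.
  have WU : W t * U t = g t *: 1.
    by rewrite /W /U -scalerAl -scalerAr PM !scalerA -mulrA mulVf ?mulr1.
  rewrite -[U t * S t * W t]/((U t * S t) *m W t) mxtrace_mulC mulmxE mulrA WU -scalerAl mul1r.
  have trEt : \tr (Et t) = 0 by rewrite /Et raddfB/= trF trs subrr.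
  rewrite mxtraceZ /S mxtraceD trEt add0r mxtraceD.
  have -> : \tr (ad (F t + E t) (V t)) = 0.
    by rewrite -tl_ad tr_tl.
  have tVXV X1 : \tr (V t * X1 * V t) = - \det (V t) * \tr X1.
    rewrite -[V t * X1 * V t]/((V t * X1) *m V t) mxtrace_mulC mulmxE mulrA V2.
    by rewrite -scalerAl mul1r mxtraceZ.
  have trN (X1 : 'M[R]_2) : \tr (- X1) = - \tr X1 by rewrite raddfN.
  by rewrite add0r trN tVXV mxtraceD trN trF trE oppr0 addr0 mulr0 oppr0 mulr0.
- have bF' := bnd_wle ww bF; have bE' := bnd_wle ww bE.
  have bad := bndB wW' (bndM wW' (bndD bF' bE') bV) (bndM wW' bV (bndD bF' bE')).
  have bVV := bndM wW' (bndM wW' bV (bndB wW' bF' bE')) bV.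
  have bS := bndM wW' (bndM wW' bU (bndD bEt (bndB wW' bad bVV))) bW.
  apply: bnd_le bS.
  have -> : 3 * (2 * (h * eps) + ((eps + 2 * C * eps) * (2^-1 * y) + 2^-1 * y * (eps + 2 * C * eps) +
      2^-1 * y * (eps + 2 * C * eps) * (2^-1 * y))) * 3 =
      9 * (2 * (h * eps) + ((1 + 2 * C) * eps) * (y + y * y / 4)) by field.
  have P : 0 <= (1 + 2 * C) * eps by rewrite mulr_ge0 ?(ltW e0)//; lra.
  have yy : y * y <= 2^-1 * y by rewrite ler_wpM2r.
  have := ler_wpM2l P (_ : y + y * y / 4 <= 2 * y); lra.
- move=> t.
  have dV : dM omega V (2^-1 *: (ad (Abar t) (Y t) + (F t - Et t) - E t)) t := dMZc 2^-1 (dY t).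
  have dW := dM_inv (dMB (dM_cst omega 1 t) dV) W1 W2.
  have dQ := dMB (dMZc 2 dW) (dM_cst omega 1 t).
  apply: dM_eq dQ _.
  have half2 (X1 Y1 Z1 : 'M[R]_2) : 2 *: - (X1 * (0 - 2^-1 *: Z1) * Y1) - 0 = X1 * Z1 * Y1.
    by rewrite subr0 sub0r mulrN mulNr opprK -scalerAr -scalerAl scalerA mulfV// scale1r.
  rewrite half2.
  rewrite -VV (cayley_conj (Abar t) (F t) (E t) (Et t) (V t)) -/(S t).
  have -> : (Abar t + F t) * Q t = W t * ((1 - V t) * (Abar t + F t) * (1 + V t)) * W t.
    by rewrite !mulrA W1 mul1r -mulrA -QE'.
  have -> : Q t * (Abar t + psi t * B * adj2 (psi t) + F' t) =
     W t * ((1 + V t) * (Abar t + E t) * (1 - V t)) * W t + W t * S t * W t.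
    rewrite mulrDr; congr (_ + _).
      by rewrite QE -/(E t) -!mulrA W2 mulr1.
    by rewrite QE /F' -!mulrA [(1 + V t) * (U t * _)]mulrA U2 mul1r.
  move: (W t) (S t) => w1 s1; move: ((1 - V t) * _ * _) ((1 + V t) * _ * _) => x1 x2.
  by rewrite !mulrBr !mulrBl opprD addrA.
Qed.

End KamStep.
Import measurable_realfun.

(** * Increments bounded by the integral of a majorant of the derivative *)

Section IncrementIntegral.
Variable R : realType.
Notation mu := (@lebesgue_measure R).

Section Cover.
Variables (U : nat -> set R) (h : nat -> R).
Hypotheses (mU : forall n, measurable (U n)) (h0 : forall n, 0 <= h n).

Let H (u v : R) : \bar R := (\sum_(0 <= n <oo) (h n)%:E * mu (U n `&` `]u, v]))%E.

Let mI n (u v : R) : measurable (U n `&` `]u, v]).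
Proof. by apply: measurableI; [exact: mU|exact: measurable_itv]. Qed.

Let Hn_ge0 u v n : (0 <= (h n)%:E * mu (U n `&` `]u, v]))%E.
Proof. by rewrite mule_ge0// lee_fin. Qed.

Let H_ge0 u v : (0 <= H u v)%E.
Proof. by apply: nneseries_ge0 => n _ _; exact: Hn_ge0. Qed.

Let HD u m v : u <= m -> m <= v -> (H u v = H u m + H m v)%E.
Proof.
move=> um mv; rewrite /H -nneseriesD; try by move=> n _ _; exact: Hn_ge0.
apply: eq_eseriesr => n _; rewrite -ge0_muleDr ?measure_ge0//; congr (_ * _)%E.
rewrite -measureU; first 1 last.
- exact: mI.
- exact: mI.
- apply/seteqP; split => // t [[_ /=]]; rewrite !in_itv/= => /andP[_ tm] [_ /andP[]].
  by move=> /lt_le_trans/(_ tm); rewrite ltxx.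
rewrite -setIUr; congr (mu (_ `&` _)); apply/seteqP; split => t /=; rewrite !in_itv/=.
- move=> /andP[ut tv]; have [tm|mt] := leP t m; [left|right].
    by rewrite ut.
  by rewrite tv andbT.
- by move=> [/andP[ut tm]|/andP[mt tv]]; rewrite ?ut ?tv ?(le_trans tm mv) ?(le_lt_trans um mt).
Qed.

Let H_ge n u v : u <= v -> `]u, v] `<=` U n -> ((h n * (v - u))%:E <= H u v)%E.
Proof.
move=> uv sU; apply: le_trans (nneseries_lim_ge n.+1 _); last by move=> k _ _; exact: Hn_ge0.
rewrite big_nat_recr//= EFinM; apply: le_trans (leeDr _ _); last first.
  by apply: sume_ge0 => k _; exact: Hn_ge0.
rewrite lee_wpmul2l ?lee_fin// setIidr// lebesgue_measure_itv/= lte_fin.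
by case: ltP => // vu; rewrite lee_fin subr_le0.
Qed.

(* Continuous induction: the supremum of the points up to which the inequality holds is y. *)
Lemma increment_le_cover (f : R -> R) (x y e : R) : 0 < e -> x <= y ->
  (forall n, open (U n)) ->
  (forall c : R, x <= c <= y -> exists D n, [/\ is_derive c 1 f D, D <= h n & U n c]) ->
  ((f y - f x)%:E <= H x y + (e * (y - x))%:E)%E.
Proof.
move=> e0 xy oU hd.
pose good v := ((f v - f x)%:E <= H x v + (e * (v - x))%:E)%E.
have near c : x <= c <= y -> exists2 r : R, 0 < r & forall u v, c - r < u -> u <= c ->
    c <= v -> v < c + r -> u = c \/ v = c ->
    ((f v - f u)%:E <= H u v + (e * (v - u))%:E)%E.
  move=> /hd[D [n [/is_derive1_caratheodory[G [fG Gc GD]] Dh Uc]]].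
  have [r1 /= r10 hr1] : \forall t \near c, U n t by apply: open_nbhs_nbhs; split.
  have [r2 /= r20 hr2] : \forall t \near c, `|G c - G t| < e.
    by move/cvgrPdist_lt : Gc; apply.
  exists (Num.min r1 r2); first by rewrite lt_min r10 r20.
  move=> u v cu uc cv vc uvc.
  have [r1u r2u] : c - r1 < u /\ c - r2 < u.
    by split; apply: le_lt_trans cu; rewrite lerD2l lerN2 ge_min lexx ?orbT.
  have [r1v r2v] : v < c + r1 /\ v < c + r2.
    by split; apply: lt_le_trans vc _; rewrite lerD2l ge_min lexx ?orbT.
  have uv : u <= v by exact: le_trans cv.
  have sub : `]u, v] `<=` U n.
    move=> t /=; rewrite in_itv/= => /andP[ut tv]; apply: hr1.
    by rewrite /ball/= ltr_norml; apply/andP; split; lra.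
  have inc : f v - f u <= (h n + e) * (v - u).
    have sm t : c - r2 < t -> t < c + r2 -> G t <= h n + e.
      move=> ct tc; have /hr2 : ball c r2 t.
        by rewrite /ball/= ltr_norml; apply/andP; split; lra.
      by rewrite ltr_norml GD => /andP[]; lra.
    case: uvc => [->|->]; first by rewrite fG ler_wpM2r ?subr_ge0// sm//; lra.
    have -> : f c - f u = G u * (c - u) by have := fG u; lra.
    by rewrite ler_wpM2r ?subr_ge0// sm//; lra.
  apply: le_trans (leeD2r _ (H_ge uv sub)).
  by rewrite -EFinD lee_fin -mulrDl.
have step u v : x <= u -> u <= v -> good u ->
    ((f v - f u)%:E <= H u v + (e * (v - u))%:E)%E -> good v.
  move=> xu uv gu guv; rewrite /good (HD xu uv).
  have -> : f v - f x = (f u - f x) + (f v - f u) by lra.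
  have -> : e * (v - x) = e * (u - x) + e * (v - u) by lra.
  by rewrite EFinD [((_ + _)%R)%:E in X in (_ <= X)%E]EFinD addeACA; exact: leeD.
pose S := [set v | x <= v <= y /\ good v].
have Sx : S x by rewrite /S/= lexx xy /good !subrr mulr0 adde0; split.
have Sb : has_sup S by split; [exists x|exists y => t [/andP[_ ty] _]].
pose c := sup S.
have xc : x <= c by exact: sup_upper_bound.
have cy : c <= y by apply: ge_sup; [exists x|move=> t [/andP[]]].
have [r r0 hr] : exists2 r : R, 0 < r & forall u v, c - r < u -> u <= c ->
    c <= v -> v < c + r -> u = c \/ v = c ->
    ((f v - f u)%:E <= H u v + (e * (v - u))%:E)%E by apply: near; rewrite xc cy.
have gc : good c.
  have [u [/andP[xu uy] gu] cu] := sup_adherent r0 Sb.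
  have uc : u <= c by apply: sup_upper_bound => //; split; [rewrite xu uy|].
  apply: (step u) => //; apply: hr => //; last by right.
  by rewrite ltrDl.
have [cy'|cy'] : c = y \/ c < y by move: cy; rewrite le_eqVlt => /orP[/eqP|]; [left|right].
  by move: gc; rewrite /good cy'.
pose v := Num.min y (c + r / 2).
have cv : c < v by rewrite lt_min cy' ltrDl divr_gt0.
have vr : v < c + r by rewrite gt_min; apply/orP; right; lra.
have : S v.
  split; first by rewrite (le_trans xc (ltW cv)) ge_min lexx.
  by apply: (step c) => //; [exact: ltW|apply: hr => //; [lra|exact: ltW|left]].
by move=> /(sup_upper_bound Sb) /(lt_le_trans cv); rewrite ltxx.
Qed.

End Cover.

(* No continuity of the derivative is assumed: outer regularity covers each level set of g by an
   open set of almost the same measure. *)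
Lemma increment_le_integral (f g : R -> R) (x y : R) : x <= y ->
  (forall c : R, x <= c <= y -> exists2 D, is_derive c 1 f D & D <= g c) ->
  (forall c : R, x <= c <= y -> 0 <= g c) -> measurable_fun `[x, y] g ->
  ((f y - f x)%:E <= \int[mu]_(t in `[x, y]) (g t)%:E)%E.
Proof.
move=> xy hd g0 mg; apply/lee_addgt0Pr => e' e'0.
(* The losses add up to e': e (y - x) for rounding g up to multiples of e, e for the excess measure
   of the covers, and e (y - x) from the covering lemma. *)
pose e := e' / (2 * (y - x) + 1).
have D0 : 0 < 2 * (y - x) + 1 by rewrite ltr_wpDl// mulr_ge0// subr_ge0.
have e0 : 0 < e by rewrite divr_gt0.
have ee : e * (2 * (y - x) + 1) = e' by rewrite mulfVK// gt_eqF.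
pose E n := `[x, y]%classic `&` g @^-1` `[n%:R * e, n.+1%:R * e[%classic.
have mE n : measurable (E n) by apply: mg => //; exact: measurable_itv.
have Efin n : (mu (E n) < +oo)%E.
  apply: le_lt_trans (_ : mu `[x, y]%classic < _)%E.
    by apply: le_measure; rewrite ?inE//; [exact: mE|exact: subIsetl].
  by rewrite lebesgue_measure_itv/=; case: ifP => _; rewrite ?ltry// -EFinB ltry.
(* The excess of the n-th cover is weighted by (n + 1) e, so all the excesses together contribute at
   most e. *)
have reg n : exists V : set R, [/\ open V, E n `<=` V &
    (mu (V `\` E n) < (2^-1 ^+ n.+1 / n.+1%:R)%:E)%E].
  by apply: lebesgue_regularity_outer; [exact: mE|exact: Efin|rewrite divr_gt0// exprn_gt0].
have [U HU] := choice reg.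
have oU n : open (U n) by have [] := HU n.
have mU n : measurable (U n) by exact: open_measurable.
pose h n : R := n.+1%:R * e.
have tr c : x <= c <= y -> (Num.truncn (g c / e))%:R * e <= g c < h (Num.truncn (g c / e)).
  move=> cxy; rewrite -ler_pdivlMr// -ltr_pdivrMr//.
  by apply: truncn_itv; rewrite divr_ge0 ?g0// ltW.
have h0 n : 0 <= h n by rewrite mulr_ge0// ltW.
have key := increment_le_cover mU h0 e0 xy oU (f := f).
apply: (le_trans (key _)) => [c cxy|].
  have [D dD Dg] := hd c cxy; exists D, (Num.truncn (g c / e)).
  have /andP[t1 t2] := tr c cxy.
  have gc : `[x, y]%classic c by rewrite /= in_itv.
  have [_ sE _] := HU (Num.truncn (g c / e)); split => //.
    exact: le_trans Dg (ltW t2).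
  by apply: sE; split => //=; rewrite in_itv/= t1.
apply: (@le_trans _ _ ((\int[mu]_(t in `[x, y]) (g t + e)%:E + e%:E) + (e * (y - x))%:E)%E).
  apply: leeD2r.
  have -> : (\int[mu]_(t in `[x, y]) (g t + e)%:E = \sum_(0 <= n <oo) \int[mu]_(t in E n) (g t + e)%:E)%E.
    have UE : \bigcup_n E n = `[x, y]%classic.
      apply/seteqP; split => [t [n _ []]//|t txy]; exists (Num.truncn (g t / e)) => //; split => //=.
      by rewrite in_itv/=; apply: tr; move: txy; rewrite /= in_itv.
    rewrite -UE ge0_integral_bigcup//.
    - rewrite UE; apply/measurable_EFinP; apply: measurable_funD => //.
    - move=> t; rewrite UE /= in_itv/= => txy; rewrite lee_fin addr_ge0 ?g0//; exact: ltW.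
    - apply: ltn_trivIset => n m mn; apply/seteqP; split => // t [[_ /=]].
      rewrite !in_itv/= => /andP[n1 n2] [_ /andP[m1 m2]].
      have : m.+1%:R * e <= n%:R * e by rewrite ler_wpM2r ?(ltW e0)// ler_nat.
      by move: m1 m2 n1 n2; rewrite !bnd_simp => m1 m2 n1 n2; lra.
  apply: le_trans (epsilon_trick _ _ (ltW e0)) => //; last first.
    move=> n; apply: integral_ge0 => t [/=]; rewrite in_itv/= => txy _.
    by rewrite lee_fin addr_ge0 ?g0//; exact: ltW.
  apply: lee_nneseries => [n _ _|n _]; first by rewrite mule_ge0// lee_fin.
  have [_ sE mUE] := HU n.
  have mUE' : measurable (U n `\` E n) by apply: measurableD; [exact: mU|exact: mE].
  have -> : (e / (2 ^ n.+1)%:R)%:E = ((h n)%:E * (2^-1 ^+ n.+1 / n.+1%:R)%:E)%E.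
    rewrite -EFinM /h natrX exprVn; congr EFin; field.
    by rewrite expf_neq0//= addrC natr1 pnatr_eq0.
  apply: (@le_trans _ _ ((h n)%:E * (mu (E n) + mu (U n `\` E n)))%E).
    rewrite lee_wpmul2l ?lee_fin//.
    apply: (@le_trans _ _ (mu (E n `|` (U n `\` E n)))).
      apply: le_measure; rewrite ?inE.
      - by apply: measurableI; [exact: mU|exact: measurable_itv].
      - by apply: measurableU; [exact: mE|exact: mUE'].
      - by move=> t [Ut _]; have [|] := pselect (E n t); [left|right].
    rewrite measureU//; first exact: mE.
    by apply/seteqP; split => // t [? []].
  rewrite ge0_muleDr//; apply: leeD; last by rewrite lee_wpmul2l ?lee_fin ?h0//; exact: ltW mUE.
  have ic : (\int[mu]_(t in E n) (h n)%:E = (h n)%:E * mu (E n))%E.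
    by rewrite integral_cst//; exact: mE.
  rewrite -ic; apply: ge0_le_integral => //=.
  - exact: mE.
  - by move=> t _; rewrite lee_fin.
  - apply/measurable_EFinP; apply: measurable_funD => //.
    by apply: measurable_funS mg; [exact: measurable_itv|exact: subIsetl].
  - move=> t [_ /=]; rewrite in_itv/= => /andP[n1 _]; rewrite lee_fin /h -natr1 mulrDl mul1r.
    by rewrite lerD2r.
under eq_integral do rewrite EFinD.
rewrite ge0_integralD//=; first last.
- by move=> t _; rewrite lee_fin ltW.
- exact/measurable_EFinP.
rewrite integral_cst//=.
have -> : mu `[x, y]%classic = (y - x)%:E.
  rewrite lebesgue_measure_itv/= lte_fin; case: ltP => // yx.
  by rewrite (_ : y - x = 0)//; lra.
have absorb (I : \bar R) (a b c : R) : a + (b + c) <= e' ->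
    (I + a%:E + b%:E + c%:E <= I + e'%:E)%E.
  by move=> abc; rewrite -!addeA leeD2l// -!EFinD lee_fin.
by rewrite -EFinM; apply: absorb; move: ee; move: (y - x) => D ee; lra.
Qed.

End IncrementIntegral.

(** * Summability and slowly growing majorants *)

Section Scales.
Variable R : realType.
Notation mu := (@lebesgue_measure R).

(** The indefinite integral I acts as a bounded potential common to all f: inequalities for
    different functions on consecutive intervals can be added, and their right-hand sides
    telescope. *)
Lemma integrable_increment_bound (g : R -> R) (a : R) :
  (forall c, a <= c -> 0 <= g c) -> mu.-integrable `[a, +oo[ (fun t => (g t)%:E) ->
  exists (I : R -> R) (K : R), (forall u, a <= u -> 0 <= I u <= K) /\
    forall (u v : R) (f : R -> R), a <= u -> u <= v ->
      (forall c : R, u <= c <= v -> exists2 D, is_derive c 1 f D & D <= g c) ->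
      f v - f u <= I v - I u.
Proof.
move=> g0 ig; pose I (x : R) := (\int[mu]_(t in `[a, x]) g t)%R.
have pos (i : interval R) : [set` i] `<=` `[a, +oo[ -> 0 <= (\int[mu]_(t in [set` i]) g t)%R.
  move=> si; apply: Rintegral_ge0 => t /si/=; rewrite in_itv/= andbT; exact: g0.
have sub (i : interval R) : [set` i] `<=` `[a, +oo[ -> mu.-integrable [set` i] (EFin \o g).
  move=> si; apply: integrableS ig => //; exact: measurable_itv.
exists I, (\int[mu]_(t in `[a, +oo[) g t)%R; split.
- move=> u au; rewrite pos/=; last first.
    by move=> t /=; rewrite !in_itv/= andbT => /andP[].
  rewrite -subr_ge0 Rintegral_itvB//; apply: pos => t /=.
  by rewrite !in_itv/= !andbT => /ltW; exact: le_trans.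
- move=> u v f au uv hf.
  have sv : `[a, v]%classic `<=` `[a, +oo[%classic.
    by move=> t /=; rewrite !in_itv/= andbT => /andP[].
  have suv : `[u, v]%classic `<=` `[a, +oo[%classic.
    by move=> t /=; rewrite !in_itv/= andbT => /andP[/(le_trans au)].
  have suv' : `]u, v]%classic `<=` `[a, +oo[%classic.
    by move=> t /=; rewrite !in_itv/= andbT => /andP[/ltW/(le_trans au)].
  rewrite /I Rintegral_itvB//; last exact: sub.
  rewrite Rintegral_itv_obnd_cbnd; last exact: sub.
  have iuv := sub _ suv.
  rewrite -lee_fin /Rintegral fineK; last first.
    by apply: integrable_fin_num => //; exact: measurable_itv.
  apply: increment_le_integral => //.
    by move=> c /andP[/(le_trans au) ac _]; exact: g0.
  by have /integrableP[/measurable_EFinP m _] := iuv; exact: m.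
Qed.

(** Two smoothings: S_(j+1) = 6/5 S_j + f_(j+1) forces growth at least 6/5, and b_j = S_j + 2/3
    b_(j+1), the sum over m >= j of (2/3)^(m-j) S_m, forces growth at most 3/2. Summability against
    (4/5)^j survives because 24/25 and 2/3 times 5/4 are below 1; the two smoothings cost factors 25
    and 11, whence 275. *)
Lemma slow_majorant (f : nat -> R) (S0 sigma : R) : (forall j, 0 <= f j) -> 0 <= S0 ->
  (forall n, \sum_(j < n) f j * (4 / 5) ^+ j <= sigma) ->
  exists b : nat -> R, [/\ S0 <= b 0, forall j, f j <= b j,
    forall j, 6 / 5 * b j <= b j.+1 <= 3 / 2 * b j
    & forall n, \sum_(j < n) b j * (4 / 5) ^+ j <= 275 * (S0 + sigma)].
Proof.
move=> f0 S00 fs.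
pose S := fix S j := if j is i.+1 then 6 / 5 * S i + f j else S0 + f 0.
have Sp j : 0 <= S j.
  by elim: j => [|j IH] /=; rewrite addr_ge0// mulr_ge0.
have Sf j : f j <= S j by case: j => [|j] /=; rewrite lerDr// mulr_ge0.
pose s j := S j * (4 / 5) ^+ j.
have s0 j : 0 <= s j by rewrite mulr_ge0// exprn_ge0.
pose A n := \sum_(j < n) s j.
pose sig := 25 * (S0 + sigma).
have Asig n : A n + 25 * s n <= sig.
  apply: (@le_trans _ _ (25 * (S0 + \sum_(j < n.+1) f j * (4 / 5) ^+ j))); last first.
    by rewrite ler_wpM2l// lerD2l.
  elim: n => [|n IH].
    by rewrite /A big_ord0 big_ord1 /s /= expr0; lra.
  rewrite big_ord_recr /= /A big_ord_recr/= -/(A n).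
  have : s n.+1 = 24 / 25 * s n + f n.+1 * (4 / 5) ^+ n.+1.
    by rewrite /s /= mulrDl exprS; congr (_ + _); field.
  lra.
pose p m := (2 / 3) ^+ m * S m.
have p0 m : 0 <= p m by rewrite mulr_ge0// exprn_ge0.
have ps m : p m = (5 / 6) ^+ m * s m.
  by rewrite /p /s mulrCA -exprMn mulrC (_ : 5 / 6 * (4 / 5) = 2 / 3)//; field.
pose T n := \sum_(m < n) p m.
have TS n : T n.+1 = T n + p n by rewrite /T big_ord_recr.
have Tmono n k : T n <= T (n + k)%N.
  elim: k => [|k IH]; first by rewrite addn0.
  by rewrite addnS TS (le_trans IH)// lerDl.
have Ttail n k : T (n + k)%N - T n <= (5 / 6) ^+ n * sig.
  apply: (@le_trans _ _ ((5 / 6) ^+ n * (A (n + k)%N - A n))).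
    elim: k => [|k IH]; first by rewrite addn0 !subrr mulr0.
    rewrite addnS TS /A big_ord_recr/= -/(A _).
    have : p (n + k)%N <= (5 / 6) ^+ n * s (n + k)%N.
      rewrite ps ler_wpM2r// exprD ler_piMr ?exprn_ge0// exprn_ile1//; lra.
    move: ((5 / 6) ^+ n) (s (n + k)%N) (A (n + k)%N) IH => x y z.
    rewrite mulrBr (_ : z + y - A n = z - A n + y); last by lra.
    by rewrite mulrDr mulrBr; lra.
  rewrite ler_wpM2l ?exprn_ge0//.
  have : 0 <= A n by apply: sumr_ge0.
  have := Asig (n + k)%N; have := s0 (n + k)%N; lra.
have Tb n : T n <= sig.
  by have := Ttail 0%N n; rewrite add0n /T big_ord0 subr0 expr0 mul1r.
pose Ts := sup (range T).
have hs : has_sup (range T).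
  by split; [exists (T 0%N), 0%N|exists sig => _ [n _ <-]].
have TTs n : T n <= Ts by apply: sup_upper_bound => //; exists n.
have Tsle x : (forall n, T n <= x) -> Ts <= x.
  by move=> Tx; apply: ge_sup; [exists (T 0%N), 0%N|move=> _ [n _ <-]].
have Tsle' j x : (forall k, T (j + k)%N <= x) -> Ts <= x.
  move=> Tx; apply: Tsle => n; have [jn|nj] := leqP j n.
    by rewrite -(subnKC jn).
  apply: le_trans (Tx 0%N); rewrite -(subnKC (ltnW nj)) addn0; exact: Tmono.
pose b j := (3 / 2) ^+ j * (Ts - T j).
have bS j : b j = S j + 2 / 3 * b j.+1.
  rewrite /b TS exprS /p.
  have : (3 / 2) ^+ j * (2 / 3) ^+ j = 1 :> R.
    by rewrite -exprMn (_ : 3 / 2 * (2 / 3) = 1) ?expr1n//; field.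
  move: ((3 / 2) ^+ j) ((2 / 3) ^+ j) => x y xy.
  have -> : x * (Ts - T j) = (x * y) * S j + x * (Ts - (T j + y * S j)) by ring.
  by rewrite xy; field.
have b0 j : 0 <= b j by rewrite mulr_ge0 ?exprn_ge0// subr_ge0.
exists b; split.
- have := bS 0%N; have := b0 1%N; have := f0 0%N; rewrite [S 0%N]/=; lra.
- move=> j; have := bS j; have := b0 j.+1; have := Sf j; lra.
- move=> j; apply/andP; split; last by have := bS j; have := Sp j; lra.
  have : 4 / 5 * (Ts - T j) <= Ts - T j.+1.
    suff : Ts <= T j + 5 / 4 * (Ts - T j.+1) by lra.
    apply: (Tsle' j) => k.
    suff : 4 / 5 * (T (j + k)%N - T j) <= T (j + k).+1 - T j.+1.
      by have := TTs (j + k).+1; lra.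
    elim: k => [|k IH]; first by rewrite addn0 !subrr mulr0.
    rewrite addnS (TS (j + k)%N) (TS (j + k).+1).
    have : 4 / 5 * p (j + k)%N <= p (j + k).+1.
      rewrite /p exprS /= mulrDr.
      have := exprn_ge0 (j + k) (divr_ge0 (ler0n R 2) (ler0n R 3)).
      move: (_ ^+ _) (f0 (j + k).+1) => z f1 z0.
      have : 0 <= 2 / 3 * z * f (j + k).+1 by rewrite !mulr_ge0.
      lra.
    lra.
  have := exprn_ge0 j (divr_ge0 (ler0n R 3) (ler0n R 2)).
  rewrite /b exprS; move: (_ ^+ _) => z z0 /(ler_wpM2l z0); lra.
- pose x j := b j * (4 / 5) ^+ j => n.
  have xS j : x j = s j + 5 / 6 * x j.+1.
    by rewrite /x /s exprS {1}bS; move: (_ ^+ _) => z; field.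
  have xsig j : x j <= sig.
    rewrite /x /b mulrAC -exprMn.
    have : Ts - T j <= (5 / 6) ^+ j * sig.
      rewrite lerBlDl; apply: (Tsle' j) => k; rewrite -lerBlDl; exact: Ttail.
    have -> : 3 / 2 * (4 / 5) = 6 / 5 :> R by field.
    have e : (6 / 5) ^+ j * (5 / 6) ^+ j = 1 :> R.
      by rewrite -exprMn (_ : 6 / 5 * (5 / 6) = 1) ?expr1n//; field.
    move=> /(ler_wpM2l (exprn_ge0 j (divr_ge0 (ler0n R 6) (ler0n R 5)))).
    by rewrite mulrA e mul1r.
  have : \sum_(j < n) x j <= 6 * A n + 5 * x n - 5 * x 0%N.
    elim: n => [|n IH]; first by rewrite /A !big_ord0; lra.
    rewrite big_ord_recr /A big_ord_recr/= -/(A n); have := xS n; lra.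
  have x0 : 0 <= x 0%N by rewrite mulr_ge0// exprn_ge0.
  have := xsig n; have := Asig n; have := s0 n; rewrite /sig; lra.
Qed.

End Scales.

(** * The scales t_j and b_j given by the Brjuno-Ruessmann integral *)

Section WeightScales.
Variable R : realType.
Implicit Types (L Psi : R -> R) (x y a v : R).

(** At x > 0 a neighbourhood of x lies in the half-line, so the restricted quotient is the ordinary
    one. *)
Lemma weight_is_derive L x : weight_function L -> 0 < x -> is_derive x 1 L (derive1 L x).
Proof.
move=> [_ _ dL _] x0; have /cvg_ex[a ca] := dL x (ltW x0).
suff da : is_derive x 1 L a by rewrite derive1E; apply: DeriveDef; [exact: ex_derive|].
apply/is_derive1_caratheodory; exists (fun z => if z == x then a else (L z - L x) / (z - x)).
split => [z||]; last by rewrite eqxx.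
  by case: eqVneq => [->|zx]; [rewrite !subrr mulr0|rewrite mulfVK// subr_eq0].
apply/cvgrPdist_lt => e e0; rewrite eqxx.
have /cvgrPdist_lt/(_ e e0) := ca; rewrite near_withinE => -[r /= r0 hr].
exists (Num.min r x) => /=; first by rewrite lt_min r0.
move=> z /=; rewrite lt_min => /andP[zr zx0].
have [zx|zx] := eqVneq z x; first by rewrite subrr normr0.
by apply: hr => //; move: zx0; rewrite ltr_norml => /andP[_]; lra.
Qed.

Lemma weight_lt L x y : weight_function L -> 0 <= x -> 0 <= y -> L x < L y -> x < y.
Proof.
move=> [_ iL _ _] x0 y0; rewrite !ltNge; apply: contra.
by rewrite le_eqVlt => /orP[/eqP->//|/(iL _ _ y0)/ltW].
Qed.

Lemma weight_gt0 L x : weight_function L -> 0 < x -> 0 < L x.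
Proof. by move=> [L0 iL _ _] x0; apply: le_lt_trans (L0 _ (lexx 0)) (iL _ _ (lexx 0) x0). Qed.

Lemma weight_level L a v : weight_function L -> 0 < a -> L a <= v ->
  (forall v, exists2 y, a <= y & v <= L y) -> exists2 t, a <= t & L t = v.
Proof.
move=> hL a0 av unb; have [y ay vy] := unb v.
have cL : {within `[a, y], continuous L}.
  apply: derivable_within_continuous => z; rewrite in_itv/= => /andP[az _].
  by apply: ex_derive; apply: weight_is_derive => //; exact: lt_le_trans az.
have [|t] := IVT ay cL (v := v); first by rewrite ge_min le_max av vy orbT.
by rewrite in_itv/= => /andP[at_ _] tv; exists t.
Qed.

(** Up to a shift of the index, Lambda(t_j) = (5/4)^j Lambda(y0). Then 1 / Lambda(t_j) - 1 /
    Lambda(t_(j+1)) is a fifth of 1 / Lambda(t_j), so the integral bounds the sum of ln Psi(t_j) /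
    Lambda(t_j), and b_j majorises ln Psi(t_(j+23)) / delta. The lag 23 serves the later steps:
    (5/4)^23 > 16 and subadditivity make t grow by 16 over 23 steps, and (6/5)^23 > 64 makes b grow
    by 64. *)
Lemma scales L Psi (Bmin delta eta : R) : weight_function L -> approximating_function Psi ->
  ln (Psi t) / L t @[t --> +oo] --> (0 : R) ->
  (exists2 a : R, 0 < a & (@lebesgue_measure R).-integrable `[a, +oo[
     (fun t => (derive1 L t * ln (Psi t) / L t ^+ 2)%:E)) ->
  0 < Bmin -> 0 < delta -> 0 < eta ->
  exists t b : nat -> R, [/\ Bmin <= b 0, forall j, 6 / 5 * b j <= b j.+1 <= 3 / 2 * b j,
     (forall j, 0 < t j) /\ forall j, t j <= t j.+1,
     forall j, 16 * t j <= t (j + 23)%N /\ ln (Psi (t (j + 23)%N)) <= delta * b j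
   & forall n, \sum_(j < n) b j / L (t j) <= eta].
Proof.
move=> hL hPsi lim0 [a a0 ig] B0 delta0 eta0.
have [L0 iL dL sL] := hL; have [iP dP xP sP] := hPsi.
have lnP0 c : 1 <= c -> 0 <= ln (Psi c).
  by move=> c1; rewrite ln_ge0// (le_trans c1)// xP// (le_trans _ c1).
(* Lambda is unbounded, since ln Psi is eventually below it and Psi(y) >= y. *)
have unb a1 : 0 < a1 -> forall v, exists2 y, a1 <= y & v <= L y.
  move=> a10 v; have /cvgrPdist_lt/(_ 1 ltr01) [M [_ HM]] := lim0.
  pose y := Num.max (M + 1) (Num.max a1 (expR v)); exists y; first by rewrite !le_max lexx orbT.
  have y0 : 0 < y by rewrite !lt_max a10 !orbT.
  have My : M < y by rewrite lt_max ltrDl ltr01.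
  have := HM y My; rewrite sub0r normrN => /(le_lt_trans (ler_norm _)).
  rewrite ltr_pdivrMr ?(weight_gt0 hL y0)// mul1r => /ltW; apply: le_trans.
  rewrite -[v]expRK ler_ln ?posrE ?expR_gt0//; last by rewrite (lt_le_trans y0)// xP// ltW.
  by rewrite (le_trans _ (xP _ (ltW y0)))// !le_max lexx !orbT.
pose a' := Num.max a 1.
have a'1 : 1 <= a' by rewrite le_max lexx orbT.
have aa' : a <= a' by rewrite le_max lexx.
have dL0 c : 0 < c -> 0 <= derive1 L c.
  move=> c0; apply: (@incr_derive1_ge0 _ L [set x | 0 < x]).
  - move=> x; rewrite inE => /interior_subset/= x0.
    by apply: ex_derive; exact: weight_is_derive.
  - by move=> x y; rewrite !inE/= => x0 y0; apply: iL; exact: ltW.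
  - by apply: open_nbhs_nbhs; split => //; exact: open_gt.
pose g t := derive1 L t * ln (Psi t) / L t ^+ 2.
have g0 c : a' <= c -> 0 <= g c.
  move=> ac; have c1 := le_trans a'1 ac; have c0 := lt_le_trans ltr01 c1.
  by rewrite /g divr_ge0 ?exprn_ge0 ?mulr_ge0 ?dL0 ?lnP0 ?L0// ltW.
have ig' : (@lebesgue_measure R).-integrable `[a', +oo[ (fun t => (g t)%:E).
  apply: integrableS ig => //; try exact: measurable_itv.
  by move=> t /=; rewrite !in_itv/= !andbT; exact: le_trans.
have [I [K [IK hI]]] := integrable_increment_bound g0 ig'.
have stepI u v : a' <= u -> u <= v -> ln (Psi u) * ((L u)^-1 - (L v)^-1) <= I v - I u.
  move=> au uv; have u1 := le_trans a'1 au.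
  have := hI u v (fun x => - ln (Psi u) * (L x)^-1) au uv.
  rewrite mulrBr !mulNr opprK addrC; apply => c /andP[uc cv].
  have c1 := le_trans u1 uc; have c0 := lt_le_trans ltr01 c1; have Lc := weight_gt0 hL c0.
  exists (- ln (Psi u) *: (- L c ^- 2 *: derive1 L c)).
    apply: is_deriveZ; apply: is_deriveV; last exact: weight_is_derive.
    by rewrite gt_eqF.
  have lnuc : ln (Psi u) <= ln (Psi c).
    have Pu : 0 < Psi u by rewrite (lt_le_trans _ (xP _ (le_trans ler01 u1)))// (lt_le_trans ltr01).
    have uc' : Psi u <= Psi c.
      move: uc; rewrite le_eqVlt => /orP[/eqP->//|/(iP _ _ (le_trans ler01 u1))/ltW//].
    by rewrite ler_ln ?posrE// (lt_le_trans Pu).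
  have := dL0 c c0; have : 0 <= (L c ^+ 2)^-1 by rewrite invr_ge0 exprn_ge0// ltW.
  rewrite /GRing.scale/= /g; move: (_^-1) (derive1 L c) (ln (Psi u)) (ln (Psi c)) lnuc.
  move=> z D p1 p2 p12 z0 D0; have := ler_wpM2r (mulr_ge0 D0 z0) p12; lra.
have [q23 [q0 q16 q23E]] : exists q : R, [/\ 0 < q, 16 < q & (5 / 4) ^+ 23 = q].
  by exists ((5 / 4) ^+ 23); split => //; rewrite ?exprn_gt0// !exprS expr0; lra.
(* 550 is twice the constant of [slow_majorant]: one half of [eta] is for [Bmin], the other for the
   sum. *)
have [k0 [k00 k0E]] : exists k : R, 0 < k /\ k = 550.
  by exists 550; split; [rewrite ltr0n|].
pose eta' := delta * eta / (k0 * q23).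
have eta'0 : 0 < eta' by apply: divr_gt0; exact: mulr_gt0.
have [y0 ay0 Vy0] := unb a' (lt_le_trans ltr01 a'1) (k0 * Bmin / eta).
have y00 : 0 < y0 by apply: lt_le_trans ay0; exact: lt_le_trans a'1.
have La0 := weight_gt0 hL y00.
have e0 j : 0 < (5 / 4 : R) ^+ j by rewrite exprn_gt0.
have lev j : exists t, y0 <= t /\ L t = (5 / 4) ^+ j * L y0.
  have [|t h1 h2] := weight_level hL y00 _ (unb y0 y00) (v := (5 / 4) ^+ j * L y0).
    by rewrite ler_peMl ?(ltW La0)// exprn_ege1//; lra.
  by exists t.
have [t ht] := choice lev.
have yt j : y0 <= t j by have [] := ht j.
have Lt j : L (t j) = (5 / 4) ^+ j * L y0 by have [] := ht j.
have t0 j : 0 < t j := lt_le_trans y00 (yt j).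
have at_ j : a' <= t j := le_trans ay0 (yt j).
have tm j : t j <= t j.+1.
  apply: ltW; apply: (weight_lt hL) => //; try exact: ltW.
  by rewrite !Lt ltr_pM2r// exprS ltr_pMl//; lra.
pose phi j := ln (Psi (t j)) / L (t j).
have phi0 j : 0 <= phi j.
  by rewrite divr_ge0 ?lnP0 ?(ltW (weight_gt0 hL (t0 j)))// (le_trans a'1).
pose Phi n := \sum_(j < n) phi j.
have PhiS n : Phi n.+1 = Phi n + phi n by rewrite /Phi big_ord_recr.
have PhiK n : Phi n <= 5 * K.
  apply: (@le_trans _ _ (5 * (I (t n) - I (t 0%N)))); last first.
    by have := IK _ (at_ n); have := IK _ (at_ 0%N); lra.
  elim: n => [|n IH]; first by rewrite /Phi big_ord0 subrr mulr0.
  rewrite PhiS; have := stepI _ _ (at_ n) (tm n).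
  have -> : (L (t n.+1))^-1 = 4 / 5 * (L (t n))^-1.
    by rewrite !Lt exprS; field; rewrite !gt_eqF.
  rewrite -/(phi n).
  have -> : ln (Psi (t n)) * ((L (t n))^-1 - 4 / 5 / L (t n)) = 1 / 5 * phi n.
    by rewrite /phi; move: (_^-1) (ln _) => z z'; field.
  lra.
have hs : has_sup (range Phi).
  by split; [exists (Phi 0%N), 0%N|exists (5 * K) => _ [n _ <-]].
(* Starting the scales at n0 makes the remaining sum as small as [delta] and [eta] require. *)
have [_ [n0 _ <-] Tn0] := sup_adherent eta'0 hs.
have tail n : \sum_(j < n) phi (n0 + (j + 23))%N <= eta'.
  have TPhi : Phi (n0 + (n + 23))%N <= sup (range Phi).
    by apply: sup_upper_bound => //; exists (n0 + (n + 23))%N.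
  suff : Phi n0 + \sum_(j < n) phi (n0 + (j + 23))%N <= Phi (n0 + (n + 23))%N by lra.
  elim: n {TPhi} => [|n IH].
    rewrite big_ord0 addr0 add0n; elim: 23%N => [|k IH]; first by rewrite addn0.
    by rewrite addnS PhiS (le_trans IH)// lerDl.
  have -> : (n0 + (n.+1 + 23) = (n0 + (n + 23)).+1)%N by rewrite addSn (addnS n0).
  by rewrite big_ord_recr/= PhiS addrA lerD2r.
pose La1 := L (t n0).
have La1E : La1 = (5 / 4) ^+ n0 * L y0 by exact: Lt.
have La10 : 0 < La1 by exact: weight_gt0.
have La1V : k0 * Bmin / eta <= La1.
  by apply: (le_trans Vy0); rewrite La1E ler_peMl ?(ltW La0)// exprn_ege1//; lra.
have Ltn j : L (t (n0 + j)%N) = (5 / 4) ^+ j * La1 by rewrite Lt La1E exprD; ring.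
pose f j := ln (Psi (t (n0 + (j + 23))%N)) / delta.
have f0 j : 0 <= f j by rewrite divr_ge0 ?(ltW delta0)// lnP0// (le_trans a'1).
have fphi j : f j * (4 / 5) ^+ j = La1 * q23 / delta * phi (n0 + (j + 23))%N.
  have e45 : (4 / 5) ^+ j = ((5 / 4) ^+ j)^-1 :> R by rewrite -exprVn invf_div.
  rewrite /f /phi Ltn exprD q23E e45; field.
  by rewrite !gt_eqF.
have fs n : \sum_(j < n) f j * (4 / 5) ^+ j <= La1 * q23 / delta * eta'.
  under eq_bigr do rewrite fphi.
  by rewrite -mulr_sumr ler_wpM2l// ?divr_ge0 ?mulr_ge0// ltW.
have [b [b0 fb bb bs]] := slow_majorant f0 (ltW B0) fs.
exists (fun j => t (n0 + j)%N), b; split => //.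
- by split=> j; rewrite ?addnS.
- move=> j; split; last by have := fb j; rewrite /f ler_pdivrMr// mulrC.
  have dbl x : 0 <= x -> L (2 * x) <= 2 * L x.
    by move=> x0; rewrite !mulr_natl !mulr2n; exact: sL.
  have tp := t0 (n0 + j)%N; have tp' := ltW tp.
  apply: ltW; apply: (weight_lt hL); rewrite ?mulr_ge0//; first exact: ltW.
  apply: (@le_lt_trans _ _ (16 * L (t (n0 + j)%N))).
    have -> : 16 * t (n0 + j)%N = 2 * (2 * (2 * (2 * t (n0 + j)%N))) by ring.
    have := dbl _ tp'; have := dbl _ (mulr_ge0 (ler0n R 2) tp').
    have := dbl _ (mulr_ge0 (ler0n R 2) (mulr_ge0 (ler0n R 2) tp')).
    have := dbl _ (mulr_ge0 (ler0n R 2) (mulr_ge0 (ler0n R 2) (mulr_ge0 (ler0n R 2) tp'))).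
    lra.
  have := weight_gt0 hL tp; rewrite !Ltn => Lp.
  rewrite exprD q23E mulrAC; move: Lp; move: (_ * La1) => z z0.
  by rewrite mulrC ltr_pM2l.
- move=> n; apply: (@le_trans _ _ (La1^-1 * \sum_(j < n) b j * (4 / 5) ^+ j)).
    rewrite mulr_sumr; apply: ler_sum => j _; rewrite Ltn invfM -exprVn invf_div.
    by rewrite mulrA mulrC.
  apply: (@le_trans _ _ (La1^-1 * (275 * (Bmin + La1 * q23 / delta * eta')))).
    by rewrite ler_wpM2l// invr_ge0 ltW.
  rewrite mulrC ler_pdivrMr//.
  have -> : La1 * q23 / delta * eta' = La1 * eta / k0 by rewrite /eta'; field; rewrite !gt_eqF.
  move: La1V; rewrite ler_pdivrMr// k0E; lra.
Qed.

End WeightScales.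

(** * Resonances and their removal by a rotation *)

Section Resonance.
Context {R : realType} {d : nat}.
Variables (omega : 'rV[R]_d) (L : R -> R) (A0 : 'M[R]_2) (F0 : 'rV[R]_d -> 'M[R]_2).
Variables (kappa s1 : R) (t b p r : nat -> R).
Implicit Types (x : 'rV[R]_d) (n m k : 'rV[int]_d) (j : nat) (A J : 'M[R]_2).
Implicit Types (psi Ab F Z : 'rV[R]_d -> 'M[R]_2).

(* The error of step [j] has size [expR (- b j)] and the frequencies treated there are at most
   [t j / 8]; the small divisors and the frames cost powers of [expR (p j)]. *)
Record kam_scales : Prop := KamScales {
  ks_L : weight_function L;
  ks_s : 0 < s1;
  ks_r : forall j, s1 <= r j;
  ks_rS : forall j, r j.+1 <= r j;
  ks_b : forall j, 6 / 5 * b j <= b j.+1 <= 3 / 2 * b j;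
  ks_p : forall j, b j = 100 * (1000 * p j);
  ks_b0 : [/\ 0 <= b 0, 100 <= expR (p 0), mnorm A0 + 1 <= expR (p 0)
    & kappa^-1 <= expR (p 0)];
  ks_kappa : 0 < kappa < 1;
  ks_t : forall j, [/\ 0 < t j, t j <= t j.+1 & 16 * t j <= t (j + 23)%N];
  ks_div : forall j k, k != 0 -> norm1 (rvint k : 'rV[R]_d) <= t (j + 23)%N ->
    expR (- (2 * p j)) <= `|phase 1 k omega|;
  ks_high : forall j k, t j / 8 < norm1 (rvint k : 'rV[R]_d) ->
    wt L 1 (r j.+1) k <= expR (- (3 / 2 * b j)) * wt L 1 (r j) k }.

Hypothesis ks : kam_scales.

Lemma ks_b_mono i j : (i <= j)%N -> b i <= b j.
Proof.
have b0 j' : 0 <= b j'.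
  elim: j' => [|j' IH]; first by have [] := ks_b0 ks.
  have := ks_b ks j'; lra.
move=> /subnKC <-; elim: (j - i)%N => [|k IH]; first by rewrite addn0.
rewrite addnS; have := ks_b ks (i + k); have := b0 (i + k)%N; lra.
Qed.

Lemma ks_b_ge0 j : 0 <= b j.
Proof. by have [h _ _ _] := ks_b0 ks; exact: le_trans h (ks_b_mono (leq0n j)). Qed.

Lemma ks_t_mono i j : (i <= j)%N -> t i <= t j.
Proof.
move=> /subnKC <-; elim: (j - i)%N => [|k IH]; first by rewrite addn0.
by rewrite addnS (le_trans IH)//; have [] := ks_t ks (i + k).
Qed.

Lemma ks_const j : [/\ 100 <= expR (p j), mnorm A0 + 1 <= expR (p j)
  & kappa^-1 <= expR (p j)].
Proof.
have [_ h1 h2 h3] := ks_b0 ks.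
have h : expR (p 0) <= expR (p j).
  by rewrite ler_expR; have := ks_b_mono (leq0n j); have := ks_p ks 0; have := ks_p ks j; lra.
by split; apply: le_trans h.
Qed.

Lemma ks_gap i j : (i + 23 <= j)%N -> 64 * b i <= b j /\ 16 * t i <= t j.
Proof.
move=> ij; split; last first.
  by have [_ _ h] := ks_t ks i; apply: (le_trans h); exact: ks_t_mono.
apply: le_trans (ks_b_mono ij).
have e l : (6 / 5) ^+ l * b i <= b (i + l)%N.
  elim: l => [|l IH]; first by rewrite expr0 mul1r addn0.
  rewrite addnS exprS -mulrA; have := ks_b ks (i + l); lra.
apply: le_trans (e 23%N); rewrite ler_wpM2r ?ks_b_ge0//.
by rewrite !exprS expr0; lra.
Qed.

Lemma expR_sum_le (x y u v z : R) : x <= expR u -> y <= expR u -> 2 <= expR v -> u + v <= z ->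
  x + y <= expR z.
Proof.
move=> xu yu v2 uvz; apply: (@le_trans _ _ (expR (u + v))); last by rewrite ler_expR.
rewrite expRD; have := expR_gt0 u; move: (expR u) (expR v) xu yu v2 => y1 y2 xu yu v2 y0.
have := ler_wpM2l (ltW y0) v2; lra.
Qed.

Lemma expR_mul_le (x y u v z : R) : 0 <= x -> 0 <= y -> x <= expR u -> y <= expR v ->
  u + v <= z -> x * y <= expR z.
Proof.
move=> x0 y0 xu yv uvz; apply: (@le_trans _ _ (expR (u + v))); last by rewrite ler_expR.
by rewrite expRD ler_pM.
Qed.

(** Half-integer frequencies enter the frames only through a sign under unit translations, so
    conjugation by P gives 1-periodic functions, to which [bnd21] applies. *)
Definition half_periodic (P : 'rV[R]_d -> 'M[R]_2) := forall i,
  (forall x, P (x + ustep i) = P x) \/ (forall x, P (x + ustep i) = - P x).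

Lemma half_periodicM P Q : half_periodic P -> half_periodic Q ->
  half_periodic (fun x => P x * Q x).
Proof.
move=> hP hQ i; have [hp|hp] := hP i; have [hq|hq] := hQ i; [left|right|right|left] => x;
  by rewrite hp hq ?mulrN ?mulNr ?opprK.
Qed.

Lemma half_periodic_adj2 P : half_periodic P -> half_periodic (fun x => adj2 (P x)).
Proof.
move=> hP i; have [hp|hp] := hP i; [left|right] => x; rewrite hp//.
by rewrite -scaleN1r adj2Z scaleN1r.
Qed.

Lemma half_periodic_rot J n : half_periodic (rot J n).
Proof.
move=> i; have e f : rot J n (f + ustep i) = (if (2 %| n 0%R i)%Z then 1 else -1) *: rot J n f.
  rewrite /rot -!trig_cos -!trig_sin !trig_ustep scalerDr !scalerA.
  by [].
case: ifP e => _ e; [left|right] => x; rewrite e ?scale1r//.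
by rewrite scaleN1r.
Qed.

Lemma half_periodic_conj P (K : 'M[R]_2) : half_periodic P ->
  forall x i, P (x + ustep i) * K * adj2 (P (x + ustep i)) = P x * K * adj2 (P x).
Proof.
move=> hP x i; have [hp|hp] := hP i; rewrite hp//.
have -> : adj2 (- P x) = - adj2 (P x) by rewrite -scaleN1r adj2Z scaleN1r.
by rewrite mulrN !mulNr opprK.
Qed.

Lemma rot_comm J n x : J * rot J n x = rot J n x * J.
Proof. by rewrite /rot mulrDr mulrDl -!scalerAr -!scalerAl mulr1 mul1r. Qed.

Lemma half_phase n : phase 2 n omega = phase 1 n omega / 2.
Proof. by rewrite phase12; field. Qed.

(** A budget increasing with j, like [zbound]: the difference of two consecutive values exceeds the
    contribution of a step, so the bounds are uniform in j. *)
Definition abound j := mnorm A0 + 1 - expR (- (b j / 2)).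
Definition zbound j := expR (- (97 / 100 * b 0)) - expR (- (97 / 100 * b j)).

(** On the wide strip [psi] itself has no bound; only its conjugates do, that of A by [abound] and
    those of constants by the frame. *)
Record reduced j psi A Ab F Z (M C : R) : Prop := Reduced {
  rd_det : forall x, \det (psi x) = 1;
  rd_half : half_periodic psi;
  rd_trA : \tr A = 0;
  rd_trAb : forall x, \tr (Ab x) = 0;
  rd_trF : forall x, \tr (F x) = 0;
  rd_dpsi : forall x, dM omega psi (Ab x * psi x - psi x * A) x;
  rd_detZ : forall x, \det (Z x) = 1;
  rd_dZ : forall x, dM omega Z ((A0 + F0 x) * Z x - Z x * (Ab x + F x)) x;
  rd_Ab : exists y, bnd 1 (wt L 1 (r j)) Ab y;
  rd_F : bnd 1 (wt L 1 (r j)) F (expR (- b j));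
  rd_Z : bnd 1 (wt L 1 (r j)) (fun x => Z x - 1) (zbound j);
  rd_A : bnd 1 (wt L 1 (r j)) (fun x => psi x * A * adj2 (psi x)) (abound j);
  rd_M : 0 <= M;
  rd_C : 0 <= C;
  rd_frame : frame psi (wt L 1 (r j)) M C }.

Lemma ks_weight j : weight (wt L 1 (r j) : 'rV[int]_d -> R).
Proof. by apply: (wt_weight (ks_L ks)); apply: le_trans (ks_r ks j); exact: ltW (ks_s ks). Qed.

Lemma abound_le j : abound j <= expR (p j).
Proof.
have [_ h _] := ks_const j; apply: le_trans h.
by rewrite /abound gerBl// ltW// expR_gt0.
Qed.

Definition resonant j A m := `|4 * \det A - phase 1 m omega ^+ 2| < expR (- (b j / 100)).

(** The square of the phase is at least exp(-4 p j), far above the resonance threshold exp(-1000 p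
    j). Hence det A > 0: A is elliptic with eigenvalues i alpha and - i alpha, and alpha is close to
    half the phase. *)
Lemma resonance_eigenvalue j A m : m != 0 -> norm1 (rvint m : 'rV[R]_d) <= t (j + 23)%N ->
  resonant j A m -> exists alpha : R, [/\ 0 < alpha, alpha ^+ 2 = \det A,
    expR (- (5 / 2 * p j)) <= alpha,
    `|alpha - `|phase 1 m omega| / 2| <= alpha
    & (alpha - `|phase 1 m omega| / 2) ^+ 2 <= expR (- (b j / 100))].
Proof.
move=> m0 mt hres; have mu0 := ks_div ks m0 mt.
move: hres; rewrite /resonant -(real_normK (num_real (phase 1 m omega))).
move: mu0; move: (`|phase 1 m omega|) => mu mue hX.
have e0 := expR_gt0 (- (2 * p j)); have mu0 : 0 < mu by exact: lt_le_trans mue.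
have [c1000 _ _] := ks_const j; have bj := ks_b_ge0 j; have bp := ks_p ks j.
have mu2 : expR (- (4 * p j)) <= mu ^+ 2.
  have -> : - (4 * p j) = - (2 * p j) + - (2 * p j) by lra.
  by rewrite expRD expr2; apply: ler_pM => //; exact: ltW.
have X8 : 8 * expR (- (b j / 100)) <= mu ^+ 2.
  apply: le_trans mu2.
  apply: (@expR_mul_le _ _ (p j) (- (b j / 100))) => //; rewrite ?expR_ge0//; lra.
have D0 : mu ^+ 2 / 8 <= \det A.
  by move: hX X8; rewrite ltr_norml => /andP[]; lra.
have mu20 : 0 < mu ^+ 2 by rewrite exprn_gt0.
pose al := Num.sqrt (\det A).
have al2 : al ^+ 2 = \det A by rewrite sqr_sqrtr//; lra.
have al0 : 0 < al by rewrite sqrtr_gt0; lra.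
have al3 : mu / 3 <= al.
  rewrite -(@ler_pXn2r _ 2)// ?nnegrE ?divr_ge0 ?(ltW mu0) ?(ltW al0)//.
  by rewrite al2 expr_div_n; move: mu20 D0; lra.
exists al; split => //.
- apply: le_trans al3; rewrite ler_pdivlMr//; apply: le_trans mue.
  rewrite mulrC; apply: (@expR_mul_le _ _ (p j / 2) (- (5 / 2 * p j))) => //.
  + rewrite -(@ler_pXn2r _ 2)// ?nnegrE ?expR_ge0//.
    have -> : expR (p j / 2) ^+ 2 = expR (p j) by rewrite expr2 -expRD; congr expR; lra.
    by rewrite expr2; lra.
  + lra.
- rewrite ler_norml; apply/andP; split; lra.
- have dif : `|2 * al - mu| * mu <= expR (- (b j / 100)).
    apply: (@le_trans _ _ `|4 * \det A - mu ^+ 2|); last exact: ltW.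
    have -> : 4 * \det A - mu ^+ 2 = (2 * al - mu) * (2 * al + mu) by rewrite -al2; ring.
    rewrite normrM ler_wpM2l// ler_normr; apply/orP; left; lra.
  have := expR_ge0 (- (b j / 100)); move: (expR (- (b j / 100))) dif X8 => X dif X8 X0.
  have -> : (al - mu / 2) ^+ 2 = (2 * al - mu) ^+ 2 / 4 by field.
  rewrite -(real_normK (num_real (2 * al - mu))).
  move: (normr_ge0 (2 * al - mu)); move: (`|2 * al - mu|) dif => D dif D0'.
  have : (D * mu) * (D * mu) <= X * X by rewrite ler_pM// mulr_ge0// ltW.
  have -> : D * mu * (D * mu) = D ^+ 2 * mu ^+ 2 by ring.
  have := ler_wpM2r X0 X8.
  have [X00|] := ltP 0 X; last first.
    move=> XX; have X00 : X = 0 by apply/eqP; rewrite eq_le XX.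
    rewrite X00 mulr0 => _ h; suff -> : D ^+ 2 = 0 by rewrite mul0r.
    by apply/eqP; rewrite eq_le sqr_ge0 andbT; move: h; rewrite mulr0 pmulr_lle0.
  move=> h1 h2; have h3 : D ^+ 2 * (8 * X) <= X * X.
    by apply: le_trans h2; rewrite ler_wpM2l ?sqr_ge0.
  have : D ^+ 2 * 8 <= X by rewrite -(ler_pM2r X00) -mulrA.
  have := sqr_ge0 D; lra.
Qed.

(** As A = alpha J commutes with the rotation, the new constant is c J with |c| <= alpha, so the
    bound on the conjugate of A survives although [psi] may become much larger. J costs exp(7/2 p j)
    in the original coordinates, so [frame_rot] multiplies the frame constant by 3 exp(21/2 p j). *)
Lemma rotate_resonance j psi A Ab F Z M C m : reduced j psi A Ab F Z M C -> m != 0 ->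
  norm1 (rvint m : 'rV[R]_d) <= t j / 8 + M -> M <= t j / 64 -> C <= expR (p j) ->
  resonant j A m ->
  exists (alpha c : R) (J : 'M[R]_2) m' M', [/\ 0 < alpha, A = alpha *: J, cstruct J,
    expR (- (5 / 2 * p j)) <= alpha
    & [/\ 0 <= \det (c *: J) <= expR (- (b j / 100)), M' <= t j / 4, m' != 0 &
      reduced j (fun x => psi x * rot J m' x) (c *: J) Ab F Z M' (expR (20 * p j))]].
Proof.
move=> rd m0 mM Mt Cp hres.
have [tj0 tS t16] := ks_t ks j; have t23 : t j <= t (j + 23)%N by exact: ks_t_mono (leq_addr _ _).
have [|alpha [al0 al2 ale cal c2]] := resonance_eigenvalue m0 _ hres; first by lra.
pose mu := phase 1 m omega; pose c := alpha - `|mu| / 2.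
(* The sign of m is chosen so that the rotation subtracts from alpha. *)
pose m' := if 0 <= mu then m else - m.
have mum' : phase 2 m' omega = `|mu| / 2.
  rewrite half_phase /m'; case: lerP => mu0; first by rewrite ger0_norm.
  by rewrite phaseN ltr0_norm.
have nm' : norm1 (rvint m' : 'rV[R]_d) = norm1 (rvint m : 'rV[R]_d).
  rewrite /m'; case: ifP => // _; rewrite -[RHS]norm1N; congr norm1.
  by apply/matrixP => i k; rewrite !mxE rmorphN.
pose J := alpha^-1 *: A.
have AJ : A = alpha *: J by rewrite scalerA mulfV ?scale1r// gt_eqF.
have hJ : cstruct J.
  split; first by rewrite mxtraceZ (rd_trA rd) mulr0.
  by rewrite detZ exprVn al2 mulVf// -al2 gt_eqF// exprn_gt0.
have wW := ks_weight j; have [c100 _ _] := ks_const j; have bp := ks_p ks j.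
have bj := ks_b_ge0 j; have pj : 0 <= p j by lra.
have bJ : bnd 1 (wt L 1 (r j)) (fun x => psi x * J * adj2 (psi x)) (expR (7 / 2 * p j)).
  apply: (bnd_le _ (bnd_ext _ (bndZ wW alpha^-1 (rd_A rd)))) => [|x]; last first.
    by rewrite /J -scalerAr -scalerAl.
  rewrite gtr0_norm ?invr_gt0//.
  apply: (@expR_mul_le _ _ (5 / 2 * p j) (p j)); rewrite ?invr_ge0 ?(ltW al0)//.
  - exact: bnd_ge0 (rd_A rd).
  - by rewrite -[expR _]invrK -expRN lef_pV2 ?posrE ?expR_gt0.
  - exact: abound_le.
  - lra.
have J1 : 1 <= expR (7 / 2 * p j) by apply: le_trans (expR_ge1Dx _); lra.
have rJ : (fun x => psi x * rot J m' x * (c *: J) * adj2 (psi x * rot J m' x)) =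
    (fun x => c *: (psi x * J * adj2 (psi x))).
  apply/funext => x; rewrite -scalerAr -scalerAl; congr (_ *: _).
  rewrite adj2M (adj2_rot _ _ hJ) -[psi x * _ * J]mulrA -rot_comm !mulrA.
  by rewrite -[psi x * J * _ * _]mulrA rotVr// mulr1.
exists alpha, c, J, m', (M + norm1 (rvint m' : 'rV[R]_d)); split => //; split.
- by rewrite detZ (proj2 hJ) mulr1 sqr_ge0.
- by rewrite nm'; lra.
- by rewrite /m'; case: ifP; rewrite ?oppr_eq0.
- split; try by [apply: (rd_trAb rd)|apply: (rd_trF rd)|apply: (rd_detZ rd)|apply: (rd_dZ rd)|
    apply: (rd_Ab rd)|apply: (rd_F rd)|apply: (rd_Z rd)].
  + by move=> x; apply: det1M; [exact: rd_det rd x|exact: det_rot].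
  + by apply: half_periodicM; [exact: rd_half rd|exact: half_periodic_rot].
  + by rewrite mxtraceZ (proj1 hJ) mulr0.
  + move=> x; apply: (dM_eq (dMM (rd_dpsi rd x) (dM_rot omega m' x hJ))).
    rewrite mum' AJ /c; have := rot_comm J m' x; move: (rot J m' x) (psi x) (Ab x) => ro P K ho.
    have -> : P * ro * ((alpha - `|mu| / 2) *: J) = (alpha - `|mu| / 2) *: (P * (J * ro)).
      by rewrite -scalerAr -mulrA -ho.
    have -> : (K * P - P * (alpha *: J)) * ro = K * (P * ro) - alpha *: (P * (J * ro)).
      by rewrite mulrBl -scalerAr -scalerAl -!mulrA.
    by rewrite -scalerAr scalerBl opprB addrAC addrA.
  + apply: (bnd_le _ (bnd_ext _ (bndZ wW (c / alpha) (rd_A rd)))) => [|x].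
      rewrite -[leRHS]mul1r ler_wpM2r//; first exact: bnd_ge0 (rd_A rd).
      by rewrite normrM normfV (gtr0_norm al0) ler_pdivrMr// mul1r.
    rewrite (congr1 (@^~ x) rJ) {1}AJ -scalerAr -scalerAl scalerA mulfVK// gt_eqF//.
  + by rewrite addr_ge0 ?(rd_M rd)// norm1_ge0.
  + exact: expR_ge0.
  + apply: (frame_le wW); last exact: frame_rot wW hJ (rd_det rd) J1 bJ (rd_frame rd).
      by rewrite addr_ge0 ?(rd_M rd)// norm1_ge0.
    apply: (@expR_mul_le _ _ (p j + 21 / 2 * p j) (p j)); rewrite ?(rd_C rd)//; last by lra.
    apply: (@expR_mul_le _ _ (p j) (21 / 2 * p j)); rewrite ?exprn_ge0 ?expR_ge0//.
      by apply: le_trans c100; lra.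
    rewrite -expRM_natl ler_expR mulr_natl; lra.
Qed.

End Resonance.

(** * The nonresonant step *)

Section ReducedStep.
Context {R : realType} {d : nat}.
Variables (omega : 'rV[R]_d) (L : R -> R) (A0 : 'M[R]_2) (F0 : 'rV[R]_d -> 'M[R]_2).
Variables (kappa s1 : R) (t b p r : nat -> R).
Implicit Types (x : 'rV[R]_d) (n m k : 'rV[int]_d) (j : nat) (A J : 'M[R]_2).
Implicit Types (psi Ab F Z : 'rV[R]_d -> 'M[R]_2).

Hypothesis ks : @kam_scales R d omega L A0 kappa s1 t b p r.

Local Notation reduced := (reduced omega L A0 F0 b r).

(** One unit [p j] in the exponent absorbs a factor 100, which takes care of numerical constants. *)
Lemma expR_shrink j (x y : R) : x + p j <= y -> 100 * expR x <= expR y.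
Proof.
move=> xy; have [c _ _] := ks_const ks j; rewrite -ler_expR in xy.
apply: le_trans xy; rewrite expRD mulrC ler_wpM2l// expR_ge0.
Qed.

Lemma ks_bounds j : [/\ 0 <= p j, b j = 100 * (1000 * p j) & 6 / 5 * b j <= b j.+1 <= 3 / 2 * b j].
Proof.
have h := ks_p ks j; split=> //; last exact: ks_b ks j.
have := ks_b_ge0 ks j; lra.
Qed.

Lemma nonresonant_divisors j A M : M <= t j / 4 ->
  (forall m, m != 0 -> norm1 (rvint m : 'rV[R]_d) <= t j / 8 + M -> ~~ resonant omega b j A m) ->
  divisors omega A (expR (2 * p j)) (expR (b j / 100)) (t j / 8 + M).
Proof.
move=> Mt hres k k0 kM; have [tj0 _ t16] := ks_t ks j.
have h1 : expR (- (2 * p j)) <= `|phase 1 k omega|.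
  apply: (ks_div ks k0); apply: (le_trans kM); lra.
have h2 : expR (- (b j / 100)) <= `|4 * \det A - phase 1 k omega ^+ 2|.
  by have := hres k k0 kM; rewrite /resonant -leNgt.
have n1 : 0 < `|phase 1 k omega| := lt_le_trans (expR_gt0 _) h1.
have n2 : 0 < `|4 * \det A - phase 1 k omega ^+ 2| := lt_le_trans (expR_gt0 _) h2.
split; first by rewrite -normr_gt0.
- by rewrite -normr_gt0.
- by rewrite normfV -[expR _]invrK -expRN lef_pV2 ?posrE ?expR_gt0.
- by rewrite normfV -[expR _]invrK -expRN lef_pV2 ?posrE ?expR_gt0.
Qed.

Lemma wt_step j k : wt L 1 (r j.+1) k <= wt L 1 (r j) (k : 'rV[int]_d).
Proof. exact: (wt_le (ks_L ks) 1 k (ks_rS ks j)). Qed.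

(** The divisors cost exp(b j / 100 + 6 p j) and the frame exp(20 p j), so the correction is below
    exp(- 98/100 b j). The quadratic error, of order exp(- 196/100 b j), and the discarded
    frequencies, of order exp(- 5/2 b j), fit into exp(- b j.+1) because b grows by at most 3/2. *)
Lemma reduced_step j psi A Ab F Z M C : reduced j psi A Ab F Z M C ->
  M <= t j / 4 -> C <= expR (20 * p j) ->
  (forall m, m != 0 -> norm1 (rvint m : 'rV[R]_d) <= t j / 8 + M -> ~~ resonant omega b j A m) ->
  exists B Ab' F' Z' G, [/\ reduced j.+1 psi (A + B) Ab' F' Z' M C,
    `|\det (A + B) - \det A| <= expR (- (b j / 2)),
    bnd 1 (wt L 1 (r j)) G (expR (- b j)) & mean (fun x => adj2 (psi x) * G x * psi x) B].
Proof.
move=> rd Mt CE hres.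
have wW := ks_weight ks (j : nat); have wW' := ks_weight ks j.+1.
have [pj bp bb] := ks_bounds j; have [c100 _ _] := ks_const ks j.
have sh := @expR_shrink j.
have ab0 := bnd_ge0 (rd_A rd); have abE := abound_le ks j; have C0 := rd_C rd.
pose Dv := expR (b j / 100 + 6 * p j); pose eps := expR (- b j).
have Dvh : expR (2 * p j) + 2 * abound A0 b j * expR (b j / 100) +
    4 * abound A0 b j ^+ 2 * (expR (2 * p j) * expR (b j / 100)) <= Dv.
  have h1 : expR (2 * p j) <= expR (b j / 100 + 4 * p j) by rewrite ler_expR; clear -ks pj bp bb; lra.
  have h2 : abound A0 b j * expR (b j / 100) <= expR (b j / 100 + 4 * p j).
    apply: (expR_mul_le _ _ abE (lexx _)); rewrite ?expR_ge0//; lra.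
  have h3 : abound A0 b j ^+ 2 * (expR (2 * p j) * expR (b j / 100)) <= expR (b j / 100 + 4 * p j).
    rewrite -expRD; apply: (expR_mul_le (u := 2 * p j) _ _ _ (lexx _)); rewrite ?expR_ge0 ?sqr_ge0//.
      by rewrite expRM_natl !expr2 ler_pM.
    lra.
  have := sh (b j / 100 + 4 * p j) Dv.
  have := sh (b j / 100 + 4 * p j) (b j / 100 + 6 * p j) ltac:(clear -ks pj bp bb; lra).
  have := expR_ge0 (b j / 100 + 4 * p j); rewrite /Dv; lra.
have Ceps : 2 * C * eps <= expR (- b j + 21 * p j).
  have : C * eps <= expR (- b j + 20 * p j) by apply: (expR_mul_le _ _ CE (lexx _)); rewrite ?expR_ge0//; lra.
  have := sh (- b j + 20 * p j) (- b j + 21 * p j) ltac:(clear -ks pj bp bb; lra).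
  have := expR_ge0 (- b j + 20 * p j); rewrite -mulrA; lra.
have Ceps0 : 0 <= 2 * C * eps by rewrite !mulr_ge0// expR_ge0.
pose y := Dv * (2 * C * eps).
have y0 : 0 <= y by rewrite mulr_ge0// expR_ge0.
have yE : y <= expR (- (98 / 100 * b j)).
  by apply: (expR_mul_le _ _ (lexx _) Ceps); rewrite ?expR_ge0//; lra.
have small (z : R) : z <= - p j -> 100 * expR z <= 1.
  by move=> h; rewrite -[leRHS]expR0; apply: sh; lra.
have y2 : y <= 2^-1 by have := small (- (98 / 100 * b j)) ltac:(clear -ks pj bp bb; lra); lra.
have [B [Q [F' [G [[trB bB bG mG] [dQ bQ bQ'] trF' bF' dQ1]]]]] :=
  kam_step wW wW' (wt_step j) (expR_gt0 _) (expR_gt0 _) (ks_high ks (j := j)) (rd_det rd)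
    (rd_trA rd) (rd_trAb rd) (rd_trF rd) (rd_dpsi rd) (rd_A rd) (rd_frame rd) C0
    (expR_ge0 _) (expR_ge0 _) (nonresonant_divisors Mt hres) Dvh (rd_F rd) y2.
pose E x := psi x * B * adj2 (psi x).
have Epsi x : E x * psi x = psi x * B by rewrite /E -mulrA adj2_det1l ?mulr1// (rd_det rd).
exists B, (fun x => Ab x + E x), F', (fun x => Z x * Q x), G.
have wle F1 z : bnd 1 (wt L 1 (r j)) F1 z -> bnd 1 (wt L 1 (r j.+1)) F1 z := bnd_wle (wt_step j).
split => //; last first.
  (* The determinants are compared after conjugation, where A and B have bounds. *)
  have dc X : \det (psi 0 * X * adj2 (psi 0)) = \det X.
    by rewrite !det_mulmx det_adj2 (rd_det rd) mul1r mulr1.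
  rewrite -(dc (A + B)) -(dc A) mulrDr mulrDl; apply: (le_trans (det2D _ _)).
  have := mnorm_bnd wW 0 bB; have := mnorm_bnd wW 0 (rd_A rd).
  move: (psi 0 * A * _) (psi 0 * B * _) => X Y hX hY.
  have h1 := mnorm_ge0 X; have h2 := mnorm_ge0 Y.
  apply: (expR_mul_le (u := - b j + 21 * p j) (v := 2 * p j)) => //; rewrite ?addr_ge0//.
  - exact: le_trans hY _.
  - apply: (expR_sum_le (u := p j) (v := p j)); first exact: le_trans abE.
    + apply: (le_trans hY); apply: (le_trans Ceps); rewrite ler_expR; clear -ks pj bp bb; lra.
    + by clear -ks c100; lra.
    + by clear -ks pj bp bb; lra.
  - by clear -ks pj bp bb; lra.
split; try by [exact: (rd_det rd)|exact: (rd_half rd)|exact: (rd_M rd)|exact: (rd_C rd)].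
- by rewrite mxtraceD (rd_trA rd) trB addr0.
- by move=> x; rewrite mxtraceD (rd_trAb rd) tr_conj ?trB ?addr0// (rd_det rd).
- exact: trF'.
- move=> x; apply: (dM_eq (rd_dpsi rd x)).
  by rewrite mulrDl Epsi mulrDr opprD addrACA subrr addr0.
- by move=> x; apply: det1M; [exact: rd_detZ rd x|exact: dQ].
- move=> x; apply: (dM_eq (dMM (rd_dZ rd x) (dQ1 x))).
  move: (Z x) (Q x) (A0 + F0 x) (Ab x + F x) (Ab x + E x + F' x) => z q a u v.
  by rewrite mulrBl mulrBr !mulrA addrA subrK.
- have [y1 hy1] := rd_Ab rd; exists (y1 + 2 * C * eps).
  exact: bndD (wle _ _ hy1) (wle _ _ bB).
- apply: (bnd_le _ bF').
  have i1 : expR (- (3 / 2 * b j)) * eps = expR (- (5 / 2 * b j)) by rewrite -expRD; congr expR; clear -ks; lra.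
  have i2 : (1 + 2 * C) * eps * y <= expR (- (196 / 100 * b j)).
    apply: (expR_mul_le (u := - b j + 22 * p j) _ y0 _ yE); last by clear -ks pj bp bb; lra.
      by rewrite mulr_ge0 ?expR_ge0//; clear -ks C0; lra.
    apply: (expR_mul_le (u := 22 * p j) _ _ _ (lexx _)); rewrite ?expR_ge0//; first (by clear -ks C0; lra); last by clear -ks pj bp bb; lra.
    have := sh (20 * p j) (22 * p j) ltac:(clear -ks pj bp bb; lra).
    have : 1 <= expR (20 * p j) by apply: le_trans (expR_ge1Dx _); clear -ks pj; lra.
    by move: CE; clear -ks; lra.
  have e3 (u v : R) : 2 * u * eps * v = 2 * (u * eps * v) by rewrite !mulrA.
  rewrite i1 -/eps -/y e3; move: i2; move: ((1 + 2 * C) * eps * y) => q i2; clear -ks i2 sh bb bp pj.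
  have := sh (- (5 / 2 * b j)) (- b j.+1) ltac:(clear -ks pj bp bb; lra).
  have := sh (- (196 / 100 * b j)) (- b j.+1) ltac:(clear -ks pj bp bb; lra).
  have := expR_ge0 (- (5 / 2 * b j)); have := expR_ge0 (- (196 / 100 * b j)).
  lra.
- have zb0 : 0 <= zbound b j := bnd_ge0 (rd_Z rd).
  have zb1 : zbound b j <= 1.
    rewrite /zbound; have := expR_ge0 (- (97 / 100 * b j)).
    have : expR (- (97 / 100 * b 0)) <= 1.
      by rewrite -[leRHS]expR0 ler_expR; have := ks_b_ge0 ks 0; lra.
    lra.
  have bZ : bnd 1 (wt L 1 (r j.+1)) Z 3.
    apply: (bnd_le _ (bnd_ext _ (bndD (wle _ _ (rd_Z rd)) (bnd_cst 1 wW' 1)))) => [|x].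
      rewrite mnorm1; lra.
    by rewrite subrK.
  apply: (bnd_le _ (bnd_ext _ (bndD (wle _ _ (rd_Z rd)) (bndM wW' bZ bQ)))) => [|x].
    have h1 := sh (- (98 / 100 * b j)) (- (97 / 100 * b j)) ltac:(clear -ks pj bp bb; lra).
    have h2 := sh (- (97 / 100 * b j.+1)) (- (97 / 100 * b j)) ltac:(clear -ks pj bp bb; lra).
    have := expR_ge0 (- (97 / 100 * b j)).
    rewrite /zbound -/eps -/Dv -/y; move: zb0 zb1 y0 yE; rewrite /zbound; clear -ks h1 h2; nra.
  by rewrite mulrBr mulr1 addrC addrA subrK.
- apply: (bnd_le _ (bnd_ext _ (bndD (wle _ _ (rd_A rd)) (wle _ _ bB)))) => [|x]; last first.
    by rewrite mulrDr mulrDl.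
  have h1 := sh (- b j + 21 * p j) (- (b j / 2)) ltac:(clear -ks pj bp bb; lra).
  have h2 := sh (- (b j.+1 / 2)) (- (b j / 2)) ltac:(clear -ks pj bp bb; lra).
  have := expR_ge0 (- (b j / 2)); rewrite /abound; move: Ceps; rewrite /eps; clear -ks h1 h2; lra.
- move=> c; have := rd_frame rd c; move: (fun _ => _) (C * _) => G1 z.
  elim=> [k U V z1 k1 hk|G2 H z1 z2 _ h1 _ h2|G2 H z1 e _ h1].
  + by apply: fdec_atom => // phi; exact: wle.
  + exact: fdec_add.
  + exact: fdec_ext e h1.
Qed.

End ReducedStep.

(** * The splitting of the frame and the treatment of resonances *)

Section Output.
Context {R : realType} {d : nat}.
Variables (omega : 'rV[R]_d) (L : R -> R) (A0 : 'M[R]_2) (F0 : 'rV[R]_d -> 'M[R]_2).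
Variables (kappa s0 s1 : R) (t b p r : nat -> R).
Implicit Types (x : 'rV[R]_d) (n m k : 'rV[int]_d) (j : nat) (A J : 'M[R]_2).
Implicit Types (psi chi Ab F Z : 'rV[R]_d -> 'M[R]_2) (M C be pb T : R).

Hypothesis ks : @kam_scales R d omega L A0 kappa s1 t b p r.
Hypothesis s01 : s1 = 1000 * (1000 * s0).

Local Notation reduced := (reduced omega L A0 F0 b r).

(* After a rotation or an acceptance at time [jg] the determinant is so small that no resonance
   occurs before time [jg + 23]; the frame is controlled by the scale [be], [T] of that time. *)
Record gap j A M C be pb T : Prop := Gap {
  gp_be : be = 100 * (1000 * pb);
  gp_pb : 0 <= pb;
  gp_M : M <= T / 4;
  gp_C : C <= expR (20 * pb);
  gp_time : (64 * be <= b j /\ 16 * T <= t j) \/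
    exists jg, [/\ (jg <= j)%N, be = b jg, T = t jg &
      `|\det A| <= (2 - expR (- (b j / 8))) * expR (- (b jg / 100))] }.

(** The inverse of the weight of the index n + n at width [s1], that is, the gain of a Fourier
    coefficient at frequency n. *)
Definition decay n := expR (- (2 * pi * lam L 1 n * s1)).

(* The rotation of [psi] by [n] is kept apart from the slowly growing conjugacy [chi]. *)
Record adapted j psi A chi n J : Prop := Adapted {
  ad_J : cstruct J;
  ad_psi : forall x, psi x = chi x * rot J n x;
  ad_det : forall x, \det (chi x) = 1;
  ad_half : half_periodic chi;
  ad_mnormJ : mnorm J <= expR (10 * p j);
  ad_ac : mnorm (ac J A) <= (1 - expR (- (b j / 4))) * decay n;
  ad_small : ac J A = 0 \/ mnorm A <= kappa * expR (- (b j / 200)) /\ b j < s1 * lam L 1 n;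
  ad_chi1 : bnd 2 (wt L 2 s1) chi (expR (b j / 7));
  ad_chi0 : bnd 2 (wt L 2 s0) chi (expR (b j / 1000)) }.

(** n = 0 stands for the absence of a pending rotation. The bounds on [chi] then refer to the scale
    [be] of the last change, not to the current one, and are therefore comfortable when the next
    resonance comes. *)
Definition fitted j psi A chi n J be : Prop :=
  if n == 0 then [/\ chi = psi, bnd 2 (wt L 2 s1) chi (expR (9 * be))
    & bnd 2 (wt L 2 s0) chi (expR (be / 1000))]
  else adapted j psi A chi n J.

Lemma s0_gt0 : 0 < s0. Proof. by have := ks_s ks; rewrite s01; lra. Qed.

Lemma wt0W : weight (wt L 2 s0 : 'rV[int]_d -> R).
Proof. by apply: (wt_weight (ks_L ks)); exact: ltW s0_gt0. Qed.

Lemma wt1W : weight (wt L 2 s1 : 'rV[int]_d -> R).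
Proof. by apply: (wt_weight (ks_L ks)); exact: ltW (ks_s ks). Qed.

Lemma decay_gt0 n : 0 < decay n. Proof. exact: expR_gt0. Qed.

(** Up to step jg + 22 the frequencies considered are below t (jg + 23), where the squared phase is
    at least exp(-4 p jg), whereas det A and the threshold are of order exp(-1000 p jg). *)
Lemma small_det_nonresonant j jg A M m : (jg <= j)%N -> (j < jg + 23)%N -> M <= t j / 4 ->
  `|\det A| <= 2 * expR (- (b jg / 100)) -> m != 0 ->
  norm1 (rvint m : 'rV[R]_d) <= t j / 8 + M -> ~~ resonant omega b j A m.
Proof.
move=> gj jg23 Mt dA m0 mM; apply/negP; rewrite /resonant.
have [tj0 _ _] := ks_t ks j; have tj : t j <= t (jg + 23)%N by exact: ks_t_mono ks _ _ (ltnW jg23).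
have mu1 : expR (- (2 * p jg)) <= `|phase 1 m omega| by apply: (ks_div ks m0); lra.
have [pj bp _] := ks_bounds ks jg.
have bb : b jg <= b j := ks_b_mono ks gj.
have X : expR (- (b j / 100)) <= expR (- (b jg / 100)) by rewrite ler_expR; lra.
have sh := expR_shrink ks (j := jg) (x := - (b jg / 100)) (y := - (4 * p jg)) ltac:(lra).
have mu2 : expR (- (4 * p jg)) <= phase 1 m omega ^+ 2.
  rewrite -(real_normK (num_real (phase 1 m omega))).
  have -> : - (4 * p jg) = - (2 * p jg) + - (2 * p jg) by lra.
  by rewrite expRD expr2 ler_pM// expR_ge0.
move: dA; rewrite ler_norml => /andP[_ d2]; rewrite ltr_norml => /andP[d3 _].
have := expR_gt0 (- (b jg / 100)); clear -ks s01 d2 d3 mu2 sh X; lra.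
Qed.

Lemma gap_le j A M C be pb T : gap j A M C be pb T ->
  [/\ M <= t j / 4, C <= expR (20 * p j), be <= b j & pb <= p j].
Proof.
move=> [bep pb0 hM hC htime]; have [pj bp _] := ks_bounds ks j; have [tj0 _ _] := ks_t ks j.
have [be1 T1] : be <= b j /\ T <= t j.
  case: htime => [[h1 h2]|[jg [gj -> -> _]]]; first by split; lra.
  by split; [exact: ks_b_mono ks _ _ gj|exact: ks_t_mono ks _ _ gj].
have pb1 : pb <= p j by lra.
split => //; first by lra.
apply: (le_trans hC); rewrite ler_expR; lra.
Qed.

Lemma resonant_far j A M C be pb T m : gap j A M C be pb T -> m != 0 ->
  norm1 (rvint m : 'rV[R]_d) <= t j / 8 + M -> resonant omega b j A m ->
  64 * be <= b j /\ 16 * T <= t j.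
Proof.
move=> gp m0 mM hres; have [Mt _ _ _] := gap_le gp.
case: (gp_time gp) => // -[jg [gj -> -> dA]].
have [j23|j23] := leqP (jg + 23) j; first exact: (ks_gap ks j23).
exfalso; move: hres; apply/negP; apply: (small_det_nonresonant gj j23 Mt _ m0 mM).
apply: (le_trans dA); rewrite ler_wpM2r ?expR_ge0//.
have := expR_ge0 (- (b j / 8)); lra.
Qed.

Lemma ac_self J : cstruct J -> ac J J = 0.
Proof. by move=> hJ; rewrite /ac (cstruct_sqr hJ) mulN1r subrr scaler0. Qed.

(** With a rotation pending, a resonance excludes the second case of [ad_small], in which det A is
    too small. So A is a multiple of J and the complex structure K of the new rotation is J or - J:
    both rotations combine into one and [chi] does not change. If their frequencies cancel, the
    frame is [chi] itself. *)
Lemma rotation_decision j psi A Ab F Z M C chi n J be pb T :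
  reduced j psi A Ab F Z M C -> gap j A M C be pb T -> fitted j psi A chi n J be ->
  exists psi' A' M' C' n' J' be' pb' T', [/\ reduced j psi' A' Ab F Z M' C',
    gap j A' M' C' be' pb' T', fitted j psi' A' chi n' J' be' &
    forall m, m != 0 -> norm1 (rvint m : 'rV[R]_d) <= t j / 8 + M' -> ~~ resonant omega b j A' m].
Proof.
move=> rd gp ft; have [Mt CE beb pbp] := gap_le gp.
have [[m [m0 mM hres]]|nores] := pselect (exists m, [/\ m != 0,
    norm1 (rvint m : 'rV[R]_d) <= t j / 8 + M & resonant omega b j A m]); last first.
  exists psi, A, M, C, n, J, be, pb, T; split => // m m0 mM; apply/negP => hres.
  by apply: nores; exists m.
have [be64 T16] := resonant_far gp m0 mM hres.
have [pj bp bb] := ks_bounds ks j; have [c100 cA ck] := ks_const ks j.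
have [tj0 _ _] := ks_t ks j.
have jj : (j < j + 23)%N by rewrite -[X in (X < _)%N]addn0 ltn_add2l.
have bep := gp_be gp; have pb0 := gp_pb gp.
have pb64 : 64 * pb <= p j by lra.
have M64 : M <= t j / 64 by have := gp_M gp; lra.
have Cp : C <= expR (p j) by apply: (le_trans (gp_C gp)); rewrite ler_expR; lra.
have [al [c [K [m' [M' [al0 AK hK ale [/andP[d0 d1] M't m'0 rd']]]]]]] :=
  rotate_resonance ks rd m0 mM M64 Cp hres.
have X0 := expR_gt0 (- (b j / 100)).
have E8 : expR (- (b j / 8)) <= 1 by rewrite -[leRHS]expR0 ler_expR; clear -ks s01 pj bp bb bep pb0 be64 pb64; lra.
have dn : `|\det (c *: K)| <= (2 - expR (- (b j / 8))) * expR (- (b j / 100)).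
  rewrite ger0_norm//; apply: (le_trans d1); rewrite ler_peMl ?(ltW X0)//; lra.
have dn2 : `|\det (c *: K)| <= 2 * expR (- (b j / 100)).
  by apply: (le_trans dn); rewrite ler_wpM2r ?(ltW X0)//; have := expR_ge0 (- (b j / 8)); clear -ks s01; lra.
have gp' : gap j (c *: K) M' (expR (20 * p j)) (b j) (p j) (t j).
  by split => //; right; exists j; split.
have nores : forall m, m != 0 -> norm1 (rvint m : 'rV[R]_d) <= t j / 8 + M' ->
    ~~ resonant omega b j (c *: K) m.
  by move=> k k0 kM; exact: (small_det_nonresonant (leqnn j) jj M't dn2 k0 kM).
have ac0 : ac K (c *: K) = 0 by rewrite acZ ac_self// scaler0.
have E4 : 0 <= 1 - expR (- (b j / 4)).
  by rewrite subr_ge0 -[leRHS]expR0 ler_expR; clear -ks s01 pj bp bb bep pb0 be64 pb64; lra.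
exists (fun x => psi x * rot K m' x), (c *: K), M', (expR (20 * p j)).
move: ft; rewrite /fitted; case: eqVneq => [n0 [chiE b1 b0]|n0 ad].
  exists m', K, (b j), (p j), (t j); split => //; rewrite (negPf m'0).
  split => //; try by rewrite chiE; [exact: rd_det rd|exact: rd_half rd].
  - by move=> x; rewrite chiE.
  - by rewrite chiE; exact: rd_det rd.
  - by rewrite chiE; exact: rd_half rd.
  (* A is recovered from its conjugate at one point; no rotation is pending here, so [psi] is [chi],
     which is bounded at width [s0]. *)
  - have mA : mnorm A <= expR (5 * p j).
      have -> : A = adj2 (psi 0) * (psi 0 * A * adj2 (psi 0)) * psi 0.
        by rewrite !mulrA adj2_det1l ?mul1r -?mulrA ?adj2_det1l ?mulr1// (rd_det rd).
      have hp : mnorm (psi 0) <= expR (be / 1000).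
        by have := mnorm_bnd wt0W 0 b0; rewrite chiE.
      have hA := mnorm_bnd (ks_weight ks j) 0 (rd_A rd).
      have hA' := le_trans hA (abound_le ks j).
      apply: (le_trans (mnormM _ _)).
      apply: (expR_mul_le (u := be / 1000 + p j) _ _ _ hp); rewrite ?mnorm_ge0//; last by clear -ks s01 pj bp bb bep pb0 be64 pb64; lra.
      apply: (le_trans (mnormM _ _)); rewrite mnorm_adj2.
      by apply: (expR_mul_le _ _ hp hA'); rewrite ?mnorm_ge0//; clear -ks s01 pj bp bb bep pb0 be64 pb64; lra.
    have -> : K = al^-1 *: A by rewrite AK scalerA mulVf ?scale1r// gt_eqF.
    rewrite mnormZ; apply: (expR_mul_le (u := 5 / 2 * p j) (v := 5 * p j)) => //.
    + exact: mnorm_ge0.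
    + rewrite gtr0_norm ?invr_gt0// -[expR _]invrK -expRN lef_pV2 ?posrE ?expR_gt0//.
    + by clear -ks s01 pj bp bb bep pb0 be64 pb64; lra.
  - by rewrite ac0 mnorm0 mulr_ge0// ltW// decay_gt0.
  - by left.
  (* 64 be <= b j at a resonance, and 9 / 64 < 1 / 7. *)
  - by apply: bnd_le b1; rewrite ler_expR; clear -ks s01 pj bp bb bep pb0 be64 pb64; lra.
  - by apply: bnd_le b0; rewrite ler_expR; clear -ks s01 pj bp bb bep pb0 be64 pb64; lra.
have acA : ac J A = 0.
  case: (ad_small ad) => // -[sA _]; exfalso; move: hres; apply/negP.
  apply: (small_det_nonresonant (leqnn j) jj Mt _ m0 mM).
  apply: (le_trans (det2_abs A)); apply: (@le_trans _ _ (expR (- (b j / 100)))); last by clear -ks s01 X0; lra.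
  have sA' : mnorm A <= expR (- (b j / 200)).
    apply: (le_trans sA); rewrite ger_pMl ?expR_gt0//.
    by have /andP[_ /ltW] := ks_kappa ks.
  by rewrite expr2; apply: (expR_mul_le _ _ sA' sA'); rewrite ?mnorm_ge0//; clear -ks s01 pj bp bb bep pb0 be64 pb64; lra.
have hJ := ad_J ad.
have [x AJ] := cm_tr0 hJ (rd_trA rd); rewrite ac_cm// in AJ.
have KJ : K = J \/ K = - J.
  have : x ^+ 2 = al ^+ 2.
    have := congr1 (fun B : 'M[R]_2 => \det B) AK; rewrite {1}AJ !detZ.
    by rewrite (proj2 hJ) (proj2 hK) !mulr1.
  move=> /eqP; rewrite eqf_sqr => /orP[/eqP xa|/eqP xa]; [left|right].
    by apply: (scalerI (a := al)); rewrite ?gt_eqF// -AK AJ xa.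
  by apply: (scalerI (a := al)); rewrite ?gt_eqF// -AK AJ xa scaleNr scalerN.
have [n' hn'] : exists n', forall y, rot J n y * rot K m' y = rot J n' y.
  case: KJ => ->; first by exists (n + m') => y; rewrite rotM.
  by exists (n - m') => y; rewrite rotN rotM.
have acK : ac J (c *: K) = 0 by case: KJ ac0 => -> //; rewrite acN.
have psiE y : psi y * rot K m' y = chi y * rot J n' y by rewrite (ad_psi ad) -mulrA hn'.
exists n', J, (b j), (p j), (t j); split => //; case: eqVneq => [n'0|n'0].
  split; last exact: ad_chi0 ad.
  - by apply/funext => y; rewrite psiE n'0 rot0 mulr1.
  - by apply: bnd_le (ad_chi1 ad); rewrite ler_expR; clear -ks s01 pj bp bb bep pb0 be64 pb64; lra.
split => //; try by [exact: ad_det ad|exact: ad_half ad|exact: ad_mnormJ ad|exact: ad_chi1 ad|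
  exact: ad_chi0 ad].
- by rewrite acK mnorm0 mulr_ge0// ltW// decay_gt0.
- by left.
Qed.

End Output.

(** * Change of the complex structure of a pending rotation *)

Section Rebase.
Context {R : realType} {d : nat}.
Implicit Types (x : 'rV[R]_d) (n m k : 'rV[int]_d) (A B J N X : 'M[R]_2).

Lemma ac_anti_id J X : cstruct J -> J * X = - (X * J) -> ac J X = X.
Proof.
move=> hJ h; rewrite /ac h mulNr -mulrA (cstruct_sqr hJ) mulrN1 opprK.
have -> : X + X = 2 *: X by rewrite scaler_nat mulr2n.
by rewrite scalerA mulVf ?scale1r.
Qed.

(* When A is close to a nonzero multiple of J, its normalization is a complex structure close
   to J that commutes with A. *)
Lemma normalize_structure J A (y : R) : cstruct J -> \tr A = 0 -> cm J A = y *: J -> y != 0 ->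
  mnorm (ac J A) <= `|y| / 2 ->
  exists J' z, [/\ cstruct J', A = z *: J' &
    mnorm (J' - J) <= 2 * (mnorm J + 1) * (mnorm (ac J A) / `|y|)].
Proof.
move=> hJ trA cmA y0 ny.
pose N := ac J A; pose nu := mnorm N; have nu0 : 0 <= nu := mnorm_ge0 _.
have AE : A = y *: J + N by rewrite -cmA cm_ac.
have y1 : 0 < `|y| by rewrite normr_gt0.
have detA : \det A = y ^+ 2 + \det N by rewrite AE det_cm_ac.
have dN : `|\det N| <= nu ^+ 2 := det2_abs N.
have nu2 : nu ^+ 2 <= `|y| ^+ 2 / 4.
  by rewrite !expr2 (_ : _ / 4 = (`|y| / 2) * (`|y| / 2)); [rewrite ler_pM|field].
have y2 : y ^+ 2 = `|y| ^+ 2 by rewrite real_normK// num_real.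
move: y1 nu2 y2 ny detA; rewrite -/N -/nu; set a := `|y| => a0 nu2 y2 ny detA.
have a2 : 0 < a ^+ 2 by rewrite exprn_gt0.
have [D1 D2] : - nu ^+ 2 <= \det N /\ \det N <= nu ^+ 2.
  by move: dN; rewrite ler_norml => /andP[].
pose al := Num.sqrt (\det A).
have dA : a ^+ 2 / 4 <= \det A by rewrite detA y2; lra.
have al2 : al ^+ 2 = \det A by rewrite sqr_sqrtr//; lra.
have al0 : 0 < al by rewrite sqrtr_gt0; lra.
have ala : a / 2 <= al.
  rewrite -(@ler_pXn2r _ 2)// ?nnegrE ?divr_ge0 ?(ltW al0) ?(ltW a0)//.
  by rewrite al2 expr_div_n; move: dA; lra.
pose s := Num.sg y; have ys : s * y = a by rewrite /s -normrEsg.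
have s1 : s ^+ 2 = 1 by rewrite sqr_sg y0.
pose J' := (s / al) *: A.
have J'E : J' = (a / al) *: J + (s / al) *: N.
  by rewrite /J' AE scalerDr scalerA -ys; congr (_ *: _ + _); ring.
exists J', (s * al); split.
- split; first by rewrite mxtraceZ trA mulr0.
  by rewrite detZ exprMn s1 mul1r exprVn al2 mulVf// -al2 gt_eqF// exprn_gt0.
- rewrite /J' scalerA (_ : s * al * (s / al) = 1) ?scale1r//.
  by rewrite -s1 expr2; field; rewrite gt_eqF.
have -> : J' - J = (a / al - 1) *: J + (s / al) *: N.
  by rewrite J'E scalerBl scale1r addrAC.
apply: (le_trans (mnormD _ _)); rewrite [mnorm (_ *: J)]mnormZ [mnorm (_ *: N)]mnormZ -/nu.
have n1 : `|s / al| <= 2 / a.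
  have -> : `|s / al| = al^-1.
    rewrite normrM normfV (gtr0_norm al0) (_ : `|s| = 1) ?mul1r//.
    by apply/eqP; rewrite -(@eqrXn2 _ 2)// expr1n real_normK ?num_real// s1.
  by rewrite -[2 / a]invf_div lef_pV2 ?posrE ?divr_gt0.
have n2 : `|a / al - 1| <= nu / a.
  have -> : a / al - 1 = - \det N / (al * (a + al)).
    have -> : \det N = (al - a) * (al + a) by rewrite -subr_sqr al2 detA y2; ring.
    by field; rewrite !gt_eqF// addr_gt0.
  rewrite normrM normrN normfV (gtr0_norm (mulr_gt0 al0 (addr_gt0 a0 al0))).
  rewrite ler_pdivrMr ?mulr_gt0 ?addr_gt0//; apply: (le_trans dN).
  rewrite expr2 -mulrA ler_wpM2l// mulrC ler_pdivlMr//.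
  have : a / 2 * a <= al * (a + al) by rewrite ler_pM ?divr_ge0 ?(ltW a0)//; lra.
  have := ler_wpM2r (ltW a0) ny; lra.
have mJ0 := mnorm_ge0 J.
have h1 := ler_wpM2r mJ0 n2; have h2 := ler_wpM2r nu0 n1.
have h3 : 0 <= nu / a * mnorm J by rewrite !mulr_ge0// invr_ge0 ltW.
have -> : 2 * (mnorm J + 1) * (nu / a) = 2 * (nu / a * mnorm J) + 2 / a * nu by ring.
lra.
Qed.

(** Both squares being -1, everything cancels except J' - J, and the two half frequencies combine
    into the index n + n. *)
Lemma rot_change J J' n x : cstruct J -> cstruct J' ->
  rot J n x * adj2 (rot J' n x) - 1 =
  2^-1 *: (trig 2 (n + n) 0 x *: (J * (J' - J)) - J * (J' - J)
    - trig 2 (n + n) (- (pi / 2)) x *: (J' - J)).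
Proof.
move=> hJ hJ'; rewrite (adj2_rot _ _ hJ') trig_cos trig_sin phaseD cosD sinD /rot phaseN cosN sinN.
have := cos2Dsin2 (phase 2 n x); move: (cos _) (sin _) => c s cs.
have JJ : J * J' = J * (J' - J) - 1 by rewrite mulrBr (cstruct_sqr hJ) opprK addrK.
move: (J * (J' - J)) JJ => K JJ.
have -> : (c *: 1 + s *: J) * (c *: 1 + - s *: J') = (c * c) *: 1 - (s * c) *: (J' - J) - (s * s) *: (J * J').
  rewrite mulrDl !mulrDr -!scalerAl -!scalerAr !mul1r mulr1 !scalerA scalerBr.
  by move: (J * J') => Y; mring.
have cc : c * c = 1 - s * s by rewrite -!expr2 -cs addrK.
by rewrite JJ cc; apply/matrixP => i k; rewrite !mxE; field.
Qed.

(** The weight of n + n is affordable at width [s1], because the J' of the application differs from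
    J by about [decay n], the inverse of that weight. *)
Lemma bnd_rot_change (w : 'rV[int]_d -> R) J J' n : weight w -> cstruct J -> cstruct J' ->
  bnd 2 w (fun x => rot J n x * adj2 (rot J' n x) - 1)
    (w (n + n) * ((1 + mnorm J) * mnorm (J' - J))).
Proof.
move=> wW hJ hJ'; have bX := bnd_cst 2 wW (J' - J); have bJ := bnd_cst 2 wW (J * (J' - J)).
have w1 : 1 <= w (n + n) by case: wW.
have := bndZ wW 2^-1 (bndB wW (bndB wW (bnd_trig wW (n + n) 0 bJ) bJ)
  (bnd_trig wW (n + n) (- (pi / 2)) bX)).
move=> /(bnd_ext (fun x => esym (rot_change n x hJ hJ'))); apply: bnd_le.
rewrite ger0_norm//.
have := mnormM J (J' - J); have := mnorm_ge0 (J' - J); have := mnorm_ge0 (J * (J' - J)).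
move: (mnorm (J * (J' - J))) (mnorm (J' - J)) (w (n + n)) w1 => u v w2 w1 u0 v0 uv.
have h1 := ler_wpM2l (le_trans ler01 w1) uv.
have h2 := ler_peMl u0 w1; have h3 := mulr_ge0 (le_trans ler01 w1) v0.
rewrite mulrDl mul1r mulrDr; lra.
Qed.

Lemma rot_ustep_sign J n x i :
  rot J n (x + ustep i) = (if (2 %| n 0%R i)%Z then 1 else -1) *: rot J n x.
Proof. by rewrite /rot -!trig_cos -!trig_sin !trig_ustep scalerDr !scalerA. Qed.

Lemma rot_change_periodic J J' n x i :
  rot J n (x + ustep i) * adj2 (rot J' n (x + ustep i)) = rot J n x * adj2 (rot J' n x).
Proof.
rewrite !rot_ustep_sign adj2Z -scalerAl -scalerAr scalerA.
by case: ifP => _; rewrite ?mulrNN ?mulr1 ?mul1r scale1r.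
Qed.

(** By [conj_rot] the anticommuting part of the integrand is a rotation of index - (n + n) times a
    function bounded through [chi] alone, so its mean is a Fourier coefficient of that function. *)
Lemma ac_mean_bound (w : 'rV[int]_d -> R) psi chi G B J n (X g : R) : weight w -> cstruct J ->
  (forall x, psi x = chi x * rot J n x) -> bnd 2 w chi X -> bnd 2 w G g ->
  mean (fun x => adj2 (psi x) * G x * psi x) B ->
  mnorm (ac J B) <= (1 + mnorm J) * ((1 + mnorm J ^+ 2) * (X * g * X)) / w (- (n + n)).
Proof.
move=> wW hJ psiE bX bG mB.
pose H x := adj2 (chi x) * G x * chi x.
have bH : bnd 2 w H (X * g * X) := bndM wW (bndM wW (bnd_adj2 wW bX) bG) bX.
have K0 : 0 <= 1 + mnorm J ^+ 2 by rewrite addr_ge0// sqr_ge0.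
have macK (U : 'M[R]_2) : mnorm (ac J U) <= (1 + mnorm J ^+ 2) * mnorm U.
  by rewrite mulrC; exact: mnorm_ac.
have bac : bnd 2 w (fun x => ac J (H x)) ((1 + mnorm J ^+ 2) * (X * g * X)).
  exact: (bnd_lin wW (acD J) (fun c U => acZ J c U) K0 macK bH).
have bJac := bndM wW (bnd_cst 2 wW J) bac.
have mac := mean_lin (acD J) (fun c U => acZ J c U) macK mB.
have E x : ac J (adj2 (psi x) * G x * psi x) =
    trig 2 (- (n + n)) 0 x *: ac J (H x) + trig 2 (- (n + n)) (- (pi / 2)) x *: (J * ac J (H x)).
  have -> : adj2 (psi x) * G x * psi x = adj2 (rot J n x) * H x * rot J n x.
    by rewrite psiE adj2M /H !mulrA.
  rewrite (conj_rot hJ) acD.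
  have -> : ac J (cm J (H x)) = 0.
    rewrite /ac (cm_comm hJ) -mulrA (cstruct_sqr hJ) mulrN1 subrr scaler0//.
  rewrite add0r ac_anti_id// ?trig_cos ?trig_sin.
    by rewrite /rot mulrDl -!scalerAl mul1r.
  have h := ac_anti hJ (H x); rewrite mulrA rot_comm -mulrA h mulrN mulrA//.
have {}mac := mean_ext E mac.
apply: (le_trans (mean_trig_bound wW bac bJac mac)).
by rewrite [in leRHS]mulrDl mul1r.
Qed.

End Rebase.

(** * Merging, keeping or rebasing the pending rotation *)

Section EndOfStep.
Context {R : realType} {d : nat}.
Variables (omega : 'rV[R]_d) (L : R -> R) (A0 : 'M[R]_2) (F0 : 'rV[R]_d -> 'M[R]_2).
Variables (kappa s0 s1 : R) (t b p r : nat -> R).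
Implicit Types (x : 'rV[R]_d) (n m k : 'rV[int]_d) (j : nat) (A B J : 'M[R]_2).
Implicit Types (psi chi Ab F Z G : 'rV[R]_d -> 'M[R]_2) (M C be pb T : R).

Hypothesis ks : @kam_scales R d omega L A0 kappa s1 t b p r.
Hypothesis s01 : s1 = 1000 * (1000 * s0).

Local Notation reduced := (reduced omega L A0 F0 b r).
Local Notation gap := (gap t b).
Local Notation decay := (decay L s1).
Local Notation adapted := (adapted L kappa s0 s1 b p).
Local Notation fits := (fitted L kappa s0 s1 b p).

Lemma wt_double (s : R) n : wt L 2 s (n + n) = expR (2 * pi * lam L 1 n * s).
Proof. by rewrite /wt -mulr2n lam_double. Qed.

Lemma wt_decay n : wt L 2 s1 (n + n) * decay n = 1.
Proof. by rewrite wt_double -[decay n]/(expR (- (2 * pi * lam L 1 n * s1))) -expRD subrr expR0. Qed.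

(** The factor 2 - exp(- b j / 8) in [gp_time] is an increasing budget for the changes of the
    determinant. *)
Lemma gap_step j A A' M C be pb T : gap j A M C be pb T ->
  `|\det A' - \det A| <= expR (- (b j / 2)) -> gap j.+1 A' M C be pb T.
Proof.
move=> [bep pb0 hM hC htime] dA; split => //.
have [pj bp bb] := ks_bounds ks j; have [_ tS _] := ks_t ks j.
case: htime => [[h1 h2]|[jg [gj beE TE dg]]]; first by left; split; lra.
right; exists jg; split => //; first exact: leqW.
have bg := ks_b_mono ks gj.
have X : expR (- (b j / 100)) <= expR (- (b jg / 100)) by rewrite ler_expR; lra.
have sh := expR_shrink ks (j := j).
have h1 := sh (- (b j.+1 / 8)) (- (b j / 8)) ltac:(clear -ks s01 pj bp bb; lra).
have h2 := sh (- (b j / 2)) (- (b j / 8) - b j / 100) ltac:(clear -ks s01 pj bp bb; lra).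
rewrite expRD in h2.
have e8 := expR_ge0 (- (b j / 8)); have h3 := ler_wpM2l e8 X.
have h4 := ler_wpM2r (le_trans (expR_ge0 _) X) h1.
have : `|\det A'| <= `|\det A| + expR (- (b j / 2)).
  by rewrite -[\det A'](subrK (\det A)) addrC (le_trans (ler_normD _ _))// lerD2l.
have := mulr_ge0 e8 (expR_ge0 (- (b jg / 100))).
move: dg h1 h2 h3 h4; rewrite !mulrBl.
move: (expR (- (b j / 8))) (expR (- (b j.+1 / 8))) (expR (- (b jg / 100))) (expR (- (b j / 2))).
move=> a c e f; clear -ks s01; lra.
Qed.

Lemma lam2_le n : lam L 2 n <= lam L 1 n.
Proof.
rewrite /lam; case: ifP => // _; apply: (weight_le (ks_L ks)); first exact: norm1_ge0.
rewrite /freq !norm1Z; rewrite ler_wpM2r ?norm1_ge0// !ger0_norm// invr1; lra.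
Qed.

Lemma mean_decay j psi A chi n J G B : adapted j psi A chi n J ->
  bnd 1 (wt L 1 (r j)) G (expR (- b j)) -> mean (fun x => adj2 (psi x) * G x * psi x) B ->
  mnorm (ac J B) <= expR (- (b j / 2)) * decay n.
Proof.
move=> ad bG mB; have [pj bp bb] := ks_bounds ks j.
have bG2 : bnd 2 (wt L 2 s1) G (expR (- b j)).
  by apply: bnd12; apply: bnd_wle bG => k; exact: (wt_le (ks_L ks) 1 k (ks_r ks j)).
apply: (le_trans (ac_mean_bound (wt1W ks) (ad_J ad) (ad_psi ad) (ad_chi1 ad) bG2 mB)).
have -> : (wt L 2 s1 (- (n + n)))^-1 = decay n.
  have [_ _ -> _] := wt1W (d := d) ks.
  by apply: (mulfI (lt0r_neq0 (expR_gt0 (2 * pi * lam L 2 (n + n) * s1)))); rewrite -/(wt L 2 s1 _) wt_decay mulfV// gt_eqF// expR_gt0.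
rewrite ler_wpM2r ?expR_ge0//.
have mJ := ad_mnormJ ad; have mJ0 := mnorm_ge0 J.
have sh := expR_shrink ks (j := j).
have h1 := sh (10 * p j) (11 * p j) ltac:(clear -ks s01; lra).
have h2 := sh (20 * p j) (21 * p j) ltac:(clear -ks s01; lra).
have e1 : 1 <= expR (10 * p j) by apply: le_trans (expR_ge1Dx _); clear -ks s01 pj; lra.
have e2 : 1 <= expR (20 * p j) by apply: le_trans (expR_ge1Dx _); clear -ks s01 pj; lra.
have mJ2 : mnorm J ^+ 2 <= expR (20 * p j).
  by rewrite expr2; apply: (expR_mul_le _ _ mJ mJ) => //; clear -ks s01; lra.
have g0 : expR (b j / 7) * expR (- b j) * expR (b j / 7) = expR (- (5 / 7 * b j)).
  by rewrite -!expRD; congr expR; clear -ks s01; field.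
rewrite g0; apply: (@expR_mul_le _ _ _ (11 * p j) (21 * p j - 5 / 7 * b j)).
- by clear -ks s01 mJ0; lra.
- by rewrite mulr_ge0 ?expR_ge0// addr_ge0// sqr_ge0.
- by clear -ks s01 mJ h1 e1; lra.
- apply: (@expR_mul_le _ _ _ (21 * p j) (- (5 / 7 * b j))) => //.
  + by rewrite addr_ge0// sqr_ge0.
  + by clear -ks s01 mJ2 h2 e2; lra.
- by clear -ks s01 pj bp; lra.
Qed.

(** While A is not small, its commuting part y J dominates, so J can be replaced by the
    normalisation of A. The resulting change of [chi] is harmless: at width [s1] the weight of n + n
    meets [decay n], and at width [s0] what remains is below exp(- b j / 4). *)
Lemma rebase_step j psi A chi n J : cstruct J -> (forall x, psi x = chi x * rot J n x) ->
  (forall x, \det (chi x) = 1) -> half_periodic chi -> mnorm J <= expR (10 * p j) ->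
  \tr A = 0 -> mnorm (ac J A) <= decay n ->
  mnorm (ac J A) * wt L 2 s0 (n + n) <= expR (- (b j / 2)) ->
  kappa * expR (- (b j.+1 / 200)) < mnorm A ->
  bnd 2 (wt L 2 s1) chi (expR (b j / 7)) -> bnd 2 (wt L 2 s0) chi (expR (b j / 1000)) ->
  exists chi' J', adapted j.+1 psi A chi' n J' /\
    bnd 1 (wt L 1 s0) (fun x => chi' x * adj2 (chi x) - 1) (expR (- (b j / 4))).
Proof.
move=> hJ psiE dchi hchi mJ trA n1 n0 lA b1 b0.
have [pj bp bb] := ks_bounds ks j; have [c100 cA ck] := ks_const ks j.
have [_ bp' _] := ks_bounds ks j.+1.
have sh := expR_shrink ks (j := j).
have mJ0 := mnorm_ge0 J; have nu0 := mnorm_ge0 (ac J A).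
have w1W := wt1W (d := d) ks; have w0W := wt0W (d := d) ks s01.
have [w01 _ _ _] := w0W.
have nu2 : mnorm (ac J A) <= expR (- (b j / 2)).
  by apply: le_trans n0; rewrite ler_peMr.
have kap0 : 0 < kappa by have /andP[] := ks_kappa ks.
have kE : expR (- (p j)) <= kappa.
  by rewrite expRN -[leRHS]invrK lef_pV2 ?posrE ?invr_gt0 ?expR_gt0.
pose g := expR (- p j - 3 / 400 * b j).
have gA : g < mnorm A.
  apply: le_lt_trans lA; rewrite /g expRD ler_pM ?expR_ge0// ler_expR.
  by clear -ks s01 bb; lra.
have [y cmA] := cm_tr0 hJ trA.
have Ag : mnorm A <= `|y| * mnorm J + mnorm (ac J A).
  by rewrite -{1}[A](cm_ac J) cmA -mnormZ mnormD.
have h2 : 100 * expR (- (b j / 2)) <= g by apply: sh; clear -ks s01 pj bp bb; lra.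
(* Otherwise A would be below kappa exp(- b j.+1 / 200), the norm of J being at most exp(10 p j). *)
have yE : expR (- (b j / 125)) <= `|y|.
  rewrite leNgt; apply/negP => yl.
  have h1 : 100 * expR (- (b j / 125) + 10 * p j) <= g by apply: sh; clear -ks s01 pj bp bb; lra.
  have : `|y| * mnorm J <= expR (- (b j / 125) + 10 * p j).
    by apply: (expR_mul_le _ mJ0 (ltW yl) mJ).
  have g0 := expR_gt0 (- p j - 3 / 400 * b j); rewrite -/g in g0.
  by clear -ks s01 h1 h2 nu2 Ag gA g0; lra.
have yp : 0 < `|y| := lt_le_trans (expR_gt0 _) yE.
have h3 : 100 * expR (- (b j / 2)) <= expR (- (b j / 125)) by apply: sh; clear -ks s01 pj bp bb; lra.
have ny2 : mnorm (ac J A) <= `|y| / 2.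
  by have := expR_ge0 (- (b j / 2)); clear -ks s01 h3 nu2 yE; lra.
have y0 : y != 0 by rewrite -normr_gt0.
have [J' [z [hJ' AJ' DJ]]] := normalize_structure hJ trA cmA y0 ny2.
have h10 := sh (10 * p j) (11 * p j) ltac:(clear -ks s01; lra).
have e1 : 1 <= expR (10 * p j) by apply: le_trans (expR_ge1Dx _); clear -ks s01 pj; lra.
have Dnu : mnorm (J' - J) <= expR (b j / 125 + 11 * p j) * mnorm (ac J A).
  apply: (le_trans DJ); rewrite [_ / `|y|]mulrC mulrA ler_wpM2r//.
  apply: (@expR_mul_le _ _ _ (11 * p j) (b j / 125)); rewrite ?invr_ge0//.
  - by clear -ks s01 mJ0; lra.
  - by clear -ks s01 mJ h10 e1; lra.
  - by rewrite -[expR _]invrK -expRN lef_pV2 ?posrE ?expR_gt0.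
  - by clear -ks s01; lra.
have D0 := mnorm_ge0 (J' - J).
have Qw (v e : R) : 0 <= v -> mnorm (ac J A) * v <= expR e ->
    v * ((1 + mnorm J) * mnorm (J' - J)) <= expR (e + b j / 125 + 22 * p j).
  move=> v0 ve; apply: (@le_trans _ _ (v * ((1 + mnorm J) * (expR (b j / 125 + 11 * p j) * mnorm (ac J A))))).
    by rewrite ler_wpM2l// ler_wpM2l// addr_ge0.
  have -> : v * ((1 + mnorm J) * (expR (b j / 125 + 11 * p j) * mnorm (ac J A))) =
     (1 + mnorm J) * (expR (b j / 125 + 11 * p j) * (mnorm (ac J A) * v)) by ring.
  apply: (@expR_mul_le _ _ _ (11 * p j) (b j / 125 + 11 * p j + e)).
  - by rewrite addr_ge0.
  - by rewrite !mulr_ge0// expR_ge0.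
  - by clear -ks s01 mJ h10 e1; lra.
  - by apply: (expR_mul_le (expR_ge0 _) _ (lexx _) ve); rewrite ?mulr_ge0.
  - by clear -ks s01; lra.
pose Q x := rot J n x * adj2 (rot J' n x).
have bQ1 : bnd 2 (wt L 2 s1) (fun x => Q x - 1) (expR (b j / 100)).
  apply: (bnd_le _ (bnd_rot_change n w1W hJ hJ')).
  apply: (@le_trans _ _ (expR (0 + b j / 125 + 22 * p j))); last first.
    by rewrite ler_expR; clear -ks s01 pj bp; lra.
  apply: Qw; first by case: w1W => h _ _ _; exact: le_trans ler01 (h _).
  rewrite expR0 -(wt_decay n) [wt _ _ _ _ * decay _]mulrC ler_wpM2r//.
  by case: w1W => h _ _ _; exact: le_trans ler01 (h _).
have bQ0 : bnd 2 (wt L 2 s0) (fun x => Q x - 1) (expR (- (2 / 5 * b j))).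
  apply: (bnd_le _ (bnd_rot_change n w0W hJ hJ')).
  apply: (@le_trans _ _ (expR (- (b j / 2) + b j / 125 + 22 * p j))); last first.
    by rewrite ler_expR; clear -ks s01 pj bp; lra.
  by apply: Qw n0; exact: le_trans ler01 (w01 _).
have dQ x : \det (Q x) = 1.
  by apply: det1M; [exact: det_rot|rewrite det_adj2; exact: det_rot].
have chiQ x : chi x + chi x * (Q x - 1) = chi x * Q x by rewrite mulrBr mulr1 addrCA subrr addr0.
have nuD : mnorm (J' - J) <= expR (p j).
  apply: (le_trans Dnu); apply: (expR_mul_le (expR_ge0 _) nu0 (lexx _) nu2).
  by clear -ks s01 pj bp; lra.
exists (fun x => chi x * Q x), J'; split.
- split => //.
  + by move=> x; rewrite psiE /Q -!mulrA adj2_det1l ?mulr1// det_rot.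
  + by move=> x; apply: det1M.
  + apply: half_periodicM => //; apply: half_periodicM; first exact: half_periodic_rot.
    by apply: half_periodic_adj2; exact: half_periodic_rot.
  + have -> : J' = J + (J' - J) by rewrite addrC subrK.
    apply: (le_trans (mnormD _ _)); apply: (@le_trans _ _ (expR (11 * p j))); last first.
      by rewrite ler_expR; clear -ks s01 pj bp bp' bb; lra.
    have : expR (p j) <= expR (10 * p j) by rewrite ler_expR; clear -ks s01 pj; lra.
    by clear -ks s01 mJ nuD h10 e1; lra.
  + rewrite AJ' acZ (ac_self hJ') scaler0 mnorm0 mulr_ge0 ?expR_ge0//.
    by rewrite subr_ge0 -[leRHS]expR0 ler_expR; clear -ks s01 pj bp bb; lra.
  + by left; rewrite AJ' acZ (ac_self hJ') scaler0.
  + apply: (bnd_le _ (bnd_ext chiQ (bndD b1 (bndM w1W b1 bQ1)))).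
    rewrite -expRD; apply: (@expR_sum_le _ _ _ (b j / 7 + b j / 100) (p j)) => //.
    * by rewrite ler_expR; clear -ks s01 pj bp; lra.
    * by clear -ks s01 c100; lra.
    * by clear -ks s01 pj bp bb; lra.
  + apply: (bnd_le _ (bnd_ext chiQ (bndD b0 (bndM w0W b0 bQ0)))).
    rewrite -expRD; apply: (@expR_sum_le _ _ _ (b j / 1000) (p j)) => //.
    * by rewrite ler_expR; clear -ks s01 pj bp; lra.
    * by clear -ks s01 c100; lra.
    * by clear -ks s01 pj bp bb; lra.
- have E x : chi x * (Q x - 1) * adj2 (chi x) = chi x * Q x * adj2 (chi x) - 1.
    by rewrite mulrBr mulr1 mulrBl adj2_det1.
  apply: bnd21 => [|x i].
    apply: (bnd_le _ (bnd_ext E (bndM w0W (bndM w0W b0 bQ0) (bnd_adj2 w0W b0)))).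
    by rewrite -!expRD ler_expR; clear -ks s01 pj bp; lra.
  by rewrite /Q rot_change_periodic; congr (_ - 1); exact: half_periodic_conj hchi x i.
Qed.

(** Merging requires, besides a small A, that s1 Lambda(|n|) <= b j.+1. Then, up to the norm of J,
    the rotation costs exp(p j.+1) at width s0 = s1 / 10^6 and exp(8 b j.+1) at width s1, whence the
    9 in [fitted]. If A is small but n is too large, the rotation stays pending under the second
    case of [ad_small]; if A is not small, J is rebased. *)
Lemma end_step j psi A Ab F Z M C chi n J be pb T :
  reduced j psi A Ab F Z M C -> gap j A M C be pb T -> fits j psi A chi n J be ->
  (forall m, m != 0 -> norm1 (rvint m : 'rV[R]_d) <= t j / 8 + M -> ~~ resonant omega b j A m) ->
  exists A' Ab' F' Z' chi' n' J' be' pb' T', [/\ reduced j.+1 psi A' Ab' F' Z' M C,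
    gap j.+1 A' M C be' pb' T', fits j.+1 psi A' chi' n' J' be' &
    (n' = 0 /\ mnorm A' <= kappa * expR (- (b j.+1 / 200))) \/
    bnd 1 (wt L 1 s0) (fun x => chi' x * adj2 (chi x) - 1) (expR (- (b j / 4)))].
Proof.
move=> rd gp ft nores; have [Mt CE beb pbp] := gap_le ks gp.
have [B [Ab' [F' [Z' [G [rd' dB bG mB]]]]]] := reduced_step ks rd Mt CE nores.
have gp' := gap_step gp dB.
have w0W := wt0W (d := d) ks s01; have w1W := wt1W (d := d) ks.
exists (A + B), Ab', F', Z'.
have same : (forall x, \det (chi x) = 1) ->
    bnd 1 (wt L 1 s0) (fun x => chi x * adj2 (chi x) - 1) (expR (- (b j / 4))).
  move=> dc; have w01 : weight (wt L 1 s0 : 'rV[int]_d -> R).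
    by apply: (wt_weight (ks_L ks)); exact: ltW (s0_gt0 ks s01).
  apply: (bnd_le (expR_ge0 _) (bnd_ext _ (bnd0 1 w01))) => x.
  by rewrite adj2_det1// subrr.
move: ft; rewrite /fitted; case: eqVneq => [n0 [chiE b1 b0]|n0 ad].
  exists chi, n, J, be, pb, T; split => //; first by rewrite n0 eqxx.
  by right; apply: same; rewrite chiE; exact: rd_det rd.
have [pj bp bb] := ks_bounds ks j; have [_ bp' _] := ks_bounds ks j.+1.
have sh := expR_shrink ks (j := j).
have dec0 := decay_gt0 L s1 n.
have acB := mean_decay ad bG mB.
have acAB : mnorm (ac J (A + B)) <= mnorm (ac J A) + mnorm (ac J B) by rewrite acD mnormD.
have ac1 : mnorm (ac J (A + B)) <= (1 - expR (- (b j.+1 / 4))) * decay n.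
  apply: (le_trans acAB); apply: (le_trans (lerD (ad_ac ad) acB)).
  rewrite -mulrDl ler_wpM2r ?(ltW dec0)//.
  have h1 := sh (- (b j.+1 / 4)) (- (b j / 4)) ltac:(clear -ks s01 pj bp bb; lra).
  have h2 := sh (- (b j / 2)) (- (b j / 4)) ltac:(clear -ks s01 pj bp bb; lra).
  by have := expR_ge0 (- (b j / 4)); clear -ks s01 h1 h2; lra.
have ac2 : mnorm (ac J (A + B)) <= decay n.
  apply: (le_trans ac1); rewrite ger_pMl//.
have ds : decay n * wt L 2 s0 (n + n) = expR (- (2 * pi * lam L 1 n * (s1 - s0))).
  rewrite wt_double -[decay n]/(expR (- (2 * pi * lam L 1 n * s1))) -expRD; congr expR; ring.
have lam0 := lam_ge0 (ks_L ks) 1 n; have sp := s0_gt0 ks s01.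
have pi2 := pi_ge2 R.
have plam : s1 * lam L 1 n <= 2 * pi * lam L 1 n * (s1 - s0).
  have -> : 2 * pi * lam L 1 n * (s1 - s0) = (2 * (s1 - s0)) * (pi * lam L 1 n) by ring.
  have s2 : s1 <= 2 * (s1 - s0) by rewrite s01; clear -ks s01 sp; lra.
  apply: ler_pM => //; first exact: ltW (ks_s ks).
  by rewrite ler_peMl//; clear -ks s01 pi2; lra.
have ac3 : mnorm (ac J (A + B)) * wt L 2 s0 (n + n) <= expR (- (b j / 2)).
  have w0 : 0 <= wt L 2 s0 (n + n) := expR_ge0 _.
  case: (ad_small ad) => [ac0|[_ lamb]].
    apply: (@le_trans _ _ (expR (- (b j / 2)) * decay n * wt L 2 s0 (n + n))).
      by rewrite ler_wpM2r// (le_trans acAB)// ac0 mnorm0 add0r.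
    rewrite -mulrA ds ger_pMr ?expR_gt0// -[leRHS]expR0 ler_expR oppr_le0.
    by apply: le_trans plam; rewrite mulr_ge0// ltW// (ks_s ks).
  apply: (@le_trans _ _ (decay n * wt L 2 s0 (n + n))); first by rewrite ler_wpM2r.
  by rewrite ds ler_expR lerN2; move: plam lamb; have := ks_b_ge0 ks j; clear -ks s01; lra.
have [smallA|largeA] := leP (mnorm (A + B)) (kappa * expR (- (b j.+1 / 200))); last first.
  have [chi' [J' [ad' close]]] := rebase_step (ad_J ad) (ad_psi ad) (ad_det ad) (ad_half ad)
    (ad_mnormJ ad) (rd_trA rd') ac2 ac3 largeA (ad_chi1 ad) (ad_chi0 ad).
  by exists chi', n, J', be, pb, T; split => //; [rewrite (negPf n0)|right].
have mJ := ad_mnormJ ad; have mJ0 := mnorm_ge0 J; have [c100 _ _] := ks_const ks j.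
have [lamn|lamn] := leP (s1 * lam L 1 n) (b j.+1); last first.
  exists chi, n, J, be, pb, T; split => //; last by right; apply: same; exact: ad_det ad.
  rewrite (negPf n0); split => //; try by [exact: ad_J ad|exact: ad_psi ad|exact: ad_det ad|
    exact: ad_half ad|right].
  + by apply: (le_trans mJ); rewrite ler_expR; clear -ks s01 pj bp bp' bb; lra.
  + by apply: bnd_le (ad_chi1 ad); rewrite ler_expR; clear -ks s01 pj bp bb; lra.
  + by apply: bnd_le (ad_chi0 ad); rewrite ler_expR; clear -ks s01 pj bp bb; lra.
(* Merging starts a new gap at j + 1: det A is at most the square of the norm of A, below exp(- b
   j.+1 / 100). *)
exists psi, 0, J, (b j.+1), (p j.+1), (t j.+1); split; [by []| | |by left].
- have [p1 _ _] := ks_bounds ks j.+1; have [_ tS _] := ks_t ks j.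
  split => //.
  + by apply: (le_trans Mt); clear -ks s01 tS; lra.
  + by apply: (le_trans CE); rewrite ler_expR; clear -ks s01 pj bp bp' bb; lra.
  + right; exists j.+1; split => //; apply: (le_trans (det2_abs _)).
    have kap1 : kappa <= 1 by have /andP[_ /ltW] := ks_kappa ks.
    have smA : mnorm (A + B) <= expR (- (b j.+1 / 200)).
      by apply: (le_trans smallA); rewrite ger_pMl ?expR_gt0.
    apply: (@le_trans _ _ (expR (- (b j.+1 / 100)))).
      by rewrite expr2; apply: (expR_mul_le _ _ smA smA); rewrite ?mnorm_ge0//; clear -ks s01; lra.
    rewrite ler_peMl ?expR_ge0//.
    have : expR (- (b j.+1 / 8)) <= 1.
      by rewrite -[leRHS]expR0 ler_expR; clear -ks s01 bp' p1; lra.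
    by clear -ks s01; lra.
have psiE : psi = (fun x => chi x * rot J n x) by apply/funext => x; rewrite (ad_psi ad).
have h10 := sh (10 * p j) (11 * p j) ltac:(clear -ks s01; lra).
have e1 : 1 <= expR (10 * p j) by apply: le_trans (expR_ge1Dx _); clear -ks s01 pj; lra.
have mJ11 : 2 + mnorm J <= expR (11 * p j) by clear -ks s01 mJ h10 e1; lra.
have wn (s : R) : 0 < s -> wt L 2 s n <= expR (8 * (s * lam L 1 n)).
  move=> sp'; rewrite ler_expR.
  have -> : 2 * pi * lam L 2 n * s = 2 * s * (pi * lam L 2 n) by ring.
  have -> : 8 * (s * lam L 1 n) = 2 * s * (4 * lam L 1 n) by ring.
  have s0' : 0 <= 2 * s by rewrite mulr_ge0// ltW.
  have pi4 : pi <= 4 :> R by have := pihalf_lt2 R; clear -ks s01; lra.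
  apply: (ler_wpM2l s0'); apply: ler_pM => //; first exact: pi_ge0.
  - exact: (lam_ge0 (ks_L ks)).
  - exact: lam2_le.
rewrite eqxx; split => //.
- rewrite psiE; apply: (bnd_le _ (bndM w1W (ad_chi1 ad) (bnd_rot J n w1W))).
  apply: (@expR_mul_le _ _ _ (b j / 7) (8 * b j.+1 + 11 * p j)); rewrite ?expR_ge0//.
  + by rewrite mulr_ge0 ?expR_ge0// addr_ge0.
  + apply: (@expR_mul_le _ _ _ (8 * b j.+1) (11 * p j)); rewrite ?expR_ge0 ?addr_ge0//.
    by apply: (le_trans (wn _ (ks_s ks))); rewrite ler_expR ler_wpM2l.
  + by clear -ks s01 pj bp bp' bb; lra.
- rewrite psiE; apply: (bnd_le _ (bndM w0W (ad_chi0 ad) (bnd_rot J n w0W))).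
  apply: (@expR_mul_le _ _ _ (b j / 1000) (p j.+1 + 11 * p j)); rewrite ?expR_ge0//.
  + by rewrite mulr_ge0 ?expR_ge0// addr_ge0.
  + apply: (@expR_mul_le _ _ _ (p j.+1) (11 * p j)); rewrite ?expR_ge0 ?addr_ge0//.
    apply: (le_trans (wn _ sp)); rewrite ler_expR.
    have : 1000 * (1000 * (s0 * lam L 1 n)) <= 100 * (1000 * p j.+1).
      by rewrite -bp'; move: lamn; rewrite s01 !mulrA.
    by have [p1 _ _] := ks_bounds ks j.+1; clear -ks s01 p1; lra.
  + by clear -ks s01 pj bp bp' bb; lra.
Qed.

End EndOfStep.

(** * The sequence of states and what each state provides *)

Section Sequence.
Context {R : realType} {d : nat}.
Variables (omega : 'rV[R]_d) (L : R -> R) (A0 : 'M[R]_2) (F0 : 'rV[R]_d -> 'M[R]_2).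
Variables (kappa s0 s1 : R) (t b p r : nat -> R).
Implicit Types (x : 'rV[R]_d) (n m k : 'rV[int]_d) (j : nat) (A B J : 'M[R]_2).

Hypothesis ks : @kam_scales R d omega L A0 kappa s1 t b p r.
Hypothesis s01 : s1 = 1000 * (1000 * s0).

Record kam_state := KamState {
  st_psi : 'rV[R]_d -> 'M[R]_2; st_A : 'M[R]_2; st_Ab : 'rV[R]_d -> 'M[R]_2;
  st_F : 'rV[R]_d -> 'M[R]_2; st_Z : 'rV[R]_d -> 'M[R]_2; st_chi : 'rV[R]_d -> 'M[R]_2;
  st_n : 'rV[int]_d; st_J : 'M[R]_2 }.
Implicit Types S : kam_state.

Definition valid j S := exists M C be pb T,
  [/\ reduced omega L A0 F0 b r j (st_psi S) (st_A S) (st_Ab S) (st_F S) (st_Z S) M C,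
      gap t b j (st_A S) M C be pb T
    & fitted L kappa s0 s1 b p j (st_psi S) (st_A S) (st_chi S) (st_n S) (st_J S) be].

Definition accepted j S := st_n S = 0 /\ mnorm (st_A S) <= kappa * expR (- (b j / 200)).

Definition continued j S S' := bnd 1 (wt L 1 s0)
  (fun x => st_chi S' x * adj2 (st_chi S x) - 1) (expR (- (b j / 4))).

Lemma valid_step j S : valid j S ->
  exists S', valid j.+1 S' /\ (accepted j.+1 S' \/ continued j S S').
Proof.
move=> [M [C [be [pb [T [rd gp ft]]]]]].
have [psi' [A' [M' [C' [n' [J' [be' [pb' [T' [rd' gp' ft' nores]]]]]]]]]] :=
  rotation_decision ks s01 rd gp ft.
have [A1 [Ab1 [F1 [Z1 [chi1 [n1 [J1 [be1 [pb1 [T1 [rd1 gp1 ft1 rel]]]]]]]]]]] :=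
  end_step ks s01 rd' gp' ft' nores.
exists (KamState psi' A1 Ab1 F1 Z1 chi1 n1 J1); split => //.
by exists M', C', be1, pb1, T1.
Qed.

Definition initial_state := KamState (fun=> 1) A0 (fun=> A0) F0 (fun=> 1) (fun=> 1) 0 0.

Lemma valid_initial : \tr A0 = 0 -> (forall x, \tr (F0 x) = 0) ->
  bnd 1 (wt L 1 (r 0)) F0 (expR (- b 0)) -> valid 0 initial_state.
Proof.
move=> trA trF bF.
have [pj bp bb] := ks_bounds ks 0; have [c100 cA ck] := ks_const ks 0.
have wW := ks_weight ks (d := d) 0.
have e4 : 2 <= expR (p 0 / 4).
  rewrite -(@ler_pXn2r _ 4)// ?nnegrE ?expR_ge0// -expRM_natl.
  have -> : 4 * (p 0 / 4) = p 0 by field.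
  by apply: le_trans c100; rewrite !exprS expr0; lra.
have two (x : R) : p 0 / 4 <= x -> 2 <= expR x.
  by move=> h; apply: (le_trans e4); rewrite ler_expR.
(* The frame of the identity has range 0 and constant 2; the scale b 0 / 64 and T = 0 put the
   initial state beyond a gap, ready for a resonance. *)
exists 0, 2, (b 0 / 64), (p 0 / 64), 0; split.
- split => //=; try by move=> x; rewrite det1.
  + by left.
  + by move=> x; apply: (dM_eq (dM_cst omega 1 x)); rewrite mulr1 mul1r subrr.
  + by move=> x; apply: (dM_eq (dM_cst omega 1 x)); rewrite mulr1 mul1r subrr.
  + by exists (mnorm A0); exact: bnd_cst.
  + have -> : zbound b 0 = 0 by rewrite /zbound subrr.
    by apply: (bnd_ext _ (bnd0 1 wW)) => x; rewrite subrr.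
  + apply: (bnd_le _ (bnd_ext _ (bnd_cst 1 wW A0))) => [|x]; last by rewrite adj21 mul1r mulr1.
    have : expR (- (b 0 / 2)) <= 1 by rewrite -[leRHS]expR0 ler_expR; lra.
    rewrite /abound; lra.
  + exact: frame1.
- split => //; try lra.
  + by apply: two; lra.
  + by left; split; rewrite ?mulr0; [lra|have [/ltW] := ks_t ks 0].
- rewrite /fitted /= eqxx; split => //.
  + apply: (bnd_le _ (bnd_cst 2 (wt1W ks) 1)); rewrite mnorm1; apply: two; lra.
  + apply: (bnd_le _ (bnd_cst 2 (wt0W ks s01) 1)); rewrite mnorm1; apply: two; lra.
Qed.

Lemma kam_sequence : \tr A0 = 0 -> (forall x, \tr (F0 x) = 0) ->
  bnd 1 (wt L 1 (r 0)) F0 (expR (- b 0)) ->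
  exists S : nat -> kam_state, forall j, valid j (S j) /\
    (accepted j.+1 (S j.+1) \/ continued j (S j) (S j.+1)).
Proof.
move=> trA trF bF.
(* The validity premise stands under the existential, which makes the relation total and [choice]
   applicable. *)
have next (y : nat * kam_state) : exists S', valid y.1 y.2 ->
    valid y.1.+1 S' /\ (accepted y.1.+1 S' \/ continued y.1 y.2 S').
  have [v|v] := pselect (valid y.1 y.2); last by exists initial_state.
  by have [S' h] := valid_step v; exists S'.
have [f hf] := choice next.
pose S := fix S j := if j is i.+1 then f (i, S i) else initial_state.
have v j : valid j (S j).
  elim: j => [|j IH]; first exact: valid_initial.
  by have [] := hf (j, S j) IH.
by exists S => j; split => //; have [] := hf (j, S j) (v j).
Qed.

(* For n <> 0 the part of A that anticommutes with J does not commute with the rotation: out_X moves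
   it from the reducible part to the error, and the rotation becomes part of out_A. *)
Definition out_X S x := if st_n S == 0 then 0 else
  st_psi S x * ac (st_J S) (st_A S) * adj2 (st_psi S x).

Definition out_A S := if st_n S == 0 then st_A S else
  cm (st_J S) (st_A S) + phase 2 (st_n S) omega *: st_J S.

Lemma accepted_out j S : accepted j S -> mnorm (out_A S) <= kappa * expR (- (b j / 200)).
Proof. by move=> [n0]; rewrite /out_A n0 eqxx. Qed.

(** [chi] is [psi] times the inverse rotation, which commutes with the commuting part of A and adds
    a multiple of J to it. Conjugation turns [out_X] into a rotation of index n + n; its weight at
    width [s0] is far below the inverse of [decay n], and the difference of the exponents exceeds 2
    b j when b j < s1 Lambda(|n|). *)
Lemma valid_out j S : valid j S ->
  [/\ [/\ forall x, \det (st_chi S x) = 1, half_periodic (st_chi S),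
        forall x, \tr (out_X S x) = 0 & \tr (out_A S) = 0],
      forall x, dM omega (st_chi S) ((st_Ab S x - out_X S x) * st_chi S x - st_chi S x * out_A S) x,
      bnd 1 (wt L 1 s0) (out_X S) (expR (- b j))
    & bnd 2 (wt L 2 s0) (st_chi S) (expR (b j / 1000))].
Proof.
move=> [M [C [be [pb [T [rd gp ft]]]]]]; have [_ _ beb _] := gap_le ks gp.
have wW : weight (wt L 1 s0 : 'rV[int]_d -> R).
  by apply: (wt_weight (ks_L ks)); exact: ltW (s0_gt0 ks s01).
have w0W := wt0W (d := d) ks s01.
have [pj bp bb] := ks_bounds ks j; have [c100 _ _] := ks_const ks j.
move: ft; rewrite /fitted /out_X /out_A; case: eqVneq => [n0 [-> b1 b0]|n0 ad].
  split; last by apply: bnd_le b0; rewrite ler_expR; clear -ks s01 beb; lra.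
  - split; [exact: rd_det rd|exact: rd_half rd|by move=> x; rewrite mxtrace0|exact: rd_trA rd].
  - by move=> x; rewrite subr0; exact: rd_dpsi rd x.
  - exact: bnd_le (expR_ge0 _) (bnd0 1 wW).
move: ad; move: (st_n S) (st_J S) n0 => n J n0 ad; have hJ := ad_J ad.
have chiE x : st_chi S x = st_psi S x * rot J (- n) x by rewrite (ad_psi ad) -mulrA rotVr ?mulr1.
have trA := rd_trA rd.
have XE x : st_psi S x * ac J (st_A S) * adj2 (st_psi S x) =
    st_chi S x * rot J (n + n) x * ac J (st_A S) * adj2 (st_chi S x).
  rewrite (ad_psi ad) adj2M (adj2_rot _ _ hJ) -(rotM _ _ _ hJ) !mulrA.
  congr (_ * adj2 _); rewrite -!mulrA; congr (_ * _).
  by rewrite (ac_rot hJ) opprK.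
have decay0 := decay_gt0 L s1 n.
split; last exact: ad_chi0 ad.
- split; [exact: ad_det ad|exact: ad_half ad| |].
  + by move=> x; rewrite tr_conj ?tr_ac// (rd_det rd).
  + by rewrite mxtraceD [\tr (_ *: J)]mxtraceZ (proj1 hJ) mulr0 addr0 tr_cm.
- move=> x; apply: (dM_ext (fun y => esym (chiE y))).
  apply: (dM_eq (dMM (rd_dpsi rd x) (dM_rot omega (- n) x hJ))); rewrite chiE.
  have hc := cm_rot hJ (st_A S) (- n) x; have hJr := rot_comm J (- n) x.
  have inv : adj2 (st_psi S x) * st_psi S x = 1 by rewrite adj2_det1l// (rd_det rd).
  have AE := cm_ac J (st_A S); rewrite phaseN; move: AE hc hJr inv.
  move: (phase 2 n omega) (st_psi S x) (adj2 (st_psi S x)) (rot J (- n) x) (st_Ab S x).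
  move=> mu P P' ro K; move: (cm J (st_A S)) (ac J (st_A S)) => u v.
  move: (st_A S) => A <- hc hJr inv.
  have -> : (K - P * v * P') * (P * ro) = K * P * ro - P * (v * ro).
    by rewrite mulrBl !mulrA -[P * v * P' * P]mulrA inv mulr1.
  have -> : P * ro * (u + mu *: J) = P * (u * ro) + mu *: (P * (J * ro)).
    by rewrite mulrDr -scalerAr -!mulrA -hc -hJr.
  rewrite mulrBl -[P * (u + v) * ro]mulrA mulrDl mulrDr scaleNr mulrN -scalerAr !opprD !addrA.
  by congr (_ - _); rewrite addrAC.
- case: (ad_small ad) => [ac0|[_ lamb]].
    by apply: (bnd_le (expR_ge0 _) (bnd_ext _ (bnd0 1 wW))) => x; rewrite ac0 mulr0 mul0r.
  have mJ := ad_mnormJ ad; have mJ0 := mnorm_ge0 J.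
  have acd : mnorm (ac J (st_A S)) <= decay L s1 n.
    apply: (le_trans (ad_ac ad)); rewrite ger_pMl//.
  apply: bnd21; last by move=> x i; exact: half_periodic_conj (rd_half rd) x i.
  apply: (bnd_le _ (bnd_ext (fun x => esym (XE x)) (bndM w0W (bndM w0W (bndM w0W (ad_chi0 ad)
    (bnd_rot J (n + n) w0W)) (bnd_cst 2 w0W (ac J (st_A S)))) (bnd_adj2 w0W (ad_chi0 ad))))).
  have sp := s0_gt0 ks s01; have lam0 := lam_ge0 (ks_L ks) 1 n.
  have ds : wt L 2 s0 (n + n) * mnorm (ac J (st_A S)) <= expR (- (2 * b j)).
    apply: (@le_trans _ _ (wt L 2 s0 (n + n) * decay L s1 n)).
      by rewrite ler_wpM2l// expR_ge0.
    rewrite wt_double -[decay L s1 n]/(expR (- (2 * pi * lam L 1 n * s1))) -expRD ler_expR.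
    have -> : 2 * pi * lam L 1 n * s0 - 2 * pi * lam L 1 n * s1 =
      - ((2 * (s1 - s0)) * (pi * lam L 1 n)) by ring.
    rewrite lerN2; apply: (@le_trans _ _ (s1 * (2 * lam L 1 n))).
      by move: lamb; clear -ks s01; lra.
    have s2 : s1 <= 2 * (s1 - s0) by rewrite s01; clear -ks s01 sp; lra.
    apply: ler_pM => //; [exact: ltW (ks_s ks)|by rewrite mulr_ge0|].
    by rewrite ler_wpM2r// pi_ge2.
  have -> : expR (b j / 1000) * (wt L 2 s0 (n + n) * (2 + mnorm J)) * mnorm (ac J (st_A S)) *
      expR (b j / 1000) = (expR (b j / 1000) * expR (b j / 1000)) *
      ((2 + mnorm J) * (wt L 2 s0 (n + n) * mnorm (ac J (st_A S)))) by ring.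
  rewrite -expRD; apply: (expR_mul_le (expR_ge0 _) _ (lexx _) (v := 11 * p j - 2 * b j)).
  + by rewrite !mulr_ge0 ?addr_ge0 ?expR_ge0// mnorm_ge0.
  + have h10 := expR_shrink ks (j := j) (x := 10 * p j) (y := 11 * p j) ltac:(clear -ks s01; lra).
    have e1 : 1 <= expR (10 * p j) by apply: le_trans (expR_ge1Dx _); clear -ks s01 pj; lra.
    apply: (@expR_mul_le _ _ _ (11 * p j) (- (2 * b j))) => //.
    * by rewrite addr_ge0.
    * by rewrite mulr_ge0 ?expR_ge0// mnorm_ge0.
    * by clear -ks s01 mJ h10 e1; lra.
  + by clear -ks s01 pj bp; lra.
Qed.

(** Each quotient of consecutive conjugacies is within exp(- b j / 4) of 1; the factor 4 leaves room
    for the products of these differences. *)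
Lemma continued_bound (S : nat -> kam_state) j1 : (forall j, valid j (S j)) ->
  (forall j, (j1 <= j)%N -> continued j (S j) (S j.+1)) -> forall j, (j1 <= j)%N ->
  bnd 1 (wt L 1 s0) (fun x => st_chi (S j) x * adj2 (st_chi (S j1) x) - 1)
    (4 * (expR (- (b j1 / 4)) - expR (- (b j / 4)))).
Proof.
move=> v c j /subnKC <-.
have wW : weight (wt L 1 s0 : 'rV[int]_d -> R).
  by apply: (wt_weight (ks_L ks)); exact: ltW (s0_gt0 ks s01).
have dchi i x : \det (st_chi (S i) x) = 1 by have [[h _ _ _] _ _ _] := valid_out (v i).
elim: (j - j1)%N => [|k IH].
  rewrite addn0 subrr mulr0; apply: (bnd_ext _ (bnd0 1 wW)) => x.
  by rewrite adj2_det1// subrr.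
rewrite addnS; have ci := c _ (leq_addr k j1).
have [pj bp bb] := ks_bounds ks (j1 + k).
have e4 : expR (- (b j1 / 4)) <= 100^-1.
  have [p1 bp1 _] := ks_bounds ks j1.
  have := expR_shrink ks (j := j1) (x := - (b j1 / 4)) (y := 0) ltac:(lra).
  rewrite expR0; lra.
apply: (bnd_le _ (bnd_ext _ (bndD (bndD ci IH) (bndM wW ci IH)))) => [|x].
  have h := expR_shrink ks (j := j1 + k) (x := - (b (j1 + k).+1 / 4)) (y := - (b (j1 + k) / 4)) ltac:(lra).
  have h0 := expR_ge0 (- (b (j1 + k) / 4)).
  have : expR (- (b (j1 + k) / 4)) * (4 * (expR (- (b j1 / 4)) - expR (- (b (j1 + k) / 4)))) <=
      expR (- (b (j1 + k) / 4)) * 1 by rewrite ler_wpM2l//; lra.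
  lra.
have := dchi (j1 + k)%N x; move: (st_chi (S (j1 + k).+1) x) (st_chi (S (j1 + k)%N) x) (adj2 (st_chi (S j1) x)) => P Q K dQ.
have -> : P * K = (P * adj2 Q) * (Q * K) by rewrite -mulrA [adj2 Q * _]mulrA adj2_det1l ?mul1r.
move: (P * adj2 Q) (Q * K) => U V.
by rewrite mulrBl mulrBr !mulr1 mul1r; move: (U * V) => W; mring.
Qed.

End Sequence.

(** * Existence of the scales and of the widths *)

Section ScalesExist.
Context {R : realType}.

Lemma kam_scales_exist (L Psi : R -> R) (kappa r0 c : R) (A0 : 'M[R]_2) :
  weight_function L -> approximating_function Psi -> 0 < kappa < 1 -> 0 < r0 ->
  ln (Psi t) / L t @[t --> +oo] --> (0 : R) ->
  (exists2 a : R, 0 < a & (@lebesgue_measure R).-integrable `[a, +oo[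
     (fun t => (derive1 L t * ln (Psi t) / L t ^+ 2)%:E)) ->
  exists t b p r : nat -> R, [/\ r 0 = r0, c <= expR (p 0) &
    forall d (omega : 'rV[R]_d), (forall k, k != 0 ->
      kappa / Psi (norm1 (rvint k)) <= `|dot (rvint k) omega|) ->
    kam_scales omega L A0 kappa (r0 / 2) t b p r].
Proof.
move=> hL hPsi hk r00 lim0 int; have [k0 k1] := andP hk.
have [L0 iL dL sL] := hL; have [iP dP xP sP] := hPsi.
(* The sum dominates at once each quantity that exp(p 0) has to exceed. *)
pose K := Num.max c 0 + 100 + (mnorm A0 + 1) + kappa^-1.
have m0 : 0 <= Num.max c 0 by rewrite le_max lexx orbT.
have mc : c <= Num.max c 0 by rewrite le_max lexx.
have A00 := mnorm_ge0 A0; have ki0 : 0 < kappa^-1 by rewrite invr_gt0.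
have K1 : 100 < K by rewrite /K; lra.
have K0 : 0 < ln K by apply: ln_gt0; lra.
have B0 : 0 < 100 * (1000 * ln K) by move: K0; clear; lra.
have e0 : 0 < (100^-1 * 1000^-1 : R) by lra.
have r6 : 0 < r0 / 6 by rewrite divr_gt0.
have [t [b [b0 bb [t0 tm] tt bs]]] := scales hL hPsi lim0 int B0 e0 r6.
(* A loss of width 3 b_j / Lambda(t_j) damps the frequencies beyond t_j / 8 by exp(- 3/2 b_j), since
   Lambda is at least Lambda(t_j) / 8 there and 2 pi >= 4. The losses sum to at most 3 r0 / 6. *)
pose p j := b j / 100 / 1000; pose r n := r0 - 3 * \sum_(j < n) b j / L (t j).
have KE : K <= expR (p 0).
  rewrite -[K]lnK ?posrE; last by lra.
  by rewrite ler_expR /p; clear -b0; lra.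
have bp j : b j = 100 * (1000 * p j) by rewrite /p; clear; lra.
have bge0 j : 0 <= b j.
  elim: j => [|j IH]; first by clear -b0 B0; lra.
  by have := bb j; clear -IH; lra.
have Lt j : 0 < L (t j) by exact: weight_gt0.
have kE j : expR (- p j) <= kappa.
  rewrite expRN -[leRHS]invrK lef_pV2 ?posrE ?expR_gt0//.
  apply: (@le_trans _ _ (expR (p 0))); first by move: KE; rewrite /K; clear -m0 A00; lra.
  rewrite ler_expR /p; suff : b 0 <= b j by clear; lra.
  elim: j => [//|j IH]; have := bb j; have := bge0 j; clear -IH; lra.
exists t, b, p, r; split; first by rewrite /r big_ord0 mulr0 subr0.
  by move: KE; rewrite /K; clear -mc m0 A00 ki0; lra.
move=> d omega hom; split => //.
- by rewrite divr_gt0.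
- by move=> j; rewrite /r; have := bs j; clear; lra.
- move=> j; rewrite /r big_ord_recr/=; have : 0 <= b j / L (t j) by rewrite divr_ge0// ltW.
  by clear; lra.
- by move: KE; rewrite /K => KE; split; [exact: bge0|clear -KE m0 A00 ki0; lra..].
- by move=> j; have [h1 _] := tt j; split.
- move=> j k kn0 kt; rewrite /phase freq1.
  have n1 := rvint_neq0_norm1 (R := R) kn0.
  have P1 : 1 <= Psi (norm1 (rvint k : 'rV[R]_d)).
    by apply: le_trans (xP _ (le_trans ler01 n1)).
  have PE : Psi (norm1 (rvint k : 'rV[R]_d)) <= expR (p j).
    have [_ h] := tt j; apply: (@le_trans _ _ (Psi (t (j + 23)%N))).
      move: kt; rewrite le_eqVlt => /orP[/eqP->//|/(iP _ _ (le_trans ler01 n1))]; exact: ltW.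
    rewrite -ler_ln ?posrE ?expR_gt0 ?expRK//.
      by apply: (le_trans h); rewrite /p; clear; lra.
    exact: lt_le_trans (t0 _) (xP _ (ltW (t0 _))).
  have P0 : 0 < Psi (norm1 (rvint k : 'rV[R]_d)) := lt_le_trans ltr01 P1.
  have h : expR (- (2 * p j)) <= kappa / Psi (norm1 (rvint k : 'rV[R]_d)).
    have -> : - (2 * p j) = - p j + - p j by clear; lra.
    rewrite expRD ler_pM ?expR_ge0 ?kE//.
    by rewrite expRN lef_pV2 ?posrE ?expR_gt0.
  apply: (le_trans h); apply: (le_trans (hom k kn0)).
  rewrite normrM ler_peMl//; have := pi_ge2 R => pi2; rewrite ger0_norm; clear -pi2; lra.
- move=> j k kt; have tj := t0 j.
  have kn0 : k != 0.
    apply/eqP => k00; move: kt; rewrite k00 /norm1 big1; last by move=> i _; rewrite !mxE normr0.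
    by clear -tj; lra.
  rewrite /wt -expRD ler_expR.
  have rE : r j.+1 = r j - 3 * (b j / L (t j)) by rewrite /r big_ord_recr/=; ring.
  have lamE : L (t j) / 8 <= lam L 1 k.
    rewrite /lam (negPf kn0) freq1; apply: (@le_trans _ _ (L (t j / 8))).
      have dbl x : 0 <= x -> L (x + x) <= L x + L x by move=> x0; exact: sL.
      have t8 : 0 <= t j / 8 by clear -tj; lra.
      have h1 := dbl _ t8; have h2 := dbl _ (addr_ge0 t8 t8).
      have h3 := dbl _ (addr_ge0 (addr_ge0 t8 t8) (addr_ge0 t8 t8)).
      move: h3; have -> : t j / 8 + t j / 8 + (t j / 8 + t j / 8) +
        (t j / 8 + t j / 8 + (t j / 8 + t j / 8)) = t j by field.
      by move: h1 h2; clear; lra.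
    by apply: weight_le => //; [clear -tj; lra|exact: ltW].
  suff : 3 / 2 * b j <= 2 * pi * lam L 1 k * (3 * (b j / L (t j))).
    by rewrite rE; move: (2 * pi * lam L 1 k) (r j) => x y; rewrite mulrBr; clear; lra.
  have q0 : 0 <= b j / L (t j) by rewrite divr_ge0// ltW.
  have h : 2 * 2 * (L (t j) / 8) * (3 * (b j / L (t j))) <= 2 * pi * lam L 1 k * (3 * (b j / L (t j))).
    have q3 : 0 <= 3 * (b j / L (t j)) by rewrite mulr_ge0.
    have l0 : 0 <= L (t j) / 8 by rewrite divr_ge0// ltW.
    have p4 : 2 * 2 <= 2 * pi :> R by have := pi_ge2 R; clear; lra.
    by apply: (ler_wpM2r q3); apply: ler_pM.
  apply: le_trans h; rewrite le_eqVlt; apply/orP; left; apply/eqP; field.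
  by rewrite gt_eqF.
Qed.

End ScalesExist.

(** * From states to the objects of the theorem *)

Section Conclusion.
Context {R : realType} {d : nat}.
Variables (omega : 'rV[R]_d) (L : R -> R) (A0 : 'M[R]_2) (F0 : 'rV[R]_d -> 'M[R]_2).
Variables (kappa s0 s1 : R) (t b p r : nat -> R).
Implicit Types (x : 'rV[R]_d) (j : nat) (A : 'M[R]_2) (psi Ab Fb Z : 'rV[R]_d -> 'M[R]_2).

Hypothesis ks : @kam_scales R d omega L A0 kappa s1 t b p r.
Hypothesis s01 : s1 = 1000 * (1000 * s0).

Record almost_reduced j psi A Ab Fb Z : Prop := AlmostReduced {
  ar_detZ : forall x, \det (Z x) = 1;
  ar_trA : \tr A = 0;
  ar_trAb : forall x, \tr (Ab x) = 0;
  ar_trFb : forall x, \tr (Fb x) = 0;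
  ar_det : forall x, \det (psi x) = 1;
  ar_Z : bnd 1 (wt L 1 s0) (fun x => Z x - 1) (expR (- (96 / 100 * b 0)));
  ar_Ab : exists y, bnd 1 (wt L 1 s0) Ab y;
  ar_Fb : bnd 1 (wt L 1 s0) Fb (expR (- (3 / 4 * b j)));
  ar_psi : bnd 2 (wt L 2 s0) psi (expR (b j / 1000));
  ar_dpsi : forall x, dM omega psi (Ab x * psi x - psi x * A) x;
  ar_dZ : forall x, dM omega Z ((A0 + F0 x) * Z x - Z x * (Ab x + Fb x)) x }.

Local Notation valid := (valid omega L A0 F0 kappa s0 s1 t b p r).
Local Notation X := (@out_X R d).
Local Notation Aout := (out_A omega).

Lemma weight_s0 : weight (wt L 1 s0 : 'rV[int]_d -> R).
Proof. by apply: (wt_weight (ks_L ks)); exact: ltW (s0_gt0 ks s01). Qed.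

Lemma zbound_le j : zbound b j <= expR (- (97 / 100 * b 0)).
Proof. by rewrite /zbound gerBl expR_ge0. Qed.

Lemma valid_bounds j S : valid j S ->
  [/\ bnd 1 (wt L 1 s0) (fun x => st_Z S x - 1) (expR (- (97 / 100 * b 0))),
      exists y, bnd 1 (wt L 1 s0) (fun x => st_Ab S x - X S x) y,
      bnd 1 (wt L 1 s0) (fun x => st_F S x + X S x) (2 * expR (- b j)),
      (forall x, \det (st_Z S x) = 1) /\ (forall x, \tr (st_Ab S x - X S x) = 0) /\
      forall x, \tr (st_F S x + X S x) = 0
    & forall x, dM omega (st_Z S) ((A0 + F0 x) * st_Z S x - st_Z S x * (st_Ab S x + st_F S x)) x].
Proof.
move=> v; have [[_ _ trX _] _ bX _] := valid_out ks s01 v.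
have [M [C [be [pb [T [rd _ _]]]]]] := v; have wW := weight_s0.
have w0 k : wt L 1 s0 k <= wt L 1 (r j) (k : 'rV[int]_d).
  apply: (wt_le (ks_L ks) 1 k); apply: le_trans (ks_r ks j).
  by have := s0_gt0 ks s01; rewrite s01; clear -ks s01; lra.
split.
- by apply: (bnd_le (zbound_le j)); exact: bnd_wle w0 (rd_Z rd).
- have [y hy] := rd_Ab rd; exists (y + expR (- b j)).
  have h := bndB wW (bnd_wle w0 hy) bX; exact: h.
- apply: bnd_le (bndD (bnd_wle w0 (rd_F rd)) bX); by rewrite mulrDl mul1r.
- split; first exact: rd_detZ rd.
  by split=> x; [rewrite raddfB/= (rd_trAb rd) trX subrr|rewrite mxtraceD (rd_trF rd) trX addr0].
- exact: rd_dZ rd.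
Qed.

Lemma valid_almost_reduced j S : valid j S -> almost_reduced j (st_chi S) (Aout S)
  (fun x => st_Ab S x - X S x) (fun x => st_F S x + X S x) (st_Z S).
Proof.
move=> v; have [[dchi _ _ trA] dch _ bchi] := valid_out ks s01 v.
have [bZ bAb bF [dZ [trAb trF]] dZ'] := valid_bounds v.
have [pj bp bb] := ks_bounds ks j; have [_ bp0 _] := ks_bounds ks 0.
have b00 := ks_b_ge0 ks 0.
split => //.
- by apply: bnd_le bZ; rewrite ler_expR; clear -ks s01 b00; lra.
- apply: bnd_le bF.
  have := expR_shrink ks (j := j) (x := - b j) (y := - (3 / 4 * b j)) ltac:(lra).
  by have := expR_ge0 (- b j); clear -ks s01; lra.
- move=> x; apply: (dM_eq (dZ' x)).
  by rewrite addrACA addNr addr0.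
Qed.

(** The conjugacy is frozen at its value chi_1 of step j1. The quotient W = chi_j chi_1^-1 is moved
    into Z and conjugates the error, while the reducible part of step j1 is corrected by chi_1 D
    chi_1^-1, so that chi_1 reduces it to the constant of step j. The condition 4 b 0 <= b j1 brings
    W within the budget of Z. *)
Lemma continued_almost_reduced (S : nat -> kam_state) j1 : (forall j, valid j (S j)) ->
  (forall j, (j1 <= j)%N -> continued L s0 b j (S j) (S j.+1)) -> 4 * b 0 <= b j1 ->
  forall j, (j1 <= j)%N -> exists Ab Fb Z,
    almost_reduced j (st_chi (S j1)) (Aout (S j)) Ab Fb Z.
Proof.
move=> v c bj1 j jj; have wW := weight_s0; have w0W := wt0W (d := d) ks s01.
have [[dchi hchi _ trA] dch _ bchi] := valid_out ks s01 (v j).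
have [bZ _ bF [dZ [_ trF]] dZ'] := valid_bounds (v j).
have [[dchi1 hchi1 _ trA1] dch1 _ bchi1] := valid_out ks s01 (v j1).
have [_ [y bAb1] _ [_ [trAb1 _]] _] := valid_bounds (v j1).
have [pj bp bb] := ks_bounds ks j; have [p0 bp0 _] := ks_bounds ks 0.
have b01 := ks_b_mono ks jj.
have sh := expR_shrink ks (j := 0); have shj := expR_shrink ks (j := j).
have bW := continued_bound ks s01 v c jj.
pose W x := st_chi (S j) x * adj2 (st_chi (S j1) x).
have E1 : 100 * expR (- b 0) <= expR (- (97 / 100 * b 0)) by apply: sh; lra.
have {}bW : bnd 1 (wt L 1 s0) (fun x => W x - 1) (expR (- (97 / 100 * b 0))).
  apply: bnd_le bW; have : expR (- (b j1 / 4)) <= expR (- b 0) by rewrite ler_expR; lra.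
  have := expR_ge0 (- (b j / 4)); have := expR_ge0 (- b 0); lra.
have E2 : expR (- (97 / 100 * b 0)) <= 100^-1.
  by have := sh (- (97 / 100 * b 0)) 0 ltac:(lra); rewrite expR0; lra.
have bW3 : bnd 1 (wt L 1 s0) W 3.
  apply: (bnd_le _ (bnd_ext _ (bndD bW (bnd_cst 1 wW 1)))) => [|x]; last by rewrite subrK.
  rewrite mnorm1; lra.
have dW x : \det (W x) = 1 by apply: det1M => //; rewrite det_adj2.
have alg1 (K P P' B B1 : 'M[R]_2) : P' * P = 1 ->
    K * P - P * B1 = (K + P * (B - B1) * P') * P - P * B.
  by move=> i; rewrite mulrDl -[P * _ * P' * P]mulrA i mulr1 mulrBr addrA [RHS]addrAC addrK.
have alg2 (a z k f w w' x0 ab : 'M[R]_2) : w * w' = 1 ->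
    (a * z - z * (k + f)) * w + z * ((k - x0) * w - w * ab) =
    a * (z * w) - z * w * (ab + w' * (f + x0) * w).
  move=> i; have -> : z * w * (ab + w' * (f + x0) * w) = z * w * ab + (z * f * w + z * x0 * w).
    by rewrite mulrDr !mulrA -[z * w * w']mulrA i mulr1 mulrDr mulrDl.
  rewrite !(mulrBl, mulrBr) !(mulrDl, mulrDr) !mulrA.
  move: (a * z * w) (z * k * w) (z * f * w) (z * x0 * w) (z * w * ab) => u1 u2 u3 u4 u5; mring.
pose D := Aout (S j) - Aout (S j1).
pose Ab x := st_Ab (S j1) x - X (S j1) x + st_chi (S j1) x * D * adj2 (st_chi (S j1) x).
have trD : \tr D = 0 by rewrite /D raddfB/= trA trA1 subrr.
exists Ab, (fun x => adj2 (W x) * (st_F (S j) x + X (S j) x) * W x), (fun x => st_Z (S j) x * W x).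
have inv1 x : adj2 (st_chi (S j1) x) * st_chi (S j1) x = 1 by rewrite adj2_det1l.
have dpsi0 x : dM omega (st_chi (S j1)) (Ab x * st_chi (S j1) x - st_chi (S j1) x * Aout (S j)) x.
  apply: (dM_eq (dch1 x)); exact: alg1.
split => //.
- by move=> x; apply: det1M.
- by move=> x; rewrite /Ab mxtraceD trAb1 tr_conj// trD addr0.
- by move=> x; rewrite tr_conjV.
- have bZ1 := bnd_ext (fun x => subrK 1 (st_Z (S j) x)) (bndD bZ (bnd_cst 1 wW 1)).
  apply: (bnd_le _ (bnd_ext _ (bndD bZ (bndM wW bZ1 bW)))) => [|x].
  + rewrite mnorm1; have h := sh (- (97 / 100 * b 0)) (- (96 / 100 * b 0)) ltac:(lra).
    have e0 := expR_ge0 (- (97 / 100 * b 0)).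
    have := ler_wpM2r e0 E2; lra.
  + by rewrite mulrBr mulr1 addrC addrA subrK.
- exists (y + expR (b j1 / 1000) * mnorm D * expR (b j1 / 1000)).
  apply: bndD bAb1 _; apply: bnd21; last by move=> x i; exact: half_periodic_conj hchi1 x i.
  have h := bndM w0W (bndM w0W bchi1 (bnd_cst 2 w0W D)) (bnd_adj2 w0W bchi1); exact: h.
- apply: (bnd_le _ (bndM wW (bndM wW (bnd_adj2 wW bW3) bF) bW3)).
  have := shj (- b j) (- (3 / 4 * b j)) ltac:(lra).
  by have := expR_ge0 (- b j); lra.
- by apply: bnd_le bchi1; rewrite ler_expR; lra.
- move=> x; have dWx := dMM (dch x) (dM_adj2 (dpsi0 x)).
  apply: (dM_eq (dMM (dZ' x) dWx)).
  have trAb : \tr (Ab x) = 0 by rewrite /Ab mxtraceD trAb1 tr_conj// trD addr0.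
  have -> : adj2 (Ab x * st_chi (S j1) x - st_chi (S j1) x * Aout (S j)) =
      Aout (S j) * adj2 (st_chi (S j1) x) - adj2 (st_chi (S j1) x) * Ab x.
    rewrite adj2D -scaleN1r adj2Z !adj2M (adj2_tr0 trA) (adj2_tr0 trAb) scaleN1r.
    by rewrite mulrN mulNr opprK addrC.
  have WW : W x * adj2 (W x) = 1 by rewrite adj2_det1.
  have -> : ((st_Ab (S j) x - X (S j) x) * st_chi (S j) x - st_chi (S j) x * Aout (S j)) *
      adj2 (st_chi (S j1) x) + st_chi (S j) x * (Aout (S j) * adj2 (st_chi (S j1) x) -
      adj2 (st_chi (S j1) x) * Ab x) = (st_Ab (S j) x - X (S j) x) * W x - W x * Ab x.
    rewrite /W mulrBl mulrBr !mulrA addrA subrK//.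
  exact: alg2.
Qed.

(** eps lies between the square roots of two consecutive error sizes, and the later state is used:
    its error exp(- 3/4 b j.+1) stays below eps even with the constant of [unorm_bnd]. With zeta =
    1/100 the allowed size of [psi] is at least exp(b j / 400), while its bound exp(b j.+1 / 1000)
    is at most exp(3/2000 b j). *)
Lemma almost_reduced_outputs j psi A Ab Fb Z (eps0 eps : R) :
  almost_reduced j.+1 psi A Ab Fb Z -> 2 * expR (2 * pi * L 0 * s0) <= expR (p 0) ->
  eps0 = expR (- b 0) / 8 -> expR (- (b j.+1 / 2)) <= eps -> eps < expR (- (b j / 2)) ->
  [/\ 0 < s0, ultradiff 1 L s0 SL2 Z, sl2 A,
      ultradiff 1 L s0 sl2 Ab /\ ultradiff 1 L s0 sl2 Fb & ultradiff 2 L s0 SL2 psi] /\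
  [/\ reducible omega Ab A psi /\ (unorm 2 L s0 psi <= (eps `^ (- (1 / 100 / 2)))%:E)%E,
      (unorm 1 L s0 Fb <= eps%:E)%E,
      forall x, is_derive x omega Z ((A0 + F0 x) *m Z x - Z x *m (Ab x + Fb x)),
      (unorm 1 L s0 (fun x => Z x - 1%:M)%R <= (eps0 `^ (9 / 10))%:E)%E
    & (unorm 1 L s0 (fun x => invmx (Z x) - 1%:M)%R <= (eps0 `^ (9 / 10))%:E)%E].
Proof.
move=> ar hL0 eps0E epsl epsu.
have wW := weight_s0; have sp := s0_gt0 ks s01; have hL := ks_L ks.
have [pj bp bb] := ks_bounds ks j; have [pj1 bp1 _] := ks_bounds ks j.+1.
have [p0 bp0 _] := ks_bounds ks 0; have [c100 _ _] := ks_const ks 0.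
have p01 : p 0 <= p j.+1 by have := ks_b_mono ks (leq0n j.+1); lra.
have eps0' : 0 < eps := lt_le_trans (expR_gt0 _) epsl.
have fin q F y : (0 < q)%N -> bnd q (wt L q s0) F y -> (unorm q L s0 F < +oo)%E.
  move=> q0 bF; apply: le_lt_trans (unorm_bnd hL q0 (ltW sp) bF) _; exact: ltry.
have ub q F y u v : (0 < q)%N -> bnd q (wt L q s0) F y -> y <= expR u -> u + p 0 <= v ->
    (unorm q L s0 F <= (expR v)%:E)%E.
  move=> q0 bF yu uv; apply: le_trans (unorm_bnd hL q0 (ltW sp) bF) _; rewrite lee_fin.
  apply: (expR_mul_le _ (bnd_ge0 bF) hL0 yu); last by lra.
  by rewrite mulr_ge0// expR_ge0.
have eps9 : eps0 `^ (9 / 10) = expR (- (9 / 10 * (b 0 + ln 8))).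
  rewrite eps0E /powR gt_eqF ?divr_gt0 ?expR_gt0//; congr expR.
  by rewrite ln_div ?posrE ?expR_gt0// expRK; lra.
have l8 : ln 8 <= p 0.
  rewrite -[p 0]expRK ler_ln ?posrE ?expR_gt0//; lra.
have bZ := ar_Z ar.
split; split => //.
- split; first exact: ar_detZ ar.
  have bZ' := bnd_ext (fun x => subrK 1 (Z x)) (bndD bZ (bnd_cst 1 wW 1)).
  exact: fin bZ'.
- exact: ar_trA ar.
- split; split; [exact: ar_trAb ar| |exact: ar_trFb ar|].
  + by have [y hy] := ar_Ab ar; exact: fin hy.
  + exact: fin (ar_Fb ar).
- by split; [exact: ar_det ar|exact: fin (ar_psi ar)].
- split; first by move=> x; exact: dM_is_derive (ar_dpsi ar x).
  rewrite /powR gt_eqF//; apply: (ub _ _ _ _ _ _ _ (ar_psi ar) (lexx _)) => //.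
  have : ln eps <= - (b j / 2).
    by rewrite -[leRHS]expRK ler_ln ?posrE ?expR_gt0// ltW.
  move: (ln eps) => l; lra.
- apply: (@le_trans _ _ (expR (- (b j.+1 / 2)))%:E); last by rewrite lee_fin.
  by apply: (ub _ _ _ _ _ _ _ (ar_Fb ar) (lexx _)) => //; lra.
- by move=> x; exact: dM_is_derive (ar_dZ ar x).
- by rewrite eps9; apply: (ub _ _ _ _ _ _ _ bZ (lexx _)) => //; lra.
- have inv x : adj2 (Z x - 1) = invmx (Z x) - 1%:M.
    rewrite det1_invmx ?(ar_detZ ar)// adj2D -(scaleN1r 1) adj2Z adj21 scaleN1r.
    by [].
  by rewrite eps9; apply: (ub _ _ _ _ _ _ _ (bnd_ext inv (bnd_adj2 wW bZ)) (lexx _)) => //; lra.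
Qed.

End Conclusion.

Lemma norm_le_mnorm (R : realType) (M : 'M[R]_2) : `|M| <= mnorm M.
Proof.
have h i : `|M i.1 i.2| <= mnorm M by exact: mnorm_entry.
rewrite [leLHS]/Num.norm/= mx_normE -[leRHS]/((NngNum (mnorm_ge0 M))%:num) num_le.
by apply/bigmax_leP; split => [|i _]; rewrite -num_le/=; [exact: mnorm_ge0 | exact: h i].
Qed.

(** * Locating eps among the scales *)

Section Growth.
Context {R : realType}.
Variable b : nat -> R.
Hypotheses (b0 : 0 < b 0) (bb : forall j, 6 / 5 * b j <= b j.+1).

Lemma growth_linear n : b 0 + n%:R * (b 0 / 5) <= b n.
Proof.
elim: n => [|n IH]; first by rewrite mul0r addr0.
have : 0 <= n%:R * (b 0 / 5) by rewrite mulr_ge0// divr_ge0// ltW.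
rewrite -(natr1 n) mulrDl mul1r; move: IH (bb n); move: (_ * (b 0 / 5)) => y; lra.
Qed.

Lemma growth_gt0 n : 0 < b n.
Proof.
apply: lt_le_trans (growth_linear n); rewrite ltr_pwDl// mulr_ge0// divr_ge0// ltW//.
Qed.

Lemma growth_lt i j : (i < j)%N -> b i < b j.
Proof.
move=> /subnKC <-; elim: (j - i.+1)%N => [|k IH].
  by rewrite addn0; have := bb i; have := growth_gt0 i; lra.
by rewrite addnS (lt_trans IH)//; have := bb (i.+1 + k); have := growth_gt0 (i.+1 + k); lra.
Qed.

Lemma growth_unbounded (y : R) : exists N, forall n, (N <= n)%N -> y <= b n.
Proof.
have c0 : 0 < b 0 / 5 by rewrite divr_gt0.
exists (Num.truncn (y / (b 0 / 5))).+1 => n Nn; apply: le_trans (growth_linear n).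
have : y / (b 0 / 5) < n%:R by apply: lt_le_trans (truncnS_gt _) _; rewrite ler_nat.
by rewrite ltr_pdivrMr// => /ltW h; apply: (le_trans h); rewrite lerDr ltW.
Qed.

Lemma growth_index (eps : R) : 0 < eps -> eps < expR (- (b 0 / 2)) ->
  exists j, expR (- (b j.+1 / 2)) <= eps /\ eps < expR (- (b j / 2)).
Proof.
move=> e0 e1; have [N hN] := growth_unbounded (- 2 * ln eps).
have exP : exists n, expR (- (b n / 2)) <= eps.
  exists N; rewrite -ler_ln ?posrE ?expR_gt0// expRK; have := hN N (leqnn N); lra.
case: (ex_minnP exP) => -[|m] hm mmin; first by move: hm; rewrite leNgt e1.
exists m; split => //; rewrite ltNge; apply/negP => h.
by have := mmin m h; rewrite ltnn.
Qed.

Lemma growth_index_ge (eps : R) i j : expR (- (b j.+1 / 2)) <= eps ->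
  eps <= expR (- (b i / 2)) -> (i <= j.+1)%N.
Proof.
move=> h1 h2; rewrite leqNgt; apply/negP => /growth_lt ij.
by have := le_trans h1 h2; rewrite ler_expR; lra.
Qed.

End Growth.

Unset Implicit Arguments.
Set Strict Implicit.

Theorem theorem1p2 (R : realType) (L Psi : R -> R) (kappa r0 : R)
    (A0 : 'M[R]_2)
    (hL : weight_function L) (hPsi : approximating_function Psi)
    (hkappa : 0 < kappa < 1) (hr0 : 0 < r0) (hA0 : sl2 A0) :
  exists eps0 : R, 0 < eps0 /\
  forall (d : nat) (omega : 'rV[R]_d) (F0 : 'rV[R]_d -> 'M[R]_2),
    (1 <= d)%N ->
    rationally_independent omega ->
    (forall i, `|omega 0 i| <= 1) ->
    brjuno_russmann L Psi kappa omega ->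
    ultradiff 1 L r0 sl2 F0 ->
    (unorm 1 L r0 F0 <= eps0%:E)%E ->
  exists (zeta : R) (r : R -> R) (Z : R -> 'rV[R]_d -> 'M[R]_2)
    (A : R -> 'M[R]_2) (Abar Fbar psi : R -> 'rV[R]_d -> 'M[R]_2),
    [/\ 0 < zeta < 1 / 8,
        forall eps, 0 < eps <= eps0 ->
          [/\ 0 < r eps, ultradiff 1 L (r eps) SL2 (Z eps), sl2 (A eps),
              ultradiff 1 L (r eps) sl2 (Abar eps) /\
              ultradiff 1 L (r eps) sl2 (Fbar eps)
            & ultradiff 2 L (r eps) SL2 (psi eps)] /\
          [/\ reducible omega (Abar eps) (A eps) (psi eps) /\
              (unorm 2 L (r eps) (psi eps) <= (eps `^ (- (zeta / 2)))%:E)%E,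
              (unorm 1 L (r eps) (Fbar eps) <= eps%:E)%E,
              forall theta, is_derive theta omega (Z eps)
                ((A0 + F0 theta) *m Z eps theta
                 - Z eps theta *m (Abar eps theta + Fbar eps theta)),
              (unorm 1 L (r eps) (fun theta => Z eps theta - 1%:M)%R
                 <= (eps0 `^ (9 / 10))%:E)%E
            & (unorm 1 L (r eps) (fun theta => invmx (Z eps theta) - 1%:M)%R
                 <= (eps0 `^ (9 / 10))%:E)%E],
        exists2 l : R, 0 < l & r eps @[eps --> 0^'+] --> l
      & (exists2 eps1 : R, 0 < eps1 <= eps0 &
           exists psi0 : 'rV[R]_d -> 'M[R]_2,
             forall eps, 0 < eps <= eps1 -> psi eps = psi0) \/
        (forall delta : R, 0 < delta ->
           exists2 eps : R, 0 < eps <= eps0 &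
             eps < delta /\ `|A eps| <= kappa * eps `^ zeta)].
Proof.
(* [eps0] is chosen before omega, whereas the limit and the integral belong to the hypothesis on
   omega. They do not involve omega: if they fail, that hypothesis is false for every omega and any
   [eps0] will do. *)
have [[lim0 int]|noint] := pselect (ln (Psi t) / L t @[t --> +oo] --> (0 : R) /\
    exists2 a : R, 0 < a & (@lebesgue_measure R).-integrable `[a, +oo[
     (fun t => (derive1 L t * ln (Psi t) / L t ^+ 2)%:E)); last first.
  by exists 1; split => // d omega F0 _ _ _ [_ h1 h2]; exfalso; apply: noint.
pose s1 := r0 / 2; pose s0 := s1 / 1000 / 1000.
have s01 : s1 = 1000 * (1000 * s0) by rewrite /s0; lra.
have [t [b [p [r [rE cE hks]]]]] :=
  kam_scales_exist (2 * expR (2 * pi * L 0 * s0)) A0 hL hPsi hkappa hr0 lim0 int.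
(* The 8 is the constant of [bnd_unorm]. *)
exists (expR (- b 0) / 8); split; first by rewrite divr_gt0// expR_gt0.
move=> d omega F0 d1 _ _ [hom _ _] [trF _] hF.
have ks := hks d omega hom.
have bF : bnd 1 (wt L 1 (r 0)) F0 (expR (- b 0)).
  rewrite rE; have h := bnd_unorm hL (ltn0Sn 0) (ltW hr0) hF.
  by apply: (bnd_le _ h); rewrite mulrCA mulfV ?mulr1.
have [S hS] := kam_sequence ks s01 hA0 trF bF.
have v j : valid omega L A0 F0 kappa s0 s1 t b p r j (S j) by have [] := hS j.
have b0 : 0 < b 0.
  have [c100 _ _] := ks_const ks 0; have h := ks_p ks 0.
  have p0 : 0 < p 0 by rewrite -expR_gt1; lra.
  rewrite h; lra.
have bb j : 6 / 5 * b j <= b j.+1 by have /andP[] := ks_b ks j.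
set eps0 := expR (- b 0) / 8.
have eps00 : 0 < eps0 by rewrite divr_gt0// expR_gt0.
have eps0l : eps0 < expR (- (b 0 / 2)).
  have h : expR (- b 0) <= expR (- (b 0 / 2)) by rewrite ler_expR; lra.
  by have := expR_gt0 (- b 0); rewrite /eps0; lra.
have idx eps : exists j, 0 < eps <= eps0 ->
    expR (- (b j.+1 / 2)) <= eps /\ eps < expR (- (b j / 2)).
  have [/andP[e1 e2]|] := pselect (0 < eps <= eps0); last by exists 0%N.
  by have [j hj] := growth_index b0 bb e1 (le_lt_trans e2 eps0l); exists j.
have [jx hjx] := choice idx.
(* The final alternative: either no step is accepted from some index on, or accepted steps occur
   beyond every index. *)
have [[j1 noacc]|acc] := pselect (exists j1, forall j, (j1 <= j)%N ->
    ~ accepted kappa b j.+1 (S j.+1)).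
- have [N hN] := growth_unbounded b0 bb (4 * b 0).
  pose j2 := maxn j1 N; have bj2 : 4 * b 0 <= b j2 by apply: hN; exact: leq_maxr.
  have cont j : (j2 <= j)%N -> continued L s0 b j (S j) (S j.+1).
    by move=> jj; have [_ [/(noacc _ (leq_trans (leq_maxl _ _) jj))|]] := hS j.
  pose eps1 := Num.min eps0 (expR (- (b j2 / 2))).
  have out eps : exists o : ('rV[R]_d -> 'M[R]_2) * 'M[R]_2 * ('rV[R]_d -> 'M[R]_2) *
      ('rV[R]_d -> 'M[R]_2) * ('rV[R]_d -> 'M[R]_2),
      (0 < eps <= eps0 -> almost_reduced omega L A0 F0 s0 b (jx eps).+1 o.1.1.1.1 o.1.1.1.2
        o.1.1.2 o.1.2 o.2) /\ (0 < eps <= eps1 -> o.1.1.1.1 = st_chi (S j2)).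
    have [le1|gt1] := leP eps eps1; last first.
      exists (st_chi (S (jx eps).+1), out_A omega (S (jx eps).+1),
        (fun x => st_Ab (S (jx eps).+1) x - out_X (S (jx eps).+1) x),
        (fun x => st_F (S (jx eps).+1) x + out_X (S (jx eps).+1) x), st_Z (S (jx eps).+1)).
      split; last by rewrite andbF.
      by move=> _ /=; exact: (valid_almost_reduced ks s01).
    have [he|nhe] := pselect (0 < eps <= eps0); last first.
      exists (st_chi (S j2), 0, fun=> 0, fun=> 0, fun=> 0).
      by split => // h; exfalso; exact: nhe.
    have [h1 h2] := hjx eps he.
    have jj : (j2 <= (jx eps).+1)%N.
      apply: (growth_index_ge b0 bb h1); apply: (le_trans le1); by rewrite ge_min lexx orbT.
    have [Ab [Fb [Z ar]]] := continued_almost_reduced ks s01 v cont bj2 jj.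
    by exists (st_chi (S j2), out_A omega (S (jx eps).+1), Ab, Fb, Z).
  have [w hw] := choice out.
  exists (1 / 100), (fun=> s0), (fun eps => (w eps).2), (fun eps => (w eps).1.1.1.2),
    (fun eps => (w eps).1.1.2), (fun eps => (w eps).1.2), (fun eps => (w eps).1.1.1.1).
  split.
  + by apply/andP; split; lra.
  + move=> eps he; have [h1 h2] := hjx eps he.
    exact: (almost_reduced_outputs ks s01 (proj1 (hw eps) he) cE erefl h1 h2).
  + exists s0; first exact: (s0_gt0 ks s01).
    exact: cvg_cst.
  + left; exists eps1; first by rewrite lt_min eps00 expR_gt0 ge_min lexx.
    by exists (st_chi (S j2)) => eps he; exact: (proj2 (hw eps) he).
- exists (1 / 100), (fun=> s0), (fun eps => st_Z (S (jx eps).+1)),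
    (fun eps => out_A omega (S (jx eps).+1)),
    (fun eps x => st_Ab (S (jx eps).+1) x - out_X (S (jx eps).+1) x),
    (fun eps x => st_F (S (jx eps).+1) x + out_X (S (jx eps).+1) x),
    (fun eps => st_chi (S (jx eps).+1)).
  split.
  + by apply/andP; split; lra.
  + move=> eps he; have [h1 h2] := hjx eps he.
    exact: (almost_reduced_outputs ks s01 (valid_almost_reduced ks s01 (v _)) cE erefl h1 h2).
  + exists s0; first exact: (s0_gt0 ks s01).
    exact: cvg_cst.
  + right=> delta delta0.
    have m0 : 0 < Num.min (delta / 2) eps0 by rewrite lt_min eps00 divr_gt0.
    have [N hN] := growth_unbounded b0 bb (- 2 * ln (Num.min (delta / 2) eps0)).
    have [j [Nj accj]] : exists j, (N <= j)%N /\ accepted kappa b j.+1 (S j.+1).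
      have [//|no] := pselect (exists j, (N <= j)%N /\ accepted kappa b j.+1 (S j.+1)).
      by exfalso; apply: acc; exists N => j Nj h; apply: no; exists j.
    (* The left end of the range of eps served by state j + 1, where eps^(1/100) = exp(- b j.+1 /
       200) is exactly the threshold in [accepted]. *)
    pose eps := expR (- (b j.+1 / 2)).
    have em : eps <= Num.min (delta / 2) eps0.
      rewrite -ler_ln ?posrE ?expR_gt0// expRK.
      by have := hN j.+1 (leqW Nj); lra.
    move: em; rewrite le_min => /andP[em1 em2].
    have he : 0 < eps <= eps0 by rewrite expR_gt0 em2.
    exists eps => //; split; first by lra.
    have [h1 h2] := hjx eps he.
    have jE : jx eps = j.
      apply/eqP; rewrite eqn_leq; apply/andP; split; last first.
        exact: (growth_index_ge b0 bb h1 (lexx _)).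
      rewrite -ltnS ltnNge; apply/negP => jl.
      have : b j.+1 <= b (jx eps) by exact: (ks_b_mono ks jl).
      by move: h2; rewrite ltr_expR; lra.
    rewrite jE; apply: (le_trans (norm_le_mnorm _)).
    rewrite /powR gt_eqF ?expR_gt0// expRK.
    have -> : 1 / 100 * - (b j.+1 / 2) = - (b j.+1 / 200) by lra.
    exact: (accepted_out omega accj).
Qed.
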